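(* Let $\Omega \subset \mathbb{R}^d$ be open, suppose that $u : \Omega \to \mathbb{R}$ solves $\Delta u = \lambda \cdot u$ with $\lambda \in \mathbb{R}$, $\lambda \neq 0$, and let $A$ be a connected component of the critical set $\mathrm{crit}(u)$. If there exists an open set $U \subset \Omega$ such that $U \cap A$ is a (nonempty) $(d-1)$-dimensional manifold, then $A$ is a proper real-analytic manifold of dimension $d-1$.
   Context: $\Delta$ is the Euclidean Laplacian, with sign convention $\Delta = -\sum_j \partial_j^2$. The critical set is $\mathrm{crit}(u) := |\nabla u|^{-1}(0) = \{x\in\Omega : \nabla u(x) = 0\}$. That $A$ is a proper real-analytic manifold of dimension $d-1$ means that $A$ is a properly embedded (i.e. closed in $\Omega$ as a subset) real-analytic submanifold of $\Omega$ of dimension $d-1$. *)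

(* Defs.v *)
From HB Require Import structures.
From mathcomp Require Export all_boot all_order all_algebra.
From mathcomp Require Export all_classical all_reals all_analysis.
Export Order.TTheory GRing.Theory Num.Theory.
Export numFieldNormedType.Exports.

Set Implicit Arguments.
Unset Strict Implicit.
Unset Printing Implicit Defensive.

Local Open Scope classical_set_scope.
Local Open Scope ring_scope.

(* R^d is 'rV[R]_d; its norm is the sup norm, which induces the Euclidean
   topology.  A function on an open set Omega is a total function of which only
   the values on Omega are ever used. *)

Section Calculus.
Context {R : realType} {d : nat}.
Implicit Types (f u : 'rV[R]_d -> R) (x : 'rV[R]_d) (Omega : set 'rV[R]_d).

Definition partial (j : 'I_d) f : 'rV[R]_d -> R :=
  fun x => 'D_(delta_mx 0 j : 'rV[R]_d) f x.

Fixpoint Ck (k : nat) Omega f : Prop :=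
  (forall x, Omega x -> {for x, continuous f}) /\
  (if k is k'.+1 then
     (forall x, Omega x ->
        forall j, derivable f x (delta_mx 0 j : 'rV[R]_d)) /\
     (forall j, Ck k' Omega (partial j f))
   else True).

Definition grad u x : 'rV[R]_d := \row_j partial j u x.

(* The nonnegative Laplacian. *)
Definition laplacian u x : R := - \sum_(j < d) partial j (partial j u) x.

Definition crit Omega u : set 'rV[R]_d := [set x | Omega x /\ grad u x = 0].

Definition solves_eigen Omega (lambda : R) u : Prop :=
  Ck 2 Omega u /\ forall x, Omega x -> laplacian u x = lambda * u x.

End Calculus.

Definition is_component {T : topologicalType} (X A : set T) : Prop :=
  exists2 x, X x & A = connected_component X x.

Section Analytic.
Context {R : realType} {d : nat}.

(* Sum over the multi-indices of total degree k, whose entries are all <= k. *)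
Definition degree_sum (b : {ffun 'I_d -> nat} -> R) (k : nat) : R :=
  \sum_(alpha : {ffun 'I_d -> 'I_k.+1} | (\sum_i alpha i)%N == k)
    b [ffun i => alpha i : nat].

Definition monomial (h : 'rV[R]_d) (alpha : {ffun 'I_d -> nat}) : R :=
  \prod_(i < d) h 0 i ^+ alpha i.

(* Since the terms are grouped by degree, absolute convergence of the multiple
   series is required separately. *)
Definition analytic_at (f : 'rV[R]_d -> R) (x : 'rV[R]_d) : Prop :=
  exists (a : {ffun 'I_d -> nat} -> R) (r : R), 0 < r /\
    forall h : 'rV[R]_d, `|h| < r ->
      cvgn (series (degree_sum (fun alpha => `|a alpha * monomial h alpha|))) /\
      series (degree_sum (fun alpha => a alpha * monomial h alpha)) @ \oo
        --> f (x + h).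

Definition analytic_on n (D : set 'rV[R]_d) (F : 'rV[R]_d -> 'rV[R]_n) : Prop :=
  forall x, D x -> forall j, analytic_at (fun y => F y 0 j) x.

End Analytic.

Definition inverse_on {S T : Type} (A : set S) (B : set T)
    (f : S -> T) (g : T -> S) : Prop :=
  f @` A = B /\ forall x, A x -> g (f x) = x.

Section Manifolds.
Context {R : realType} {d : nat}.

(* M is a topological m-manifold for the topology induced by R^d; Hausdorff and
   second countable are then automatic. *)
Definition topological_manifold (m : nat) (M : set 'rV[R]_d) : Prop :=
  forall p, M p ->
    exists (W : set 'rV[R]_d) (V : set 'rV[R]_m)
           (f : 'rV[R]_d -> 'rV[R]_m) (g : 'rV[R]_m -> 'rV[R]_d),
      [/\ open W, W p & open V] /\
      [/\ inverse_on (M `&` W) V f g,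
          {within M `&` W, continuous f} & {within V, continuous g}].

(* Embedded real-analytic submanifold: around each of its points, M is flattened
   onto R^m x {0} by a real-analytic diffeomorphism between open sets. *)
Definition analytic_submanifold (m : nat) (M : set 'rV[R]_d) : Prop :=
  forall p, M p ->
    exists (W V : set 'rV[R]_d) (phi psi : 'rV[R]_d -> 'rV[R]_d),
      [/\ open W, W p & open V] /\
      [/\ inverse_on W V phi psi, analytic_on W phi, analytic_on V psi &
          M `&` W =
            [set x | W x /\ forall j : 'I_d, (m <= j)%N -> phi x 0 j = 0]].

Definition closed_in (Omega M : set 'rV[R]_d) : Prop :=
  exists2 F : set 'rV[R]_d, closed F & M = F `&` Omega.

Definition proper_analytic_submanifold (m : nat) (Omega M : set 'rV[R]_d) :
    Prop :=
  analytic_submanifold m M /\ closed_in Omega M.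

End Manifolds.

(* Main.v *)
Require Import Defs.
From mathcomp Require Import ring lra zify.

(** Let A be the component and d = n + 1.

    Analyticity of u.  Comparing u, antisymmetrized by a reflection, with an explicit barrier
    on half a cube bounds each partial derivative of an eigenfunction at the centre of a cube
    of radius r <= 1 by a multiple of sup |u| / r ([brandt_one_sided], [grad_est]).  Difference
    quotients of u are eigenfunctions as well, so the estimate applies to them and shows that
    the second derivatives of u are again differentiable ([third_derivative]); hence every
    partial derivative of u is an eigenfunction ([sol_partial]).  Iterating the estimate k
    times with radius r / k gives derivatives of order k bounded by M C^k k! ([sol_bound]).
    Functions with such bounds form the class [ana_at]: it is closed under sums, products and
    inverses, it consists of sums of convergent power series ([ana_analytic_at]), and it obeys
    the identity theorem ([ana_identity]).

    Hypersurfaces.  If w is analytic, w p = 0 and the j-th partial derivative of w at p is not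
    0, then replacing the j-th coordinate by w is an analytic chart near p ([straighten]).
    A derivative of h \o psi, where psi is the inverse of the chart, is a word in fixed
    analytic vector fields applied to h, and [vfield_word_bound] controls such words; this
    takes the place of the composition of power series.  So the zero set of w near p is
    parametrized analytically by n variables ([slice]).

    Cells.  An n-cell is an injective continuous image of an open subset of R^n.  No nonempty
    open subset of R^(n+1) has such an image in R^n ([no_drop_of_dimension]); this follows from
    a Poincare-Miranda theorem on grids.  Therefore an analytic function of n variables that vanishes on an n-cell
    in R^n vanishes there to infinite order ([vanish_on_cell]): at a point of lowest order
    the cell would lie in a hypersurface, which has dimension n - 1.

    The component.  An analytic function has countably many critical values, by induction on
    the dimension ([countable_critical_values]), and A is connected, so u is constant on A
    ([constant_on_component]).  This constant is not 0.  Otherwise u vanishes on an n-cell of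
    critical points.  If its order of vanishing on the cell is finite, then at a point of
    lowest order k >= 2 the k-th derivative of u is a nonzero multiple of the k-th power of
    a conormal vector, and its trace cannot vanish although the equation says so
    ([flat_of_zero_cell]).  If the order is infinite, then u vanishes near a point, A contains
    a ball, and a ball is not an n-manifold ([exists_nonzero_cell]).

    Since lambda * u is not 0 on A, at each point of A some second derivative with respect to
    one variable x_j is not 0, so that A is locally contained in the hypersurface on which the
    derivative of u along x_j is 0.  If A contains an n-cell in this hypersurface, then all first
    derivatives of u vanish on the cell, hence on the whole hypersurface, which is therefore
    contained in A ([local_alternative]).  Consequently the points of A that lie on an n-cell in A
    form an open and closed subset of A.  It is not empty, so it is A, and A is a hypersurface
    near each of its points ([all_flattened]). *)

Set Implicit Arguments.
Unset Strict Implicit.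
Unset Printing Implicit Defensive.

Local Open Scope ring_scope.

(** * A Poincare-Miranda theorem on grids, modulo 2 *)

Section Grid.
Variable m : nat.
Notation vertex := ('I_m -> nat).
Notation F2 := 'F_2.
Implicit Types (v : vertex) (S : {set 'I_m}) (omega : vertex -> {set 'I_m} -> F2).

Lemma addF2 (x : F2) : x + x = 0.
Proof. by case: x => [[|[|k]] Hk]; apply: val_inj. Qed.

Definition succ_at (i : 'I_m) v : vertex := fun k => (v k + (k == i))%N.
Definition set_at (i : 'I_m) t v : vertex := fun k => if k == i then t else v k.

(** The cubical cup product of the coboundaries of the labellings in fs, evaluated on the
    face with lowest vertex v that extends in the directions S. *)
Fixpoint cup (fs : seq (vertex -> F2)) v S : F2 :=
  if fs is f :: fs' then \sum_(i in S) (f (succ_at i v) + f v) * cup fs' (succ_at i v) (S :\ i)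
  else (S == finset.set0)%:R.

(** The coboundary of the cochain omega on the face with lowest vertex v and directions S:
    the sum over its facets, which need no sign modulo 2. *)
Definition coboundary omega v S : F2 := \sum_(i in S) (omega (succ_at i v) (S :\ i) + omega v (S :\ i)).

Lemma succ_atC i k v : succ_at i (succ_at k v) = succ_at k (succ_at i v).
Proof. by apply/funext => l; rewrite /succ_at addnAC. Qed.

(** Modulo 2 the terms indexed by (i, k) and by (k, i) cancel. *)
Lemma sym_sum0 S (G : 'I_m -> 'I_m -> F2) : (forall i k, G i k = G k i) ->
  \sum_(i in S) \sum_(k in S :\ i) G i k = 0.
Proof.
move=> sG.
have E i : i \in S -> \sum_(k in S :\ i) G i k =
    \sum_(k in S | (k < i)%N) G i k + \sum_(k in S | (i < k)%N) G i k.
  move=> iS; rewrite (bigID (fun k : 'I_m => (k < i)%N)) /=; congr (_ + _); apply: eq_bigl => k.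
    by rewrite in_setD1 -(inj_eq val_inj) /=; case: (ltngtP (k : nat) i); rewrite ?andbF ?andbT.
  by rewrite in_setD1 -(inj_eq val_inj) /=; case: (ltngtP (k : nat) i); rewrite ?andbF ?andbT.
rewrite (eq_bigr _ E) big_split /=.
rewrite [X in _ + X](exchange_big_dep (mem S)) /=; last by move=> i k _ /andP[].
rewrite -[RHS](addF2 (\sum_(i in S) \sum_(k in S | (k < i)%N) G i k)); congr (_ + _).
by apply: eq_bigr => i iS; apply: eq_big => [k|k _]; rewrite ?iS // sG.
Qed.

Lemma setD1C S i k : S :\ i :\ k = S :\ k :\ i.
Proof. by apply/setP => l; rewrite !inE andbCA. Qed.

Lemma coboundary2 omega v S : coboundary (coboundary omega) v S = 0.
Proof.
rewrite /coboundary.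
under eq_bigr => i _ do rewrite -big_split /=.
apply: (@sym_sum0 S (fun i k => omega (succ_at k (succ_at i v)) (S :\ i :\ k) + omega (succ_at i v) (S :\ i :\ k)
  + (omega (succ_at k v) (S :\ i :\ k) + omega v (S :\ i :\ k)))) => i k.
by rewrite (setD1C S i k) (succ_atC k i) [X in _ = X]addrACA addrACA; congr (_ + _ + _); rewrite addrC.
Qed.

(** Leibniz rule: the coboundary of f times c is the cup product of the coboundary of f with
    c, plus f times the coboundary of c. *)
Lemma cup_cons f fs v S : cup (f :: fs) v S =
  coboundary (fun v S => f v * cup fs v S) v S + f v * coboundary (cup fs) v S.
Proof.
rewrite /coboundary mulr_sumr -big_split /=; apply: eq_bigr => i _.
move: (f (succ_at i v)) (f v) (cup fs (succ_at i v) (S :\ i)) (cup fs v (S :\ i)) => x y p q.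
have -> : x * p + y * q + y * (p + q) = (x + y) * p + (y * q + y * q) by ring.
by rewrite addF2 addr0.
Qed.

Lemma coboundary_cup fs v S : coboundary (cup fs) v S = 0.
Proof.
elim: fs v S => [|f fs IH] v S.
  by rewrite /coboundary big1// => i _; rewrite /= addF2.
rewrite -[RHS](coboundary2 (fun v S => f v * cup fs v S) v S) /coboundary; apply: eq_bigr => i _.
by rewrite !cup_cons !IH !mulr0 !addr0.
Qed.

(** A product of coboundaries is closed, so in the Leibniz rule only one term survives. *)
Lemma cup_exact f fs v S : cup (f :: fs) v S = coboundary (fun v S => f v * cup fs v S) v S.
Proof. by rewrite cup_cons coboundary_cup mulr0 addr0. Qed.

Variable N : nat.

(** The variables in s run over 0, ..., N - 1 and the others keep their value in v: with F a
    function of the lowest vertex, this is the integral of a cochain over a face of the box. *)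
Fixpoint box_sum (s : seq 'I_m) (F : vertex -> F2) v : F2 :=
  if s is i :: s' then \sum_(t < N) box_sum s' F (set_at i t v) else F v.

Lemma eq_box_sum s F G v : (forall v, F v = G v) -> box_sum s F v = box_sum s G v.
Proof. by move=> E; elim: s v => [|i s IH] v //=; apply: eq_bigr => t _. Qed.

Lemma box_sum_sum s (I : finType) (P : pred I) (F : I -> vertex -> F2) v :
  box_sum s (fun v => \sum_(i | P i) F i v) v = \sum_(i | P i) box_sum s (F i) v.
Proof.
elim: s v => [//|k s IH] v /=; rewrite exchange_big /=.
by apply: eq_bigr => t _; rewrite IH.
Qed.

Lemma box_sum_add s F G v : box_sum s (fun v => F v + G v) v = box_sum s F v + box_sum s G v.
Proof.
elim: s v => [//|k s IH] v /=; rewrite -big_split /=.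
by apply: eq_bigr => t _; rewrite IH.
Qed.

Lemma set_atC i k t u v : i != k -> set_at i t (set_at k u v) = set_at k u (set_at i t v).
Proof.
move=> ik; apply/funext => l; rewrite /set_at.
by case: (eqVneq l i) => [->|]; rewrite ?(negbTE ik).
Qed.

Lemma succ_set_at i k t v : i != k -> succ_at i (set_at k t v) = set_at k t (succ_at i v).
Proof.
move=> ik; apply/funext => l; rewrite /succ_at /set_at.
by case: (eqVneq l k) => [->|]//; rewrite eq_sym (negbTE ik) addn0.
Qed.

Lemma succ_set_same i t v : succ_at i (set_at i t v) = set_at i t.+1 v.
Proof.
apply/funext => l; rewrite /succ_at /set_at.
by case: (eqVneq l i) => _; rewrite ?addn1 ?addn0.
Qed.

Lemma box_sum_up s i F v : i \notin s -> box_sum s (fun v => F (succ_at i v)) v = box_sum s F (succ_at i v).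
Proof.
elim: s v => [//|k s IH] v /=; rewrite in_cons negb_or => /andP[ik iS].
by apply: eq_bigr => t _; rewrite IH// succ_set_at.
Qed.

(** Along direction i the sum telescopes, modulo 2, to the two opposite facets: the
    elementary case of the theorem of Stokes. *)
Lemma box_sum_face s i F v : uniq s -> i \in s ->
  box_sum s (fun v => F (succ_at i v) + F v) v = box_sum (rem i s) F (set_at i N v) + box_sum (rem i s) F (set_at i 0 v).
Proof.
elim: s v => [//|k s IH] v /= /andP[ks us]; rewrite in_cons.
have [<- _|ik /= iS] := eqVneq k i.
  have E t : box_sum s (fun v => F (succ_at k v) + F v) (set_at k t v) = box_sum s F (set_at k t.+1 v) + box_sum s F (set_at k t v).
    by rewrite box_sum_add box_sum_up// succ_set_same.
  under eq_bigr => t _ do rewrite E.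
  elim: (N) => [|M IHM]; first by rewrite big_ord0 addF2.
  by rewrite big_ord_recr /= IHM addrC addrA -(addrA (box_sum s F (set_at k M.+1 v))) addF2 addr0.
have ik' : i != k by rewrite eq_sym.
under eq_bigr => t _ do rewrite IH//.
by rewrite big_split /=; congr (_ + _); apply: eq_bigr => t _; rewrite set_atC.
Qed.

Lemma box_sum_zero s i (a : nat) F v : i \notin s -> (forall v, v i = a -> F v = 0) -> v i = a -> box_sum s F v = 0.
Proof.
move=> + HF; elim: s v => [|k s IH] v /=; first by move=> _; exact: HF.
rewrite in_cons negb_or => /andP[ik iS] va; rewrite big1// => t _.
by apply: IH => //; rewrite /set_at (negbTE ik).
Qed.

Lemma box_sum_neq0 s F v : box_sum s F v != 0 -> exists v', F v' != 0.
Proof.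
elim: s v => [|k s IH] v /=; first by exists v.
move=> H; have [t Ht] : exists t : 'I_N, box_sum s F (set_at k t v) != 0.
  apply/existsP; apply: contraNT H; rewrite negb_exists => /forallP H.
  by rewrite big1// => t _; apply/eqP; have := H t; rewrite negbK.
exact: IH Ht.
Qed.

Variable f : 'I_m -> vertex -> F2.
Hypothesis f0 : forall i v, v i = 0%N -> f i v = 0.
Hypothesis f1 : forall i v, v i = N -> f i v = 1.

Lemma cup_zero s i (a : nat) (cst : F2) v S : i \in s -> (forall v, v i = a -> f i v = cst) ->
  i \notin S -> v i = a -> cup [seq f k | k <- s] v S = 0.
Proof.
move=> + Hc; elim: s v S => [//|k s IH] v S; rewrite in_cons => iS iNS va /=.
rewrite big1// => l lS.
have li : i != l by apply: contraNneq iNS => ->.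
have ula : succ_at l v i = a by rewrite /succ_at va (negbTE li) addn0.
have [ik|ik] := eqVneq i k; first by rewrite -ik !Hc// addF2 mul0r.
rewrite IH ?mulr0//; first by move: iS; rewrite (negbTE ik).
by rewrite in_setD1 negb_and iNS orbT.
Qed.

(** By exactness and Stokes the integral is a sum over the facets of the box. On the facets
    in a direction i other than k the factor f i is constant, so its coboundary is 0. Of the two
    facets in direction k only the one where f k = 1 contributes, and the induction hypothesis
    computes its integral. *)
Lemma box_sum_cup s v : uniq s -> box_sum s (fun v => cup [seq f k | k <- s] v [set x in s]) v = 1.
Proof.
elim: s v => [|k s IH] v; first move=> _ /=.
  have -> : [set x in [::]] = finset.set0 :> {set 'I_m} by apply/setP => x; rewrite !inE.
  by rewrite eqxx.
move=> us; have /= /andP[ks us'] := us.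
set G := fun v S => f k v * cup [seq f k | k <- s] v S.
have E v' : cup [seq f k | k <- k :: s] v' [set x in k :: s] =
   \sum_(i in [set x in k :: s]) (G (succ_at i v') ([set x in k :: s] :\ i) + G v' ([set x in k :: s] :\ i)).
  by rewrite map_cons cup_exact.
apply: (etrans (eq_box_sum (k :: s) v E)); rewrite box_sum_sum (bigD1 k) /=; last by rewrite inE mem_head.
rewrite [X in _ + X]big1 ?addr0; last first.
  move=> i; rewrite inE => /andP[iS ik].
  apply: (etrans (@box_sum_face (k :: s) i (fun v => G v ([set x in k :: s] :\ i)) v us iS)).
  have iNS : i \notin [set x in k :: s] :\ i by rewrite !inE eqxx.
  have is' : i \in s by move: iS; rewrite in_cons (negbTE ik).
  have iNr : i \notin rem i (k :: s) by rewrite mem_rem_uniq// inE /= eqxx.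
  rewrite (@box_sum_zero _ i N) ?(@box_sum_zero _ i 0%N) ?addr0 ?/set_at ?eqxx// => v' va; rewrite /G.
    by rewrite (cup_zero is' (f0 (i := i)) iNS va) mulr0.
  by rewrite (cup_zero is' (f1 (i := i)) iNS va) mulr0.
have kS : k \in k :: s by exact: mem_head.
apply: (etrans (@box_sum_face (k :: s) k (fun v => G v ([set x in k :: s] :\ k)) v us kS)); rewrite /= eqxx.
have SE : [set x in k :: s] :\ k = [set x in s].
  apply/setP => x; rewrite !inE; case: eqVneq => [->|//]; by rewrite (negbTE ks).
have Z : box_sum s (fun v => G v [set x in s]) (set_at k 0 v) = 0.
  apply: (@box_sum_zero s k 0%N _ _ ks); last by rewrite /set_at eqxx.
  by move=> v' va; rewrite /G f0// mul0r.
rewrite SE Z addr0.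
rewrite -[RHS](IH (set_at k N v) us').
have: set_at k N v k = N by rewrite /set_at eqxx.
move: (set_at k N v) => v' vN.
suff H s' : k \notin s' -> forall v', v' k = N -> box_sum s' (fun v => G v [set x in s]) v' =
    box_sum s' (fun v => cup [seq f k | k <- s] v [set x in s]) v' by exact: (H s ks v' vN).
elim: s' => [|l s' IH'] /=; first by move=> _ v0 v0N; rewrite /G f1// mul1r.
rewrite in_cons negb_or => /andP[kl ks'] v0 v0N; apply: eq_bigr => t _; apply: IH' => //.
by rewrite /set_at (negbTE kl).
Qed.

(** A nonzero cup product has a nonzero increment of each factor along some edge of the
    face. The hypothesis on nth says that g occurs in fs, for functions have no decidable
    equality. *)
Lemma cup_neq0 (fs : seq (vertex -> F2)) v S g : cup fs v S != 0 ->
  (exists k, nth g fs k = g /\ (k < size fs)%N) -> exists a b : vertex,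
  [/\ forall k, (v k <= a k <= v k + (k \in S))%N, forall k, (v k <= b k <= v k + (k \in S))%N & g a != g b].
Proof.
elim: fs v S => [|f' fs IH] v S; first by move=> _ [k [_]].
move=> /= H [k [gk ks]].
have [i /andP[iS Hi]] : exists i, (i \in S) && ((f' (succ_at i v) + f' v) * cup fs (succ_at i v) (S :\ i) != 0).
  apply/existsP; apply: contraNT H; rewrite negb_exists => /forallP H.
  by rewrite big1// => i iS; apply/eqP; have := H i; rewrite iS /= negbK.
have upb l : (v l <= succ_at i v l <= v l + (l \in S))%N.
  by rewrite /succ_at leq_addr leq_add2l; case: eqVneq => [->|]; rewrite ?iS.
case: k gk ks => [/= gk _|k /= gk ks].
  exists (succ_at i v), v; split=> //; first by move=> l; rewrite leqnn leq_addr.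
  rewrite -gk; apply: contraNneq Hi => ->; by rewrite addF2 mul0r.
have Hi' : cup fs (succ_at i v) (S :\ i) != 0 by apply: contraNneq Hi => ->; rewrite mulr0.
have [|a [b [Ha Hb ab]]] := IH _ _ Hi'; first by exists k.
have sub (c : vertex) : (forall l, (succ_at i v l <= c l <= succ_at i v l + (l \in S :\ i))%N) ->
    forall l, (v l <= c l <= v l + (l \in S))%N.
  move=> Hc l; have := Hc l; rewrite /succ_at !inE; case: (eqVneq l i) => [->|_] /=.
    by rewrite iS; lia.
  by rewrite addn0.
by exists a, b; split => //; exact: sub.
Qed.

(** The coboundaries of all labellings have a cup product with integral 1 over the box, so
    it does not vanish on some unit cell. *)
Lemma grid_poincare_miranda : exists v : vertex, forall i, exists a b : vertex,
  [/\ forall k, (v k <= a k <= (v k).+1)%N, forall k, (v k <= b k <= (v k).+1)%N & f i a != f i b].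
Proof.
have us : uniq (enum 'I_m) by exact: enum_uniq.
have : box_sum (enum 'I_m) (fun v => cup [seq f k | k <- enum 'I_m] v [set x in enum 'I_m]) (fun=> 0%N) != 0.
  by rewrite box_sum_cup// oner_eq0.
move=> /box_sum_neq0[v Wv]; exists v => i.
have [|a [b [Ha Hb ab]]] := cup_neq0 (g := f i) Wv.
  exists i; rewrite size_map size_enum_ord; split => //.
  by rewrite (nth_map i) ?size_enum_ord// nth_ord_enum.
exists a, b; split => // k; [have := Ha k|have := Hb k]; rewrite inE mem_enum.
  by rewrite addn1.
by rewrite addn1.
Qed.

End Grid.

Local Open Scope classical_set_scope.
Local Open Scope ring_scope.

(** * Cubes, continuity and directional derivatives *)

Section Basics.
Context {R : realType} {d : nat}.
Implicit Types (f g : 'rV[R]_d -> R) (x y v : 'rV[R]_d) (S : set 'rV[R]_d).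

Lemma sub_entry x y i : (x - y) 0 i = x 0 i - y 0 i.
Proof. by rewrite !mxE. Qed.

Lemma coord_le_norm x i : `|x 0 i| <= `|x|.
Proof.
have := le_refl `|x|; rewrite {1}/Num.norm /= mx_normrE.
move=> /bigmax_leP[_ /(_ (0, i) isT)]; exact.
Qed.

Lemma norm_le_coord x (e : R) : 0 <= e -> (forall i, `|x 0 i| <= e) -> `|x| <= e.
Proof.
move=> e0 H; rewrite /Num.norm /= mx_normrE; apply/bigmax_leP; split => // -[i j] _ /=.
by rewrite (ord1 i).
Qed.

Lemma norm_lt_coord x (e : R) : 0 < e -> (forall i, `|x 0 i| < e) -> `|x| < e.
Proof.
move=> e0 H; rewrite /Num.norm /= mx_normrE; apply/bigmax_ltP; split => // -[i j] _ /=.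
by rewrite (ord1 i).
Qed.

Lemma norm_delta i : `|delta_mx 0 i : 'rV[R]_d| = 1.
Proof.
apply/eqP; rewrite eq_le; apply/andP; split.
  apply: norm_le_coord => // j; rewrite mxE eqxx /=.
  by case: (_ == _); rewrite ?normr1 ?normr0.
by have := coord_le_norm (delta_mx 0 i) i; rewrite mxE !eqxx normr1.
Qed.

Lemma continuous_atP {V W : normedModType R} (f : V -> W) (x : V) : {for x, continuous f} <->
  forall e : R, 0 < e -> exists2 r : R, 0 < r &
    forall y : V, `|y - x| < r -> `|f y - f x| < e.
Proof.
split=> [H e e0|H].
  have /nbhs_normP[r /= r0 rH] := @cvgr_dist_lt _ _ _ _ (nbhs_filter x) _ _ H _ e0.
  exists r => // y yr; rewrite distrC; apply: rH; by rewrite /ball_/= distrC.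
apply/cvgrPdist_lt => e /H[r r0 rH]; apply/nbhs_normP; exists r => //= y.
by rewrite /ball_/= distrC => /rH; rewrite distrC.
Qed.

Lemma openP S : open S <->
  forall x, S x -> exists2 r : R, 0 < r & forall y, `|y - x| <= r -> S y.
Proof.
split=> [oS x Sx|H].
  have nS : nbhs x S by exact: open_nbhs_nbhs.
  have [r /= r0 rH] := (nbhs_normP x S).1 nS.
  exists (r / 2); first by rewrite divr_gt0.
  move=> y yr; apply: rH; rewrite /ball_/= distrC (le_lt_trans yr)//.
  by rewrite ltr_pdivrMr// ltr_pMr// ltr1n.
rewrite openE => x /H[r r0 rH]; apply: (nbhs_normP x S).2; exists r => //= y.
by rewrite /ball_/= distrC => /ltW/rH.
Qed.

Definition cube x (r : R) : set 'rV[R]_d := [set y | `|y - x| < r].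

Lemma open_cube x r : open (cube x r).
Proof.
apply/openP => y yr; exists ((r - `|y - x|) / 2).
  by rewrite divr_gt0// subr_gt0.
move=> z zy; rewrite /cube/=.
have -> : z - x = (z - y) + (y - x) by rewrite addrA subrK.
apply: (le_lt_trans (ler_normD _ _)).
apply: (le_lt_trans (lerD zy (lexx _))).
move: yr; rewrite /cube/=; set a := `|y - x|; lra.
Qed.

Lemma nbhs_cube x r : 0 < r -> nbhs x (cube x r).
Proof.
move=> r0; apply: open_nbhs_nbhs; split; first exact: open_cube.
by rewrite /cube/= subrr normr0.
Qed.

Lemma is_derive_line f x v (t : R) : derivable f (x + t *: v) v ->
  is_derive t 1 (fun s : R => f (x + s *: v)) ('D_v f (x + t *: v)).
Proof.
have E : (fun h : R => h^-1 *: (((fun s : R => f (x + s *: v)) \o shift t) (h *: 1) - f (x + t *: v)))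
  = (fun h : R => h^-1 *: ((f \o shift (x + t *: v)) (h *: v) - f (x + t *: v))).
  apply/funext => h /=; congr (_ *: (f _ - _)).
  by rewrite scalerDl [h *: 1]mulr1 addrCA.
move=> H; split; first by rewrite /derivable E.
by rewrite /derive E.
Qed.

Lemma is_derive_of_line f x v df :
  is_derive (0:R) 1 (fun s : R => f (x + s *: v)) df ->
  is_derive x v f df.
Proof.
have E : (fun h : R => h^-1 *: (((fun s : R => f (x + s *: v)) \o shift 0) (h *: 1) - f (x + 0 *: v)))
  = (fun h : R => h^-1 *: ((f \o shift x) (h *: v) - f x)).
  apply/funext => h /=; congr (_ *: (f _ - f _)); last by rewrite scale0r addr0.
  by rewrite addr0 [h *: 1]mulr1 addrC.
move=> [H1 H2]; split; first by rewrite /derivable -E.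
by rewrite /derive -E.
Qed.

Lemma is_deriveP {V : normedModType R} (f : V -> R) (x v : V) (df : R) : is_derive x v f df <->
  forall e : R, 0 < e -> exists2 r : R, 0 < r &
    forall s : R, s != 0 -> `|s| < r -> `|(f (x + s *: v) - f x) / s - df| < e.
Proof.
have E (s : R) : s^-1 *: ((f \o shift x) (s *: v) - f x) = (f (x + s *: v) - f x) / s.
  by rewrite /= [x + _]addrC [RHS]mulrC.
split.
  move=> [H1 H2] e e0.
  have : (fun h : R => h^-1 *: ((f \o shift x) (h *: v) - f x)) @ 0^' --> df.
    by move: H1 => /cvg_ex[l Hl]; rewrite -H2 /derive (cvg_lim _ Hl).
  move=> /cvgrPdist_lt/(_ e e0) [r /= r0 rH]; exists r => // s s0 sr.
  have := rH s; rewrite /ball_/= sub0r normrN => /(_ sr s0).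
  by rewrite distrC -E.
move=> H.
have K : (fun h : R => h^-1 *: ((f \o shift x) (h *: v) - f x)) @ 0^' --> df.
  apply/cvgrPdist_lt => e /H[r r0 rH]; exists r => //= s.
  rewrite /ball_/= sub0r normrN => sr s0; rewrite distrC.
  by have := rH s s0 sr; rewrite -E.
split; first by apply/cvg_ex; exists df.
exact: cvg_lim.
Qed.

Lemma mvt_line f x v (s : R) :
  (forall t : R, `|t| <= `|s| -> derivable f (x + t *: v) v) ->
  exists2 t : R, `|t| <= `|s| & f (x + s *: v) - f x = s * 'D_v f (x + t *: v).
Proof.
move=> H.
pose g := fun t : R => f (x + t *: v); pose dg t := 'D_v f (x + t *: v).
have Hg (t : R) : `|t| <= `|s| -> is_derive t (1:R) g (dg t).
  by move=> /H; exact: is_derive_line.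
have Cg a b : (forall t, t \in `[a, b] -> `|t| <= `|s|) -> {within `[a, b], continuous g}.
  by move=> ab; apply: derivable_within_continuous => t /ab/Hg[].
have [s0|s0] := leP 0 s.
  have ab t : t \in `[0, s] -> `|t| <= `|s|.
    by rewrite in_itv/= => /andP[t0 ts]; rewrite !ger0_norm.
  have [t tI E] := @MVT_segment R g dg 0 s s0 (fun t tI => Hg t (ab t (subset_itv_oo_cc tI))) (Cg _ _ ab).
  exists t; first exact: ab.
  by move: E; rewrite /g scale0r addr0 subr0 mulrC.
have ab t : t \in `[s, 0] -> `|t| <= `|s|.
  by rewrite in_itv/= => /andP[t0 ts]; rewrite (ltr0_norm s0) (ler0_norm ts) lerN2.
have [t tI E] := @MVT_segment R g dg s 0 (ltW s0) (fun t tI => Hg t (ab t (subset_itv_oo_cc tI))) (Cg _ _ ab).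
exists t; first exact: ab.
move: E; rewrite /g scale0r addr0 sub0r mulrN => E.
by rewrite -opprB E opprK mulrC.
Qed.

End Basics.

Lemma cont_add {R : realType} {T : topologicalType} (f g : T -> R) (x : T) :
  {for x, continuous f} -> {for x, continuous g} -> {for x, continuous (fun x => f x + g x)}.
Proof. by move=> Hf Hg; exact: (@continuousD _ _ _ f g x Hf Hg). Qed.

Lemma cont_mul {R : realType} {T : topologicalType} (f g : T -> R) (x : T) :
  {for x, continuous f} -> {for x, continuous g} -> {for x, continuous (fun x => f x * g x)}.
Proof. by move=> Hf Hg; exact: (@continuousM _ _ f g x Hf Hg). Qed.

Lemma cont_inv {R : realType} {T : topologicalType} (f : T -> R) (x : T) :
  f x != 0 -> {for x, continuous f} -> {for x, continuous (fun x => (f x)^-1)}.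
Proof. by move=> f0 Hf; exact: (@continuousV _ _ f x f0 Hf). Qed.

Lemma cont_sum {R : realType} {T : topologicalType} {I : Type} (r : seq I) (F : I -> T -> R) (x : T) :
  (forall i, {for x, continuous (F i)}) -> {for x, continuous (fun y => \sum_(i <- r) F i y)}.
Proof.
move=> H; elim: r => [|i r IH].
  have -> : (fun y => \sum_(i <- [::]) F i y) = cst 0 by apply/funext => y; rewrite big_nil.
  exact: cst_continuous.
have -> : (fun y => \sum_(j <- i :: r) F j y) = (fun y => F i y + \sum_(j <- r) F j y).
  by apply/funext => y; rewrite big_cons.
exact: cont_add.
Qed.

Lemma cont_coord {R : realType} {d : nat} (i : 'I_d) (x : 'rV[R]_d) :
  {for x, continuous (fun y : 'rV[R]_d => y 0 i)}.
Proof. exact: (@coord_continuous R 1 d 0 i x). Qed.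

(** * Functions of class Ck *)

Lemma addr3B {V : zmodType} (x a b : V) : x + a + b - x = a + b.
Proof. by rewrite -(addrA x) addrAC subrr add0r. Qed.

Lemma dist_half {R : realType} (m p q e : R) :
  `|m - p| < e / 2 -> `|m - q| < e / 2 -> `|p - q| <= e.
Proof.
by rewrite !ltr_norml => /andP[A1 A2] /andP[A3 A4]; rewrite ler_norml; apply/andP; split; lra.
Qed.

Section Smooth.
Context {R : realType} {d : nat}.
Implicit Types (f g : 'rV[R]_d -> R) (x y v : 'rV[R]_d) (S : set 'rV[R]_d).

Lemma Ck_cont k S f x : Ck k S f -> S x -> {for x, continuous f}.
Proof. by case: k => [|k] [H _] Sx; exact: H. Qed.

Lemma Ck_derivable k S f x j : Ck k.+1 S f -> S x -> derivable f x (delta_mx 0 j).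
Proof. by move=> [_ [H _]] Sx; exact: H. Qed.

Lemma Ck_partial k S f j : Ck k.+1 S f -> Ck k S (partial j f).
Proof. by move=> [_ [_ H]]; exact: H. Qed.

Lemma Ck_is_derive k S f x j : Ck k.+1 S f -> S x ->
  is_derive x (delta_mx 0 j) f (partial j f x).
Proof. by move=> H Sx; apply: derivableP; exact: Ck_derivable H Sx. Qed.

Lemma Ck_sub k S S' f : S' `<=` S -> Ck k S f -> Ck k S' f.
Proof.
elim: k f => [|k IH] f sS /=; first by case=> H _; split => // x /sS/H.
case=> H [D P]; split; first by move=> x /sS/H.
split; first by move=> x /sS/D.
by move=> j; apply: IH.
Qed.

Lemma Ck_pred k S f : Ck k.+1 S f -> Ck k S f.
Proof.
elim: k f => [|k IH] f /=; first by case.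
case=> H [D P]; split => //; split => // j; exact: IH (P j).
Qed.

Lemma is_derive_eq_open S f g x v df : open S -> (forall y, S y -> f y = g y) -> S x ->
  is_derive x v f df -> is_derive x v g df.
Proof.
move=> /openP oS fg Sx /is_deriveP H; apply/is_deriveP => e /H[r r0 rH].
have [r1 r10 r1H] := oS _ Sx.
exists (Num.min r (r1 / (`|v| + 1))).
  by rewrite lt_min r0 divr_gt0// ltr_wpDl.
move=> s s0; rewrite lt_min => /andP[sr sr1].
rewrite -!fg//; first exact: rH.
apply: r1H; rewrite addrAC subrr add0r normrZ.
apply: le_trans (_ : `|s| * (`|v| + 1) <= _).
  by rewrite ler_wpM2l// lerDl.
by rewrite -ler_pdivlMr ?ltW// ltr_wpDl.
Qed.

Lemma partial_eq_open S f g x j : open S -> (forall y, S y -> f y = g y) -> S x ->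
  derivable f x (delta_mx 0 j) -> partial j g x = partial j f x.
Proof.
move=> oS fg Sx /derivableP Df.
by have [_] := is_derive_eq_open oS fg Sx Df.
Qed.

Lemma Ck_eq k S f g : open S -> (forall y, S y -> f y = g y) -> Ck k S f -> Ck k S g.
Proof.
move=> oS; elim: k f g => [|k IH] f g fg H.
  split => // x Sx; apply/continuous_atP => e e0.
  have [r r0 rH] := (continuous_atP f x).1 (Ck_cont H Sx) e e0.
  have [r1 r10 r1H] := (openP S).1 oS x Sx.
  exists (Num.min r r1); first by rewrite lt_min r0.
  move=> y; rewrite lt_min => /andP[yr yr1].
  by rewrite -!fg//; [exact: rH| exact/r1H/ltW].
split; first by move=> x; exact: Ck_cont (IH f g fg (Ck_pred H)).
split=> [x Sx j|j].
  by have [] := is_derive_eq_open oS fg Sx (Ck_is_derive j H Sx).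
apply: IH (Ck_partial j H) => y Sy.
by rewrite (partial_eq_open oS fg Sy (Ck_derivable H Sy)).
Qed.

Lemma CkSP k S f (df : 'I_d -> 'rV[R]_d -> R) : open S ->
  (forall x, S x -> {for x, continuous f}) ->
  (forall j x, S x -> is_derive x (delta_mx 0 j) f (df j x)) ->
  (forall j, Ck k S (df j)) -> Ck k.+1 S f.
Proof.
move=> oS C D H; split => //; split=> [x Sx j|j]; first by have [] := D j x Sx.
by apply: Ck_eq (H j) => // x Sx; rewrite /partial; have [_ ->] := D j x Sx.
Qed.

Lemma Ck_cst k S (c : R) : Ck k S (cst c).
Proof.
elim: k c => [|k IH] c; first by split => // x _; exact: cst_continuous.
split; first by move=> x _; exact: cst_continuous.
split=> [x _ j|j]; first exact: derivable_cst.
suff -> : partial j (cst c : 'rV[R]_d -> R) = cst 0 by [].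
by apply/funext => x; exact: derive_cst.
Qed.

Lemma Ck_add k S f g : open S -> Ck k S f -> Ck k S g -> Ck k S (fun x => f x + g x).
Proof.
move=> oS; elim: k f g => [|k IH] f g Hf Hg.
  by split => // x Sx; apply: cont_add; [exact: Ck_cont Hf Sx|exact: Ck_cont Hg Sx].
apply: (@CkSP _ _ _ (fun j x => partial j f x + partial j g x)) => //.
- by move=> x Sx; apply: cont_add; [exact: Ck_cont Hf Sx|exact: Ck_cont Hg Sx].
- move=> j x Sx; have Df := Ck_is_derive j Hf Sx; have Dg := Ck_is_derive j Hg Sx.
  exact: is_deriveD.
- by move=> j; apply: IH; exact: Ck_partial.
Qed.

Lemma Ck_mul k S f g : open S -> Ck k S f -> Ck k S g -> Ck k S (fun x => f x * g x).
Proof.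
move=> oS; elim: k f g => [|k IH] f g Hf Hg.
  by split => // x Sx; apply: cont_mul; [exact: Ck_cont Hf Sx|exact: Ck_cont Hg Sx].
apply: (@CkSP _ _ _ (fun j x => f x * partial j g x + g x * partial j f x)) => //.
- by move=> x Sx; apply: cont_mul; [exact: Ck_cont Hf Sx|exact: Ck_cont Hg Sx].
- move=> j x Sx; have Df := Ck_is_derive j Hf Sx; have Dg := Ck_is_derive j Hg Sx.
  exact: is_deriveM.
- by move=> j; apply: Ck_add => //; apply: IH; [exact: Ck_pred|exact: Ck_partial|exact: Ck_pred|exact: Ck_partial].
Qed.

Lemma Ck_inv k S f : open S -> (forall x, S x -> f x != 0) -> Ck k S f ->
  Ck k S (fun x => (f x)^-1).
Proof.
move=> oS f0; elim: k => [|k IH] Hf.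
  by split => // x Sx; apply: cont_inv; [exact: f0|exact: Ck_cont Hf Sx].
have Hi := IH (Ck_pred Hf).
apply: (@CkSP _ _ _ (fun j x => (cst (-1) x * partial j f x) * ((f x)^-1 * (f x)^-1))) => //.
- by move=> x Sx; apply: cont_inv; [exact: f0|exact: Ck_cont Hf Sx].
- move=> j x Sx; have Df := Ck_is_derive j Hf Sx.
  have [D1 D2] := Df; have fx := f0 _ Sx.
  split; first exact: derivableV.
  rewrite deriveV// D2 /cst /GRing.scale /=; move: fx; move: (f x) (partial j f x) => a b a0.
  by field.
- move=> j; do 2 (apply: Ck_mul => //); first exact: Ck_cst.
  exact: Ck_partial.
Qed.

(** The minimum of the radii serves for all indices at once. *)
Lemma finite_radius (P : 'I_d -> R -> Prop) :
  (forall i r r', r' <= r -> P i r -> P i r') ->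
  (forall i, exists2 r, 0 < r & P i r) -> exists2 r, 0 < r & forall i, P i r.
Proof.
move=> mono H.
have {}H i : exists r, 0 < r /\ P i r by have [r] := H i; exists r.
have [r rH] := @choice _ _ (fun i r => 0 < r /\ P i r) H.
exists (\big[Num.min/1]_i r i).
  by apply/bigmin_gtP; split=> [|i _]; [exact: ltr01|case: (rH i)].
move=> i; apply: mono (proj2 (rH i)).
exact: bigmin_le.
Qed.

(** From x to x + h one coordinate moves at a time, and the mean value theorem applies on
    each of these d segments. *)
Lemma C1_diff S f x : open S -> Ck 1 S f -> S x -> forall e : R, 0 < e ->
  exists2 r : R, 0 < r & forall h : 'rV[R]_d, `|h| < r ->
    `|f (x + h) - f x - \sum_i h 0 i * partial i f x| <= e * `|h|.
Proof.
move=> oS Hf Sx e e0.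
have [r1 r10 r1H] := (openP S).1 oS x Sx.
have e1 : 0 < e / d.+1%:R by rewrite divr_gt0.
have [r2 r20 r2H] : exists2 r : R, 0 < r & forall i : 'I_d, forall y, `|y - x| < r ->
    `|partial i f y - partial i f x| < e / d.+1%:R.
  apply: (@finite_radius (fun i r => forall y, `|y - x| < r ->
    `|partial i f y - partial i f x| < e / d.+1%:R)).
    by move=> i r r' rr H y yr; apply: H; exact: lt_le_trans yr rr.
  move=> i; apply: (continuous_atP _ _).1 => //.
  exact: Ck_cont (Ck_partial i Hf) Sx.
exists (Num.min r1 r2 / 2); first by rewrite divr_gt0// lt_min r10.
move=> h hr.
have {hr} /andP[hr1 hr2] : (2 * `|h| < r1) && (2 * `|h| < r2).
  by rewrite -lt_min mulrC -ltr_pdivlMr.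
(* The point T m has the first m coordinates of h. *)
pose T m : 'rV[R]_d := \row_i (if (i < m)%N then h 0 i else 0).
have T0 : T 0%N = 0 by apply/rowP => i; rewrite !mxE.
have Td : T d = h by apply/rowP => i; rewrite !mxE ltn_ord.
have TS (m : 'I_d) : T m.+1 = T m + h 0 m *: delta_mx 0 m.
  apply/rowP => i; rewrite !mxE eqxx /= ltnS leq_eqVlt.
  case: (eqVneq i m) => [->|im]; first by rewrite eqxx ltnn mulr1 add0r.
  by rewrite (negbTE (_ : (i != m :> nat)%N)) ?mulr0 ?addr0.
have Tn m (t : R) (i : 'I_d) : `|t| <= `|h 0 i| -> `|T m + t *: delta_mx 0 i| <= 2 * `|h|.
  move=> th; apply: (le_trans (ler_normD _ _)); rewrite mulr2n mulrDl mul1r lerD//.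
    apply: norm_le_coord => // j; rewrite mxE; case: ifP => _; first exact: coord_le_norm.
    by rewrite normr0.
  by rewrite normrZ norm_delta mulr1 (le_trans th)// coord_le_norm.
have -> : f (x + h) - f x = \sum_(m < d) (f (x + T m.+1) - f (x + T m)).
  rewrite -(big_mkord xpredT (fun m => f (x + T m.+1) - f (x + T m))).
  by rewrite telescope_sumr// Td T0 addr0.
rewrite -sumrB.
apply: le_trans (ler_norm_sum _ _ _) _.
apply: (@le_trans _ _ (\sum_(i < d) (e / d.+1%:R * `|h|))); last first.
  rewrite sumr_const card_ord -[leLHS]mulr_natr [leLHS]mulrAC ler_wpM2r//.
  by rewrite -mulrA ger_pMr// mulrC ler_pdivrMr// mul1r ler_nat.
apply: ler_sum => i _; rewrite TS addrA.
have [t th ->] : exists2 t : R, `|t| <= `|h 0 i| &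
    f (x + T i + h 0 i *: delta_mx 0 i) - f (x + T i)
    = h 0 i * partial i f (x + T i + t *: delta_mx 0 i).
  apply: mvt_line => t th; apply: (Ck_derivable Hf); apply: r1H.
  by rewrite addr3B (le_trans (Tn _ _ _ th))// ltW.
rewrite -mulrBr normrM mulrC ler_pM//; last exact: coord_le_norm.
apply/ltW/r2H; by rewrite addr3B (le_lt_trans (Tn _ _ _ th)).
Qed.

Lemma chain_curve S f x (gam : R -> 'rV[R]_d) (v : 'I_d -> R) :
  open S -> Ck 1 S f -> S x -> gam 0 = x ->
  (forall i, is_derive (0:R) (1:R) (fun s => gam s 0 i) (v i)) ->
  is_derive (0:R) (1:R) (fun s => f (gam s)) (\sum_i v i * partial i f x).
Proof.
move=> oS Hf Sx g0 Dg; apply/is_deriveP => e e0.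
set B := \sum_i `|partial i f x|.
set V := \sum_i `|v i|.
have B0 : 0 <= B by apply: sumr_ge0.
have V0 : 0 <= V by apply: sumr_ge0.
set e1 := e / (2 * (V + 1 + B)).
have VB : 0 < V + 1 + B by rewrite -addrA addrCA ltr_pwDl// addr_ge0.
have e10 : 0 < e1 by rewrite divr_gt0// mulr_gt0.
have [r1 r10 r1H] := C1_diff oS Hf Sx e10.
set e2 := Num.min 1 e1.
have e20 : 0 < e2 by rewrite lt_min ltr01.
have [r2 r20 r2H] : exists2 r : R, 0 < r & forall i : 'I_d, forall s : R, s != 0 ->
    `|s| < r -> `|(gam s 0 i - x 0 i) / s - v i| < e2.
  apply: (@finite_radius (fun i r => forall s : R, s != 0 ->
    `|s| < r -> `|(gam s 0 i - x 0 i) / s - v i| < e2)).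
    by move=> i r r' rr H s s0 sr; apply: H => //; exact: lt_le_trans sr rr.
  move=> i; have [r r0 rH] := (is_deriveP _ _ _ _).1 (Dg i) e2 e20.
  exists r => // s s0 sr; have := rH s s0 sr.
  by rewrite [s *: 1]mulr1 add0r g0.
exists (Num.min r2 (r1 / (V + 1))).
  by rewrite lt_min r20 divr_gt0// ltr_wpDl.
move=> s s0; rewrite [s *: 1]mulr1 add0r g0 lt_min => /andP[sr2 sr1].
set h := gam s - x.
have hs0 : 0 < `|s| by rewrite normr_gt0.
have hb : `|h| <= (V + 1) * `|s|.
  apply: norm_le_coord; first by rewrite mulr_ge0// addr_ge0.
  move=> i; rewrite mxE mxE -ler_pdivrMr// -normfV -normrM.
  have -> : (gam s 0 i - x 0 i) / s = v i + ((gam s 0 i - x 0 i) / s - v i) by rewrite [RHS]addrC subrK.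
  apply: le_trans (ler_normD _ _) _; apply: lerD.
    by rewrite /V (bigD1 i)//= lerDl sumr_ge0.
  by apply: ltW; apply: lt_le_trans (r2H i s s0 sr2) _; rewrite ge_min lexx.
have hr1 : `|h| < r1.
  apply: (le_lt_trans hb); rewrite mulrC -ltr_pdivlMr//; by rewrite ltr_wpDl.
have := r1H h hr1; rewrite [x + _]addrC subrK => H1.
have -> : (f (gam s) - f x) / s - \sum_i v i * partial i f x =
  (f (gam s) - f x - \sum_i h 0 i * partial i f x) / s
   + \sum_i ((gam s 0 i - x 0 i) / s - v i) * partial i f x.
  rewrite [X in _ = X + _]mulrBl -[RHS]addrA; congr (_ + _).
  rewrite mulr_suml -sumrN -sumrN -big_split /=; apply: eq_bigr => i _.
  by rewrite mxE mxE; ring.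
apply: (le_lt_trans (ler_normD _ _)).
have a1 : `|(f (gam s) - f x - \sum_i h 0 i * partial i f x) / s| <= e1 * (V + 1).
  by rewrite normrM normfV ler_pdivrMr// (le_trans H1)// -[leRHS]mulrA ler_pM2l.
have a2 : `|\sum_i ((gam s 0 i - x 0 i) / s - v i) * partial i f x| <= e1 * B.
  apply: (le_trans (ler_norm_sum _ _ _)); rewrite /B mulr_sumr; apply: ler_sum => i _.
  rewrite normrM ler_wpM2r//; apply: ltW; apply: lt_le_trans (r2H i s s0 sr2) _.
  by rewrite ge_min lexx orbT.
apply: (le_lt_trans (lerD a1 a2)).
rewrite -mulrDr /e1.
have -> : e / (2 * (V + 1 + B)) * (V + 1 + B) = e / 2.
  by field; apply: lt0r_neq0.
by rewrite ltr_pdivrMr// ltr_pMr// ltr1n.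
Qed.

(** Two applications of the mean value theorem, in direction i to the increment in direction
    j, then in direction j. *)
Lemma second_diff S f x i j (h : R) : Ck 2 S f ->
  (forall y, `|y - x| <= 2 * `|h| -> S y) ->
  exists2 y, `|y - x| <= 2 * `|h| &
   f (x + h *: delta_mx 0 i + h *: delta_mx 0 j) - f (x + h *: delta_mx 0 i)
   - (f (x + h *: delta_mx 0 j) - f x) = h * (h * partial j (partial i f) y).
Proof.
move=> Hf HS.
have bd (s t : R) : `|s| <= `|h| -> `|t| <= `|h| ->
    `|x + s *: delta_mx 0 i + t *: delta_mx 0 j - x| <= 2 * `|h|.
  move=> sh th; rewrite addr3B.
  by apply: (le_trans (ler_normD _ _)); rewrite !normrZ !norm_delta !mulr1 mulr2n mulrDl mul1r lerD.
have bd0 (s : R) : `|s| <= `|h| -> S (x + s *: delta_mx 0 i).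
  move=> sh; apply: HS; have := bd s 0 sh; rewrite scale0r addr0; apply.
  by rewrite normr0.
pose F y := f (y + h *: delta_mx 0 j) - f y.
have DF (t : R) : `|t| <= `|h| -> is_derive (x + t *: delta_mx 0 i) (delta_mx 0 i) F
   (partial i f (x + t *: delta_mx 0 i + h *: delta_mx 0 j) - partial i f (x + t *: delta_mx 0 i)).
  move=> th; apply: is_deriveB; last first.
    by apply: (Ck_is_derive (k := 1) i Hf); exact: bd0.
  have H := Ck_is_derive (k := 1) i Hf (HS _ (bd t h th (lexx _))).
  apply/is_deriveP => e e0; have [r r0 rH] := (is_deriveP _ _ _ _).1 H e e0.
  exists r => // s s0 sr; have := rH s s0 sr; by rewrite [_ + _ + s *: _]addrAC.
have [t th E] : exists2 t : R, `|t| <= `|h| & F (x + h *: delta_mx 0 i) - F x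
   = h * 'D_(delta_mx 0 i) F (x + t *: delta_mx 0 i).
  by apply: mvt_line => t th; have [] := DF t th.
have [_ DE] := DF t th; move: E; rewrite DE.
have [s sh ->] : exists2 s : R, `|s| <= `|h| &
   partial i f (x + t *: delta_mx 0 i + h *: delta_mx 0 j) - partial i f (x + t *: delta_mx 0 i)
   = h * partial j (partial i f) (x + t *: delta_mx 0 i + s *: delta_mx 0 j).
  apply: mvt_line => s sh; apply: (Ck_derivable (k := 0) (Ck_partial i Hf)).
  by apply: HS; exact: bd.
rewrite /F => E; exists (x + t *: delta_mx 0 i + s *: delta_mx 0 j) => //.
exact: bd.
Qed.

(** The mixed second difference is symmetric in i and j, and it is h^2 times either mixed
    derivative at points near x. *)
Lemma schwarz S f x i j : open S -> Ck 2 S f -> S x ->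
  partial i (partial j f) x = partial j (partial i f) x.
Proof.
move=> oS Hf Sx; apply/eqP; rewrite -subr_eq0 -normr_le0; apply/ler_addgt0Pr => e e0.
rewrite add0r.
have [r1 r10 r1H] := (openP S).1 oS x Sx.
have e2 : 0 < e / 2 by rewrite divr_gt0.
have [r2 r20 r2H] := (continuous_atP _ _).1 (Ck_cont (Ck_partial i (Ck_partial j Hf)) Sx) _ e2.
have [r3 r30 r3H] := (continuous_atP _ _).1 (Ck_cont (Ck_partial j (Ck_partial i Hf)) Sx) _ e2.
set h := Num.min r1 (Num.min r2 r3) / 4.
have m0 : 0 < Num.min r1 (Num.min r2 r3) by rewrite !lt_min r10 r20.
have h0 : 0 < h by rewrite divr_gt0.
have hm : 2 * `|h| < Num.min r1 (Num.min r2 r3).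
  by rewrite gtr0_norm// /h; move: m0; set m := Num.min _ _; lra.
move: (hm); rewrite !lt_min => /andP[hr1 /andP[hr2 hr3]].
have HS y : `|y - x| <= 2 * `|h| -> S y.
  by move=> yh; apply: r1H; rewrite (le_trans yh)// ltW.
have [y yh Ey] := second_diff i j Hf HS.
have [z zh Ez] := second_diff j i Hf HS.
have E : partial j (partial i f) y = partial i (partial j f) z.
  apply: (mulfI (lt0r_neq0 h0)); apply: (mulfI (lt0r_neq0 h0)).
  have Ex := addrAC x (h *: delta_mx 0 j) (h *: delta_mx 0 i).
  apply: (etrans (esym Ey)); apply: (etrans _ Ez); move: Ex {Ey Ez}.
  move: (x + h *: delta_mx 0 j + _) (x + h *: delta_mx 0 i + _) => p1 p2 ->.
  move: (f p2) (f (x + h *: delta_mx 0 i)) => p q.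
  by move: (f (x + h *: delta_mx 0 j)) (f x) => m n; ring.
have A1 := r2H z (le_lt_trans zh hr2).
have A2 := r3H y (le_lt_trans yh hr3).
rewrite E in A2; exact: dist_half A1 A2.
Qed.

End Smooth.

(** * A gradient bound from a barrier function *)

Section BarrierArithmetic.
Context {R : realType}.

Lemma shift_in_itv (zi l r t : R) : `|t| < Num.min (zi - l) (r - zi) -> l <= zi + t <= r.
Proof.
rewrite lt_min !ltr_norml => /andP[/andP[t1 t2] /andP[t3 t4]].
by apply/andP; split; lra.
Qed.

Lemma second_diff_combine (s b1 b2 b3 f1 f2 f3 Lp Lq P Q C T e : R) : `|s| = 1 ->
  b3 - f3 <= b1 - f1 -> b3 - f3 <= b2 - f2 ->
  `|Lp - T * P| <= T * e -> `|Lq - T * Q| <= T * e ->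
  f1 + f2 - 2 * f3 = s / 2 * (Lp - Lq) -> b1 + b2 - 2 * b3 = 2 * C * T ->
  0 <= 2 * C * T - s / 2 * T * (P - Q) + T * e.
Proof.
move=> s1 m1 m2 Hp Hq E1 E2.
have G : `|s / 2 * (Lp - Lq) - s / 2 * T * (P - Q)| <= T * e.
  have -> : s / 2 * (Lp - Lq) - s / 2 * T * (P - Q) = s * ((Lp - T * P) - (Lq - T * Q)) / 2 by ring.
  rewrite !normrM s1 mul1r normfV (ger0_norm (ler0n _ 2)) ler_pdivrMr//.
  by apply: (le_trans (ler_normB _ _)); rewrite mulr2n mulrDr mulr1 lerD.
move: G; rewrite ler_norml -E1 => /andP[G1 G2].
have : 0 <= (b1 + b2 - 2 * b3) - (f1 + f2 - 2 * f3) by lra.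
rewrite E2; lra.
Qed.

Lemma barrier_negative (s a N P Q e T : R) : `|s| = 1 -> 0 < a -> e < a -> 0 < T ->
  `|P| <= N -> `|Q| <= N ->
  0 <= 2 * (- a - N / 2) * T - s / 2 * T * (P - Q) + T * e -> False.
Proof.
move=> s1 a0 ea T0 PN QN.
have : `|s / 2 * (P - Q)| <= N.
  rewrite !normrM s1 mul1r normfV (ger0_norm (ler0n _ 2)) mulrC ler_pdivrMr//.
  by apply: (le_trans (ler_normB _ _)); rewrite mulr2n mulrDr mulr1 lerD.
rewrite ler_norml => /andP[G1 _].
have -> : 2 * (- a - N / 2) * T - s / 2 * T * (P - Q) + T * e
   = T * (2 * (- a - N / 2) - s / 2 * (P - Q) + e) by ring.
rewrite pmulr_rge0//; move: G1; set X := s / 2 * _; move=> G1; lra.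
Qed.

End BarrierArithmetic.

Section Brandt.
Context {R : realType} {d : nat}.
Implicit Types (f g u : 'rV[R]_d -> R) (x y z : 'rV[R]_d) (S : set 'rV[R]_d).

Definition reflect_at (j : 'I_d) z : 'rV[R]_d := \row_i (if i == j then - z 0 i else z 0 i).

Lemma reflect_at_norm j z w : `|reflect_at j z - reflect_at j w| = `|z - w|.
Proof.
apply/eqP; rewrite eq_le; apply/andP; split; apply: norm_le_coord => // i.
  rewrite !mxE; have := coord_le_norm (z - w) i; rewrite !mxE.
  by case: ifP => // _; rewrite -opprD normrN.
have := coord_le_norm (reflect_at j z - reflect_at j w) i; rewrite !mxE.
by case: ifP => // _; rewrite -opprD normrN.
Qed.

Lemma reflect_at0 j : reflect_at j 0 = 0.
Proof. by apply/rowP => i; rewrite !mxE; case: ifP; rewrite ?oppr0. Qed.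

Lemma reflect_atD j z w : reflect_at j (z + w) = reflect_at j z + reflect_at j w.
Proof. by apply/rowP => i; rewrite !mxE; case: ifP => // _; rewrite opprD. Qed.

Lemma reflect_at_e j i (t : R) : reflect_at j (t *: delta_mx 0 i) =
  (if i == j then - t else t) *: delta_mx 0 i.
Proof.
apply/rowP => k; rewrite !mxE eqxx /=.
case: (eqVneq i k) => [<-|ik]; first by case: ifP => // _; rewrite mulNr.
by rewrite !mulr0 oppr0; case: ifP.
Qed.

(** The symmetric second difference at x is the mixed one with i = j, taken at x - h e_i. *)
Lemma second_diff_sym S f x i (h : R) : Ck 2 S f ->
  (forall y, `|y - x| <= 3 * `|h| -> S y) ->
  exists2 y, `|y - x| <= 3 * `|h| &
   f (x + h *: delta_mx 0 i) + f (x - h *: delta_mx 0 i) - 2 * f x =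
   h ^+ 2 * partial i (partial i f) y.
Proof.
move=> Hf HS.
have sub y : `|y - (x - h *: delta_mx 0 i)| <= 2 * `|h| -> `|y - x| <= 3 * `|h|.
  move=> H; have -> : y - x = (y - (x - h *: delta_mx 0 i)) + (- h) *: delta_mx 0 i.
    by apply/rowP => k; rewrite !mxE; ring.
  apply: (le_trans (ler_normD _ _)); rewrite normrZ norm_delta mulr1 normrN; lra.
have [|y yh E] := @second_diff _ _ S f (x - h *: delta_mx 0 i) i i h Hf.
  by move=> y /sub; exact: HS.
exists y; first exact: sub.
rewrite expr2 -mulrA -E !subrK; ring.
Qed.

Lemma box_argmin (lo hi : 'I_d -> R) f : (forall i, lo i <= hi i) ->
  (forall z : 'rV[R]_d, (forall i, lo i <= z 0 i <= hi i) -> {for z, continuous f}) ->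
  exists2 z : 'rV[R]_d, (forall i, lo i <= z 0 i <= hi i) &
    forall y : 'rV[R]_d, (forall i, lo i <= y 0 i <= hi i) -> f z <= f y.
Proof.
move=> lohi Cf.
pose E : set 'rV[R]_d := [set v | forall i, `[lo i, hi i]%classic (v ord0 i)].
have EP z : E z <-> (forall i, lo i <= z 0 i <= hi i).
  split=> H i; have := H i; by rewrite /= in_itv.
have cE : compact E by exact: (rV_compact (fun i => @segment_compact R (lo i) (hi i))).
have E0 : E !=set0.
  by exists (\row_i lo i); apply/EP => i; rewrite mxE lexx lohi.
have Cw : {within E, continuous f}.
  by apply: continuous_in_subspaceT => z /[1!inE] /EP; exact: Cf.
have [z] := EVT_min_rV E0 cE Cw; rewrite inE => /EP zE H.
by exists z => // y yE; apply: H; rewrite inE; apply/EP.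
Qed.

Lemma second_diff_small S f p (e : R) : open S -> Ck 2 S f -> S p -> 0 < e ->
  exists2 rho : R, 0 < rho & forall (i : 'I_d) (t : R), `|t| < rho ->
    `|f (p + t *: delta_mx 0 i) + f (p - t *: delta_mx 0 i) - 2 * f p
      - t ^+ 2 * partial i (partial i f) p| <= t ^+ 2 * e.
Proof.
move=> oS Hf Sp e0.
have [r1 r10 r1H] := (openP S).1 oS p Sp.
have [r2 r20 r2H] : exists2 r : R, 0 < r & forall i : 'I_d, forall y, `|y - p| < r ->
    `|partial i (partial i f) y - partial i (partial i f) p| < e.
  apply: (@finite_radius R d (fun i r => forall y, `|y - p| < r ->
    `|partial i (partial i f) y - partial i (partial i f) p| < e)).
    by move=> i r r' rr H y yr; apply: H; exact: lt_le_trans yr rr.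
  move=> i; apply: (continuous_atP _ _).1 => //.
  exact: Ck_cont (Ck_partial i (Ck_partial i Hf)) Sp.
exists (Num.min r1 r2 / 3); first by rewrite divr_gt0// lt_min r10.
move=> i t; rewrite ltr_pdivlMr// mulrC lt_min => /andP[t1 t2].
have [|y yh ->] := second_diff_sym (x := p) i (h := t) Hf.
  by move=> y yt; apply: r1H; rewrite (le_trans yt)// ltW.
rewrite -mulrBr normrM ger0_norm ?sqr_ge0// ler_wpM2l ?sqr_ge0//.
exact/ltW/r2H/(le_lt_trans yh).
Qed.

Variables (S : set 'rV[R]_d) (u : 'rV[R]_d -> R) (x : 'rV[R]_d) (r M N : R) (j : 'I_d) (s : R).
Hypothesis oS : open S.
Hypothesis Hu : Ck 2 S u.
Hypothesis r0 : 0 < r.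
Hypothesis M0 : 0 < M.
Hypothesis N0 : 0 <= N.
Hypothesis rS : forall y, `|y - x| <= r -> S y.
Hypothesis uM : forall y, `|y - x| <= r -> `|u y| <= M.
Hypothesis uN : forall y, `|y - x| <= r -> `|\sum_i partial i (partial i u) y| <= N.
Hypothesis s1 : `|s| = 1.

Let a := M / r ^+ 2.
Let c (i : 'I_d) := if i == j then - (d%:R * a) - N / 2 else a.
Let b := d.+1%:R * (a * r) + N / 2 * r.
(** The comparison function of Brandt on the half cube of the z with |z_i| <= r and 0 <=
    z_j. The function phi below is the part of u(x + z) that is odd under reflection in z_j, so
    it vanishes for z_j = 0, and |phi| <= M. The coefficients are chosen so that the barrier is
    at least M where some |z_i| = r and at least 0 for z_j = 0, while half the sum of its second
    derivatives is - a - N / 2, too negative for barrier - phi to have an interior minimum. *)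
Definition barrier z : R := (\sum_i c i * z 0 i ^+ 2) + b * z 0 j.
Let phi z := s * (u (x + z) - u (x + reflect_at j z)) / 2.
Let F z := barrier z - phi z.
Let lo (i : 'I_d) := if i == j then 0 else - r.

Let a0 : 0 < a. Proof. by rewrite divr_gt0// exprn_gt0. Qed.

Let in_box z : (forall i, lo i <= z 0 i <= r) -> `|z| <= r /\ `|reflect_at j z| <= r.
Proof.
move=> H; suff K : `|z| <= r.
  by split => //; rewrite -[reflect_at j z]subr0 -(reflect_at0 j) reflect_at_norm subr0.
apply: norm_le_coord; first exact: ltW.
move=> i; have := H i; rewrite ler_norml /lo; case: ifP => // _ /andP[h0 ->].
by rewrite andbT (le_trans _ h0)// oppr_le0 ltW.
Qed.

Let phiM z : `|z| <= r -> `|reflect_at j z| <= r -> `|phi z| <= M.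
Proof.
move=> z1 z2; rewrite /phi 2!normrM s1 mul1r normfV (ger0_norm (ler0n _ 2)).
rewrite ler_pdivrMr//; apply: (le_trans (ler_normB _ _)).
have := uM (y := x + z); have := uM (y := x + reflect_at j z).
rewrite ![x + _ - x]addrAC subrr !add0r => /(_ z2) h2 /(_ z1) h1; lra.
Qed.

(** A sum of three terms, each of them nonnegative on the half cube. *)
Let barrierE z : barrier z = a * (\sum_(i | i != j) z 0 i ^+ 2)
  + z 0 j * (d.+1%:R * (a * r) - d%:R * a * z 0 j) + N / 2 * (z 0 j * (r - z 0 j)).
Proof.
rewrite /barrier (bigD1 j)//= {1}/c eqxx mulr_sumr.
rewrite (eq_bigr (fun i => a * z 0 i ^+ 2)); last by move=> i ij; rewrite /c (negbTE ij).
rewrite /b; ring.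
Qed.

Let d1 : d.+1%:R = d%:R + 1 :> R. Proof. by rewrite -natr1. Qed.

Let barrier_lat z i : (forall i, lo i <= z 0 i <= r) -> i != j -> `|z 0 i| = r -> M <= barrier z.
Proof.
move=> zE ij zi; rewrite barrierE (bigD1 i)//=.
have := zE j; rewrite /lo eqxx => /andP[z0 zr].
have -> : z 0 i ^+ 2 = r ^+ 2 by rewrite -zi real_normK// num_real.
set T := \sum_(_ | _) _; have T0 : 0 <= T by apply: sumr_ge0 => k _; exact: sqr_ge0.
have aM : a * r ^+ 2 = M by rewrite /a divfK// gt_eqF// exprn_gt0.
have h1 : 0 <= a * T by rewrite mulr_ge0// ltW.
have h2 : 0 <= z 0 j * (d.+1%:R * (a * r) - d%:R * a * z 0 j).
  rewrite mulr_ge0// d1 mulrDl mul1r addrAC -mulrA -mulrBr -mulrBr addr_ge0//.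
    by rewrite mulr_ge0// mulr_ge0 ?subr_ge0// ltW.
  by rewrite mulr_ge0 ?ltW.
have h3 : 0 <= N / 2 * (z 0 j * (r - z 0 j)).
  by rewrite mulr_ge0 ?divr_ge0// mulr_ge0// subr_ge0.
by rewrite mulrDr aM -!addrA lerDl addr_ge0// addr_ge0.
Qed.

Let barrier_top z : z 0 j = r -> M <= barrier z.
Proof.
move=> zj; rewrite barrierE zj subrr !mulr0 addr0.
have aM : a * r ^+ 2 = M by rewrite /a divfK// gt_eqF// exprn_gt0.
have -> : r * (d.+1%:R * (a * r) - d%:R * a * r) = M by rewrite d1 -aM; ring.
rewrite lerDr mulr_ge0 ?(ltW a0)//; apply: sumr_ge0 => k _; exact: sqr_ge0.
Qed.

Let barrier_bot z : z 0 j = 0 -> 0 <= barrier z.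
Proof.
move=> zj; rewrite barrierE zj !mul0r mulr0 !addr0.
rewrite mulr_ge0 ?(ltW a0)//; apply: sumr_ge0 => k _; exact: sqr_ge0.
Qed.

Let sum_c : \sum_i c i = - a - N / 2.
Proof.
rewrite (bigD1 j)//= {1}/c eqxx (eq_bigr (fun=> a)); last by move=> i ij; rewrite /c (negbTE ij).
rewrite sumr_const (eq_card (B := predC1 j)) ?cardC1 ?card_ord//.
have d0 : (0 < d)%N := leq_ltn_trans (leq0n _) (ltn_ord j).
rewrite -(prednK d0) /= -natr1 -mulr_natl; ring.
Qed.

Let barrier_diff z i (t : R) :
  barrier (z + t *: delta_mx 0 i) + barrier (z - t *: delta_mx 0 i) - 2 * barrier z
  = 2 * c i * t ^+ 2.
Proof.
rewrite /barrier.
have -> : 2 * c i * t ^+ 2 = \sum_k (if k == i then 2 * c k * t ^+ 2 else 0).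
  by rewrite -big_mkcond /= big_pred1_eq.
set A := \sum_k _ ; set B := \sum_k _; set C := \sum_k c k * z 0 k ^+ 2; set D := \sum_k _.
have -> : D = A + B - 2 * C.
  rewrite /A /B /C /D mulr_sumr -big_split -sumrB /=; apply: eq_bigr => k _.
  rewrite !mxE eqxx /=; case: eqP => _ /=; rewrite ?mulr1n ?mulr0n ?mulr1 ?mulr0; ring.
rewrite !mxE; ring.
Qed.

Let F_cont z : (forall i, lo i <= z 0 i <= r) -> {for z, continuous F}.
Proof.
move=> /in_box[z1 z2].
have Cu w (T : 'rV[R]_d -> 'rV[R]_d) : `|T w| <= r ->
    (forall y, `|T y - T w| = `|y - w|) -> {for w, continuous (fun y => u (x + T y))}.
  move=> wr TI; apply/continuous_atP => e e0.
  have Sw : S (x + T w) by apply: rS; rewrite addrAC subrr add0r.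
  have [rho rho0 H] := (continuous_atP _ _).1 (Ck_cont Hu Sw) e e0.
  exists rho => // y yw; apply: H.
  by rewrite opprD addrACA subrr add0r TI.
rewrite /F; apply: cont_add.
  rewrite /barrier; apply: cont_add.
    apply: cont_sum => i; apply: cont_mul; first exact: cst_continuous.
    by apply: cont_mul; exact: cont_coord.
  by apply: cont_mul; [exact: cst_continuous|exact: cont_coord].
have -> : (fun y => - phi y) = (fun y => (- s / 2) * (u (x + id y) + -1 * u (x + reflect_at j y))).
  by apply/funext => y; rewrite /phi; ring.
apply: cont_mul; first exact: cst_continuous.
apply: cont_add; first exact: Cu.
apply: cont_mul; first exact: cst_continuous.
by apply: Cu => // y; exact: reflect_at_norm.
Qed.

Let phi_diff z i (t : R) : phi (z + t *: delta_mx 0 i) + phi (z - t *: delta_mx 0 i) - 2 * phi z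
  = s / 2 * ((u (x + z + t *: delta_mx 0 i) + u (x + z - t *: delta_mx 0 i) - 2 * u (x + z))
    - (u (x + reflect_at j z + t *: delta_mx 0 i) + u (x + reflect_at j z - t *: delta_mx 0 i)
      - 2 * u (x + reflect_at j z))).
Proof.
rewrite /phi !reflect_atD -!(scaleNr t (delta_mx 0 i)) !reflect_at_e !addrA.
case: ifP => _; rewrite ?opprK;
move: (u (x + z + t *: _)) (u (x + z + (- t) *: _)) (u (x + z)) => k1 k2 k3;
move: (u (x + reflect_at j z + t *: _)) (u (x + reflect_at j z + (- t) *: _)) (u (x + reflect_at j z)) => k4 k5 k6; ring.
Qed.

(** At an interior minimum the symmetric second differences of F in all directions are
    nonnegative, but their sum is about t^2 times the sum of the second derivatives of F, which
    is at most - 2 a. *)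
Let F_interior z : (forall i, lo i < z 0 i < r) -> (forall i, lo i <= z 0 i <= r) ->
  (forall y : 'rV[R]_d, (forall i, lo i <= y 0 i <= r) -> F z <= F y) -> False.
Proof.
move=> zI zE zmin; have [z1 z2] := in_box zE.
have [p pH] : {p | p = x + z} by exists (x + z).
have [q qH] : {q | q = x + reflect_at j z} by exists (x + reflect_at j z).
have pr : `|p - x| <= r by rewrite pH addrAC subrr add0r.
have qr : `|q - x| <= r by rewrite qH addrAC subrr add0r.
have e0 : 0 < a / d.+1%:R by rewrite divr_gt0.
have [rp rp0 Hp] := second_diff_small oS Hu (rS pr) e0.
have [rq rq0 Hq] := second_diff_small oS Hu (rS qr) e0.
have [rz rz0 Hz] : exists2 rho : R, 0 < rho & forall i, forall t, `|t| < rho ->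
   lo i <= z 0 i + t <= r.
  apply: (@finite_radius R d (fun i rho => forall t, `|t| < rho -> lo i <= z 0 i + t <= r)).
    by move=> i rho rho' rr H y yr; apply: H; exact: lt_le_trans yr rr.
  move=> i; have /andP[i1 i2] := zI i.
  exists (Num.min (z 0 i - lo i) (r - z 0 i)); first by rewrite lt_min !subr_gt0 i1.
  move=> t; exact: shift_in_itv.
have [t [t0 tp tq tz]] : exists t : R, [/\ 0 < t, `|t| < rp, `|t| < rq & `|t| < rz].
  exists (Num.min rp (Num.min rq rz) / 2).
  have m0 : 0 < Num.min rp (Num.min rq rz) by rewrite !lt_min rp0 rq0.
  have m1 : `|Num.min rp (Num.min rq rz) / 2| < Num.min rp (Num.min rq rz).
    by rewrite ger0_norm ?divr_ge0 ?ltW// ltr_pdivrMr// ltr_pMr// ltr1n.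
  split; first by rewrite divr_gt0.
  - by apply: lt_le_trans m1 _; rewrite ge_min lexx.
  - by apply: lt_le_trans m1 _; rewrite !ge_min lexx orbT.
  - by apply: lt_le_trans m1 _; rewrite !ge_min lexx !orbT.
have zt i k : `|k| < rz -> forall l, lo l <= (z + k *: delta_mx 0 i) 0 l <= r.
  move=> kz l; rewrite !mxE eqxx /=; case: eqP => _ /=; first by rewrite mulr1; exact: Hz.
  by rewrite mulr0 addr0; exact: zE.
have key i : 0 <= 2 * c i * t ^+ 2 - s / 2 * t ^+ 2 * (partial i (partial i u) p - partial i (partial i u) q)
    + t ^+ 2 * (a / d.+1%:R).
  have m1 := zmin _ (zt i t tz).
  have m2 : F z <= F (z - t *: delta_mx 0 i).
    by rewrite -scaleNr; apply: zmin; apply: zt; rewrite normrN.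
  have E1 := phi_diff z i t; rewrite -pH -qH in E1.
  exact: (second_diff_combine s1 m1 m2 (Hp i t tp) (Hq i t tq) E1 (barrier_diff z i t)).
have sumkey : 0 <= \sum_i (2 * c i * t ^+ 2 - s / 2 * t ^+ 2 * (partial i (partial i u) p - partial i (partial i u) q)
    + t ^+ 2 * (a / d.+1%:R)).
  by apply: sumr_ge0 => i _; exact: key.
move: sumkey; rewrite big_split /= sumrB -mulr_suml -mulr_sumr -mulr_sumr sum_c sumrB.
rewrite sumr_const card_ord.
have := uN pr; have := uN qr.
move=> QN PN.
have ea : a / d.+1%:R *+ d < a.
  by rewrite -[_ *+ d]mulr_natr mulrAC ltr_pdivrMr// ltr_pM2l// ltr_nat.
have T0 : 0 < t ^+ 2 by rewrite exprn_gt0.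
rewrite -mulrnAr; exact: (barrier_negative s1 a0 ea T0 PN QN).
Qed.

(** The minimum of F is attained on the boundary, where the barrier dominates phi. *)
Let F_ge0 y : (forall i, lo i <= y 0 i <= r) -> 0 <= F y.
Proof.
have lohi i : lo i <= r by rewrite /lo; case: ifP => _; rewrite ?ltW// gt0_cp.
have [z zE zmin] := box_argmin lohi F_cont.
move=> yE; apply: le_trans (zmin y yE).
have [z1 z2] := in_box zE.
have := phiM z1 z2; rewrite ler_norml => /andP[_ phz].
have [zj0|zj0] := eqVneq (z 0 j) 0.
  rewrite /F subr_ge0; apply: le_trans (barrier_bot zj0).
  have -> : phi z = 0; last by [].
  rewrite /phi; have -> : reflect_at j z = z; last by rewrite subrr mulr0 mul0r.
  by apply/rowP => i; rewrite mxE; case: eqP => // ->; rewrite zj0 oppr0.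
have [zjr|zjr] := eqVneq (z 0 j) r.
  by rewrite /F subr_ge0; apply: le_trans phz (barrier_top zjr).
have [[i ij zi]|H] := pselect (exists2 i, i != j & `|z 0 i| = r).
  by rewrite /F subr_ge0; apply: le_trans phz (barrier_lat zE ij zi).
exfalso; apply: (F_interior _ zE zmin) => i.
have /andP[] := zE i; rewrite /lo; case: eqVneq => [->|ij] h1 h2.
  by rewrite !lt_neqAle h1 h2 eq_sym zj0 zjr.
rewrite !lt_neqAle h1 h2 !andbT; apply/andP; split; apply/eqP => zi; apply: H; exists i => //.
  by rewrite -zi normrN gtr0_norm.
by rewrite zi gtr0_norm.
Qed.

(** At z = t e_j the bound phi <= barrier, divided by t, becomes a bound on the derivative
    as t tends to 0, since phi z = s t times a derivative of u near x by the mean value theorem.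
    *)
Lemma brandt_one_sided : s * partial j u x <= d.+1%:R * M / r + N * r / 2.
Proof.
have Sx : S x by apply: rS; rewrite subrr normr0 ltW.
apply/ler_addgt0Pr => e e0.
have [rho rho0 H] := (continuous_atP _ _).1 (Ck_cont (Ck_partial j Hu) Sx) e e0.
set t := Num.min r rho / 8.
have m0 : 0 < Num.min r rho by rewrite lt_min r0.
have t0 : 0 < t by rewrite divr_gt0.
have tm : 8 * t = Num.min r rho by rewrite mulrC divfK.
have tr : 8 * t <= r by rewrite tm ge_min lexx.
have trho : 8 * t <= rho by rewrite tm ge_min lexx orbT.
have tE : forall i, lo i <= (t *: delta_mx 0 j : 'rV[R]_d) 0 i <= r.
  move=> i; rewrite !mxE eqxx /= /lo; case: eqP => _ /=.
    by rewrite mulr1 ltW//=; lra.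
  by rewrite mulr0 ltW ?oppr_lt0//= ltW.
have := F_ge0 tE; rewrite /F subr_ge0 /phi reflect_at_e eqxx barrierE !mxE !eqxx mulr1.
rewrite big1 ?mulr0 ?add0r; last first.
  by move=> i ij; rewrite !mxE (negbTE ij) andbF mulr0 expr0n.
have [tau taut] : exists2 tau : R, `|tau| <= `|2 * t| &
   u (x - t *: delta_mx 0 j + (2 * t) *: delta_mx 0 j) - u (x - t *: delta_mx 0 j)
   = 2 * t * partial j u (x - t *: delta_mx 0 j + tau *: delta_mx 0 j).
  apply: mvt_line => tau th; apply: (Ck_derivable (k := 1) Hu); apply: rS.
  rewrite addr3B -scaleNr -scalerDl normrZ norm_delta mulr1 (le_trans (ler_normD _ _))// normrN.
  by apply: (le_trans (lerD (lexx _) th)); rewrite !gtr0_norm ?mulr_gt0//; lra.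
have -> : x - t *: delta_mx 0 j + (2 * t) *: delta_mx 0 j = x + t *: delta_mx 0 j.
  by rewrite -addrA -scaleNr -scalerDl; congr (_ + _ *: _); ring.
rewrite scaleNr => -> .
set y := x - _ + _ => K.
have yx : `|y - x| < rho.
  rewrite /y addr3B -scaleNr -scalerDl normrZ norm_delta mulr1 (le_lt_trans (ler_normD _ _))// normrN.
  by apply: (le_lt_trans (lerD (lexx _) taut)); rewrite !gtr0_norm ?mulr_gt0//; lra.
have := H y yx => /= Hy.
have Hy' : s * partial j u x <= s * partial j u y + e.
  rewrite -lerBlDl -mulrBr (le_trans (ler_norm _))// normrM s1 mul1r distrC ltW//.
apply: (le_trans Hy'); rewrite lerD2r.
have : t * (s * partial j u y) <= t * (d.+1%:R * M / r + N * r / 2).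
  have E (P : R) : t * (s * P) = s * (2 * t * P) / 2 by field.
  rewrite E; apply: (le_trans K).
  have -> : d.+1%:R * M / r = d.+1%:R * (a * r).
    by rewrite /a; field; rewrite gt_eqF.
  rewrite [leRHS]mulrDr; apply: lerD.
    by rewrite ler_pM2l// gerBl; apply: mulr_ge0; rewrite ?(ltW t0)// mulr_ge0// ltW.
  rewrite (_ : t * (N * r / 2) = N / 2 * (t * r)); last by ring.
  by rewrite ler_wpM2l ?divr_ge0// ler_pM2l// gerBl ltW.
by rewrite ler_pM2l.
Qed.
End Brandt.

(** * Third derivatives of eigenfunctions *)

Section DifferenceQuotients.
Context {R : realType}.

(** The limit is the supremum of the lower bounds q s - C |s|, each of which is at most
    every upper bound q t + C |t|. *)
Lemma limit_of_linear_cauchy (q : R -> R) (C rho : R) : 0 < rho -> 0 <= C ->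
  (forall s t, s != 0 -> t != 0 -> `|s| < rho -> `|t| < rho -> `|q s - q t| <= C * (`|s| + `|t|)) ->
  exists L, forall s, s != 0 -> `|s| < rho -> `|q s - L| <= C * `|s|.
Proof.
move=> rho0 C0 H.
pose E : set R := [set y | exists s, [/\ s != 0, `|s| < rho & y = q s - C * `|s|]].
have ub t : t != 0 -> `|t| < rho -> ubound E (q t + C * `|t|).
  move=> t0 tr _ [s [s0 sr ->]].
  by have := H s t s0 t0 sr tr; rewrite ler_norml => /andP[_]; rewrite mulrDr; lra.
have r2 : rho / 2 != 0 by rewrite gt_eqF// divr_gt0.
have r2r : `|rho / 2| < rho by rewrite ger0_norm ?divr_ge0 ?ltW// ltr_pdivrMr// ltr_pMr// ltr1n.
have hE : has_sup E.
  split; first by exists (q (rho / 2) - C * `|rho / 2|); exists (rho / 2).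
  by exists (q (rho / 2) + C * `|rho / 2|); exact: ub.
exists (sup E) => s s0 sr; rewrite ler_norml; apply/andP; split.
  rewrite lerBrDr addrC -lerBrDr opprK.
  by apply: ge_sup; [case: hE|exact: ub].
rewrite lerBlDr -lerBlDl.
by apply: ub_le_sup; [case: hE|exists s].
Qed.

Lemma sum_lin (I : finType) (a b lam p q : R) (F G H : I -> R) :
  (forall i, H i = a * F i + b * G i) ->
  \sum_i F i = - (lam * p) -> \sum_i G i = - (lam * q) ->
  - (\sum_i H i) = lam * (a * p + b * q).
Proof.
move=> E EF EG; under eq_bigr do rewrite E.
rewrite big_split /= -!mulr_sumr EF EG; ring.
Qed.

Lemma limits_close (q q0 l l0 c e : R) : `|q - l| <= c -> `|q0 - l0| <= c -> `|q - q0| < e / 2 ->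
  c < e / 8 -> `|l - l0| < e.
Proof.
rewrite !ler_norml !ltr_norml => /andP[a1 a2] /andP[a3 a4] /andP[a5 a6] ce.
by apply/andP; split; lra.
Qed.

End DifferenceQuotients.

(** The constant of the gradient estimate on cubes of radius at most 1. *)
Definition grad_cst {R : realType} (d : nat) (lam : R) : R := d.+1%:R + `|lam|.

Lemma grad_cst_gt0 {R : realType} (d : nat) (lam : R) : 0 < grad_cst d lam.
Proof. by rewrite /grad_cst ltr_pwDl. Qed.

Section Elliptic.
Context {R : realType} {d : nat}.
Implicit Types (f g u : 'rV[R]_d -> R) (x y z : 'rV[R]_d) (S : set 'rV[R]_d).

Lemma partial_shift f (a : 'rV[R]_d) j :
  partial j (fun y => f (y + a)) = (fun y => partial j f (y + a)).
Proof.
apply/funext => x; rewrite /partial /derive.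
suff -> : (fun h : R => h^-1 *: (((fun y => f (y + a)) \o shift x) (h *: delta_mx 0 j) - f (x + a)))
  = (fun h : R => h^-1 *: ((f \o shift (x + a)) (h *: delta_mx 0 j) - f (x + a))) by [].
by apply/funext => h /=; rewrite addrA.
Qed.

Lemma is_derive_shift f (a : 'rV[R]_d) x v df : is_derive (x + a) v f df ->
  is_derive x v (fun y => f (y + a)) df.
Proof.
move/is_deriveP => H; apply/is_deriveP => e /H[r r0 rH]; exists r => // s s0 sr.
by have := rH s s0 sr; rewrite addrAC.
Qed.

Lemma Ck_shift k S S' f (a : 'rV[R]_d) : (forall y, S' y -> S (y + a)) -> Ck k S f ->
  Ck k S' (fun y => f (y + a)).
Proof.
move=> SS; have C0 g : (forall x, S x -> {for x, continuous g}) ->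
  forall x, S' x -> {for x, continuous (fun y => g (y + a))}.
  move=> Hg x /SS Sx; apply/continuous_atP => e e0.
  have [r r0 rH] := (continuous_atP _ _).1 (Hg _ Sx) e e0.
  by exists r => // y yx; apply: rH; rewrite opprD addrACA subrr addr0.
elim: k f => [|k IH] f Hf; first by split => //; apply: C0 => x; exact: Ck_cont Hf.
split; first by apply: C0 => x; exact: Ck_cont Hf.
split=> [x /SS Sx j|j].
  by have [] := is_derive_shift (Ck_is_derive j Hf Sx).
rewrite partial_shift; apply: IH; exact: Ck_partial.
Qed.

Lemma Ck_lin k S f g (a b : R) : open S -> Ck k S f -> Ck k S g ->
  Ck k S (fun y => a * f y + b * g y).
Proof.
move=> oS Hf Hg; apply: Ck_add => //.
  by apply: (Ck_mul oS _ Hf); exact: (Ck_cst k S a).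
by apply: (Ck_mul oS _ Hg); exact: (Ck_cst k S b).
Qed.

Lemma is_derive_lin f g (a b : R) x v df dg : is_derive x v f df -> is_derive x v g dg ->
  is_derive x v (fun y => a * f y + b * g y) (a * df + b * dg).
Proof.
move=> Hf Hg; exact: (is_deriveD (is_deriveZ a Hf) (is_deriveZ b Hg)).
Qed.

Lemma partial_lin S f g (a b : R) x j : Ck 1 S f -> Ck 1 S g -> S x ->
  partial j (fun y => a * f y + b * g y) x = a * partial j f x + b * partial j g x.
Proof.
move=> Hf Hg Sx.
by have [_] := is_derive_lin a b (Ck_is_derive j Hf Sx) (Ck_is_derive j Hg Sx).
Qed.

Lemma partial2_lin S f g (a b : R) x i j : open S -> Ck 2 S f -> Ck 2 S g -> S x ->
  partial i (partial j (fun y => a * f y + b * g y)) x =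
  a * partial i (partial j f) x + b * partial i (partial j g) x.
Proof.
move=> oS Hf Hg Sx; have P1f := Ck_partial j Hf; have P1g := Ck_partial j Hg.
rewrite -(partial_lin a b i P1f P1g Sx).
have E y : S y -> a * partial j f y + b * partial j g y = partial j (fun y => a * f y + b * g y) y.
  by move=> Sy; rewrite (partial_lin a b j (Ck_pred Hf) (Ck_pred Hg) Sy).
apply: (partial_eq_open oS E Sx).
exact: Ck_derivable (Ck_lin a b oS P1f P1g) Sx.
Qed.

Lemma sol_sub S S' (lam : R) u : S' `<=` S -> solves_eigen S lam u -> solves_eigen S' lam u.
Proof. by move=> SS [H1 H2]; split; [exact: Ck_sub H1|move=> x /SS/H2]. Qed.

Lemma sol_lap S (lam : R) u x : solves_eigen S lam u -> S x ->
  \sum_i partial i (partial i u) x = - (lam * u x).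
Proof. by move=> [_ H] /H <-; rewrite opprK. Qed.

Lemma sol_lin S (lam : R) u v (a b : R) : open S -> solves_eigen S lam u -> solves_eigen S lam v ->
  solves_eigen S lam (fun y => a * u y + b * v y).
Proof.
move=> oS Hu Hv; split; first by apply: Ck_lin => //; [case: Hu|case: Hv].
move=> x Sx; apply: sum_lin (sol_lap Hu Sx) (sol_lap Hv Sx) => // i.
by apply: (partial2_lin a b i i oS _ _ Sx); [case: Hu|case: Hv].
Qed.

Lemma lap_shift u (a : 'rV[R]_d) x : laplacian (fun y => u (y + a)) x = laplacian u (x + a).
Proof.
have E i : partial i (partial i (fun y => u (y + a))) x = partial i (partial i u) (x + a).
  by rewrite !partial_shift.
apply: (f_equal (@GRing.opp R)).
apply: eq_bigr => i _.
exact: E.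
Qed.

Lemma sol_shift S S' (lam : R) u a : (forall y, S' y -> S (y + a)) -> solves_eigen S lam u ->
  solves_eigen S' lam (fun y => u (y + a)).
Proof.
move=> SS [H1 H2]; split; first exact: Ck_shift H1.
by move=> x /SS Sx; rewrite lap_shift; exact: H2.
Qed.

Definition dquot (a : 'rV[R]_d) (s : R) f y := (f (y + s *: a) - f y) / s.

Lemma dquotE a s f : dquot a s f = (fun y => s^-1 * f (y + s *: a) + (- s^-1) * f y).
Proof. by apply/funext => y; rewrite /dquot; ring. Qed.

(** The equation is linear and invariant under translations. *)
Lemma sol_dquot S S' (lam : R) u a s : open S' -> (forall y, S' y -> S (y + s *: a)) ->
  S' `<=` S -> solves_eigen S lam u -> solves_eigen S' lam (dquot a s u).
Proof.
move=> oS S1 S2 Hu; rewrite dquotE; apply: sol_lin => //; [exact: sol_shift Hu|exact: sol_sub Hu].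
Qed.

Lemma partial_dquot S u a s x j : Ck 1 S u -> S x -> S (x + s *: a) ->
  partial j (dquot a s u) x = dquot a s (partial j u) x.
Proof.
move=> Hu S1 S2; rewrite !dquotE.
have H := is_derive_lin s^-1 (- s^-1) (is_derive_shift (Ck_is_derive j Hu S2)) (Ck_is_derive j Hu S1).
by have [_] := H.
Qed.

Lemma dquot_bound S u k x s (B : R) : Ck 1 S u -> s != 0 ->
  (forall t, `|t| <= `|s| -> S (x + t *: delta_mx 0 k)) ->
  (forall t, `|t| <= `|s| -> `|partial k u (x + t *: delta_mx 0 k)| <= B) ->
  `|dquot (delta_mx 0 k) s u x| <= B.
Proof.
move=> Hu s0 HS HB; rewrite /dquot.
have [t ts ->] := mvt_line (fun t ts => Ck_derivable (j := k) Hu (HS t ts)).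
by rewrite mulrAC divff// mul1r; exact: HB.
Qed.

(** The barrier bound for s = 1 and s = - 1, where the equation bounds the sum of the second
    derivatives of u by N = |lam| M. *)
Lemma grad_est S (lam : R) u x r M j : open S -> solves_eigen S lam u -> 0 < r -> r <= 1 -> 0 < M ->
  (forall y, `|y - x| <= r -> S y) -> (forall y, `|y - x| <= r -> `|u y| <= M) ->
  `|partial j u x| <= grad_cst d lam / r * M.
Proof.
move=> oS Hu r0 r1 M0 rS uM.
have N0 : 0 <= `|lam| * M by rewrite mulr_ge0// ltW.
have uN y : `|y - x| <= r -> `|\sum_i partial i (partial i u) y| <= `|lam| * M.
  by move=> yr; rewrite (sol_lap Hu (rS _ yr)) normrN normrM ler_wpM2l//; exact: uM.
have Hu2 : Ck 2 S u by case: Hu.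
have K : d.+1%:R * M / r + `|lam| * M * r / 2 <= grad_cst d lam / r * M.
  rewrite /grad_cst [leRHS]mulrAC [X in _ <= X / _]mulrDl [leRHS]mulrDl lerD2l -!mulrA.
  apply: ler_wpM2l => //; apply: ler_wpM2l; first exact: ltW.
  apply: (@le_trans _ _ 1); first by rewrite ler_pdivrMr// mul1r (le_trans r1)// ler1n.
  by rewrite invf_ge1.
rewrite ler_norml; apply/andP; split; last first.
  have := brandt_one_sided (s := 1) j oS Hu2 r0 M0 N0 rS uM uN; rewrite normr1 mul1r => /(_ erefl) h.
  exact: le_trans h K.
have := brandt_one_sided (s := -1) j oS Hu2 r0 M0 N0 rS uM uN; rewrite normrN1 mulN1r => /(_ erefl) h.
rewrite lerNl; exact: le_trans h K.
Qed.

(** The gradient estimate for the difference quotients of u, which are bounded by the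
    gradient estimate for u. *)
Lemma hess_est S (lam : R) u x r M i k : open S -> solves_eigen S lam u -> 0 < r -> r <= 1 -> 0 < M ->
  (forall y, `|y - x| <= 3 * r -> S y) -> (forall y, `|y - x| <= 3 * r -> `|u y| <= M) ->
  `|partial k (partial i u) x| <= grad_cst d lam / r * (grad_cst d lam / r * M).
Proof.
move=> oS Hu r0 r1 M0 rS uM.
have K0 := grad_cst_gt0 d lam; have Hu2 : Ck 2 S u by case: Hu.
set B := grad_cst d lam / r * M; have B0 : 0 < B by rewrite mulr_gt0// divr_gt0.
have gB y : `|y - x| <= 2 * r -> `|partial k u y| <= B.
  move=> yr; have sub z : `|z - y| <= r -> `|z - x| <= 3 * r.
    move=> zy; have -> : z - x = (z - y) + (y - x) by rewrite addrA subrK.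
    by apply: (le_trans (ler_normD _ _)); apply: (le_trans (lerD zy yr)); lra.
  by apply: (grad_est _ oS Hu r0 r1 M0) => z /sub; [exact: rS|exact: uM].
have Sx : S x by apply: rS; rewrite subrr normr0 mulr_ge0// ltW.
apply/ler_addgt0Pr => e e0.
have D := Ck_is_derive k (Ck_partial i Hu2) Sx.
have [rho rho0 H] := (is_deriveP _ _ _ _).1 D e e0.
set s := Num.min r rho / 2.
have m0 : 0 < Num.min r rho by rewrite lt_min r0.
have s0 : 0 < s by rewrite divr_gt0.
have sm : s < Num.min r rho by rewrite ltr_pdivrMr// ltr_pMr// ltr1n.
move: (sm); rewrite lt_min => /andP[sr srho].
have ns : `|s| = s by rewrite gtr0_norm.
have moved y t : `|y - x| <= r -> `|t| <= s -> `|y + t *: delta_mx 0 k - x| <= 2 * r.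
  move=> yr ts; rewrite addrAC (le_trans (ler_normD _ _))// normrZ norm_delta mulr1.
  by rewrite mulr2n mulrDl mul1r lerD// (le_trans ts)// ltW.
have S2 y : `|y - x| <= 2 * r -> S y by move=> yr; apply: rS; apply: (le_trans yr); lra.
set S' := cube x (2 * r).
have oS' : open S' by exact: open_cube.
have Hv : solves_eigen S' lam (dquot (delta_mx 0 k) s u).
  apply: (sol_dquot oS' _ _ Hu) => y; rewrite /S' /cube/= => yr.
    apply: rS; rewrite addrAC (le_trans (ler_normD _ _))// normrZ norm_delta mulr1 ns.
    by apply: (le_trans (lerD (ltW yr) (ltW sr))); lra.
  by apply: S2; exact: ltW.
have vB y : `|y - x| <= r -> `|dquot (delta_mx 0 k) s u y| <= B.
  move=> yr; apply: (dquot_bound (Ck_pred Hu2)); first by rewrite gt_eqF.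
    by move=> t; rewrite ns => ts; apply/S2/moved.
  by move=> t; rewrite ns => ts; apply/gB/moved.
have := grad_est i oS' Hv r0 r1 B0 _ vB.
have E : partial i (dquot (delta_mx 0 k) s u) x = dquot (delta_mx 0 k) s (partial i u) x.
  apply: (partial_dquot (S := S) _ (Ck_pred Hu2)) => //.
  by apply/S2/moved; rewrite ?subrr ?normr0 ?ns// ltW.
rewrite E => G.
have {}G := G _; apply: le_trans (_ : `|dquot (delta_mx 0 k) s (partial i u) x| + e <= _).
  have := H s; rewrite ns gt_eqF// => /(_ isT srho); rewrite -/(dquot (delta_mx 0 k) s (partial i u) x).
  set q := dquot _ _ _ _; set p := partial _ _ _ => qp.
  rewrite -lerBlDl; apply: le_trans (ltW qp).
  by rewrite distrC; exact: lerB_dist.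
rewrite lerD2r; apply: G => y yr; rewrite /S' /cube/= (le_lt_trans yr)//; lra.
Qed.

Lemma bounded_on_cube S f x r : 0 < r -> (forall y, S y -> {for y, continuous f}) ->
  (forall y, `|y - x| <= r -> S y) -> exists2 M, 0 < M & forall y, `|y - x| <= r -> `|f y| <= M.
Proof.
move=> r0 Cf rS.
have boxE y : (forall i, x 0 i - r <= y 0 i <= x 0 i + r) <-> `|y - x| <= r.
  split=> H.
    apply: norm_le_coord; first exact: ltW.
    by move=> i; have /andP[h1 h2] := H i; rewrite !mxE ler_norml; apply/andP; split; lra.
  move=> i; have := le_trans (coord_le_norm (y - x) i) H.
  by rewrite !mxE ler_norml => /andP[h1 h2]; apply/andP; split; lra.
have [|z /boxE zr|z zb H] := @box_argmin R d (fun i => x 0 i - r) (fun i => x 0 i + r) (fun y => - `|f y|).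
- by move=> i; rewrite lerBlDr -addrA lerDl addr_ge0// ltW.
- apply/continuous_atP => e e0.
  have [rho rho0 K] := (continuous_atP _ _).1 (Cf _ (rS _ zr)) e e0.
  exists rho => // y /K; apply: le_lt_trans.
  rewrite -opprD normrN; exact: ler_dist_dist.
exists (`|f z| + 1); first by rewrite ltr_pwDr.
move=> y /boxE/H; rewrite lerN2 => h; by rewrite (le_trans h)// lerDl.
Qed.

(** Let v be the difference of the quotients of u with steps s and t. Both are within B |s|,
    respectively B |t|, of the derivative of u, so the second derivatives of the eigenfunction v
    are at most a multiple of |s| + |t| by the Hessian estimate. Hence the difference quotients
    of the second derivatives of u have a limit L, with an error linear in the step and uniform
    near x0, and therefore L is continuous. *)
Lemma third_derivative S (lam : R) u x0 i j k : open S -> solves_eigen S lam u -> S x0 ->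
  exists r, exists L : 'rV[R]_d -> R, [/\ 0 < r, (forall y, `|y - x0| <= r -> S y),
    (forall y, `|y - x0| <= r -> is_derive y (delta_mx 0 k) (partial i (partial j u)) (L y))
    & {for x0, continuous L}].
Proof.
move=> oS Hu Sx0; have Hu2 : Ck 2 S u by case: Hu.
have [r1 r10 r1H] := (openP S).1 oS x0 Sx0.
(* All points used below are within 8 r of x0: two difference steps, the radius 3 r of the
   Hessian estimate, and the distance of y from x0. *)
have [r [r0 rle rS]] : exists r, [/\ 0 < r, r <= 1 & forall y, `|y - x0| <= 8 * r -> S y].
  exists (Num.min 1 (r1 / 8)); split; first by rewrite lt_min ltr01 divr_gt0.
    by rewrite ge_min lexx.
  move=> y yr; apply: r1H; apply: (le_trans yr).
  by rewrite mulrC -ler_pdivlMr// ge_min lexx orbT.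
have nearS (c : R) y : c <= 8 -> `|y - x0| <= c * r -> S y.
  by move=> c8 yr; apply: rS; apply: (le_trans yr); rewrite ler_pM2r.
have shiftb (c : R) y t : `|y - x0| <= c * r -> `|t| <= r -> `|y + t *: delta_mx 0 k - x0| <= (c + 1) * r.
  move=> yr tr; rewrite addrAC (le_trans (ler_normD _ _))// normrZ norm_delta mulr1.
  by rewrite mulrDl mul1r lerD.
have [B B0 HB] : exists2 B, 0 < B & forall y, `|y - x0| <= 6 * r -> `|partial k (partial k u) y| <= B.
  apply: (@bounded_on_cube S); first by rewrite mulr_gt0.
    by move=> y Sy; exact: Ck_cont (Ck_partial k (Ck_partial k Hu2)) Sy.
  by move=> y; apply: nearS; rewrite ler_nat.
pose K := grad_cst d lam / r; have K0 : 0 < K by rewrite divr_gt0// grad_cst_gt0.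
have us y s : s != 0 -> `|s| < r -> `|y - x0| <= 5 * r ->
    `|dquot (delta_mx 0 k) s u y - partial k u y| <= B * `|s|.
  move=> s0 sr yr.
  have [t ts E] := mvt_line (fun t (ts : `|t| <= `|s|) => Ck_derivable (j := k) (Ck_pred Hu2)
     (nearS (5 + 1) _ (ltac:(lra)) (shiftb 5 y t yr (ltW (le_lt_trans ts sr))))).
  have [t' ts' E'] := mvt_line (fun t' (ts' : `|t'| <= `|t|) => Ck_derivable (j := k) (Ck_partial k Hu2)
     (nearS (5 + 1) _ (ltac:(lra)) (shiftb 5 y t' yr (ltW (le_lt_trans ts' (le_lt_trans ts sr)))))).
  rewrite /dquot E mulrAC divff// mul1r; rewrite -/(partial k u) E' normrM mulrC.
  apply: ler_pM => //; apply: HB.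
  have := shiftb 5 y t' yr (ltW (le_lt_trans ts' (le_lt_trans ts sr))).
  by have -> : 5 + 1 = 6 :> R by ring.
pose w := partial i (partial j u).
pose C := K * (K * B).
have C0 : 0 <= C := mulr_ge0 (ltW K0) (mulr_ge0 (ltW K0) (ltW B0)).
have cau y : `|y - x0| <= r -> forall s t, s != 0 -> t != 0 -> `|s| < r -> `|t| < r ->
   `|dquot (delta_mx 0 k) s w y - dquot (delta_mx 0 k) t w y| <= C * (`|s| + `|t|).
  move=> yr s t s0 t0 sr tr.
  set S1 := cube x0 (7 * r).
  have oS1 : open S1 by exact: open_cube.
  have S1S z : S1 z -> S z by move=> /ltW; apply: nearS; rewrite ler_nat.
  have S1S' s' z : `|s'| < r -> S1 z -> S (z + s' *: delta_mx 0 k).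
    move=> s'r /ltW z7; apply: (nearS (7 + 1)); first by lra.
    by apply: shiftb => //; exact: ltW.
  have D s' : `|s'| < r -> solves_eigen S1 lam (dquot (delta_mx 0 k) s' u).
    by move=> s'r; apply: (sol_dquot oS1 _ S1S Hu) => z; exact: S1S'.
  have Hv := sol_lin 1 (-1) oS1 (D s sr) (D t tr).
  set v := (fun y => _) in Hv.
  have M0 : 0 < B * (`|s| + `|t|) by rewrite mulr_gt0// ltr_pwDl// normr_gt0.
  have vB z : `|z - y| <= 3 * r -> `|v z| <= B * (`|s| + `|t|).
    move=> zy; have z5 : `|z - x0| <= 5 * r.
      have -> : z - x0 = (z - y) + (y - x0) by rewrite addrA subrK.
      by apply: (le_trans (ler_normD _ _)); apply: (le_trans (lerD zy yr)); lra.
    rewrite /v mul1r mulN1r mulrDr.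
    have h1 := us z s s0 sr z5; have h2 := us z t t0 tr z5.
    have -> : dquot (delta_mx 0 k) s u z - dquot (delta_mx 0 k) t u z =
      (dquot (delta_mx 0 k) s u z - partial k u z) - (dquot (delta_mx 0 k) t u z - partial k u z).
      by rewrite opprB addrA subrK.
    by apply: (le_trans (ler_normB _ _)); exact: lerD.
  have vS z : `|z - y| <= 3 * r -> S1 z.
    move=> zy; rewrite /S1 /cube/=.
    have -> : z - x0 = (z - y) + (y - x0) by rewrite addrA subrK.
    by apply: (le_lt_trans (ler_normD _ _)); apply: (le_lt_trans (lerD zy yr)); lra.
  have H := hess_est j i oS1 Hv r0 rle M0 vS vB.
  have E s' : `|s'| < r -> partial i (partial j (dquot (delta_mx 0 k) s' u)) y = dquot (delta_mx 0 k) s' w y.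
    move=> s'r; have S1y : S1 y by rewrite /S1 /cube/= (le_lt_trans yr)//; lra.
    have Sy := S1S _ S1y; have Sy' := S1S' _ _ s'r S1y.
    have P1 : partial i (dquot (delta_mx 0 k) s' (partial j u)) y = dquot (delta_mx 0 k) s' w y.
      exact: (partial_dquot i (Ck_partial j Hu2) Sy Sy').
    rewrite -P1; apply: (partial_eq_open oS1 _ S1y).
      move=> z S1z; apply: esym; apply: (partial_dquot j (Ck_pred Hu2)); first exact: S1S.
      exact: S1S'.
    rewrite dquotE.
    have Dj := is_derive_lin s'^-1 (- s'^-1) (is_derive_shift (Ck_is_derive i (Ck_partial j Hu2) Sy')) (Ck_is_derive i (Ck_partial j Hu2) Sy).
    by case: Dj.
  move: H; rewrite /v.
  have [Ds2 _] := D s sr; have [Dt2 _] := D t tr.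
  have S1y : S1 y by rewrite /S1 /cube/= (le_lt_trans yr)//; lra.
  rewrite (partial2_lin 1 (-1) i j oS1 Ds2 Dt2 S1y) E// E// mul1r mulN1r => H.
  by have -> : C * (`|s| + `|t|) = K * (K * (B * (`|s| + `|t|))) by rewrite /C !mulrA.
have {cau} [L HL] : {L : 'rV[R]_d -> R & forall y, `|y - x0| <= r -> forall s, s != 0 -> `|s| < r ->
    `|dquot (delta_mx 0 k) s w y - L y| <= C * `|s|}.
  apply: (@choice _ _ (fun y l => `|y - x0| <= r -> forall s, s != 0 -> `|s| < r ->
    `|dquot (delta_mx 0 k) s w y - l| <= C * `|s|)) => y.
  have [yr|ny] := pselect (`|y - x0| <= r); last by exists 0.
  by have [l Hl] := limit_of_linear_cauchy r0 C0 (cau y yr); exists l.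
exists r, L; split => //.
- by move=> y yr; apply: (nearS 1); rewrite ?mul1r// ler1n.
- move=> y yr; apply/is_deriveP => e e0; exists (Num.min r (e / (C + 1))).
    by rewrite lt_min r0 divr_gt0// ltr_wpDl.
  move=> s s0; rewrite lt_min => /andP[sr se].
  apply: le_lt_trans (HL y yr s s0 sr) _.
  apply: le_lt_trans (_ : (C + 1) * `|s| < e); first by rewrite ler_wpM2r// lerDl.
  by rewrite mulrC -ltr_pdivlMr// ltr_wpDl.
apply/continuous_atP => e e0.
set s := Num.min r (e / (8 * (C + 1))) / 2.
have C1 : 0 < C + 1 by rewrite ltr_wpDl.
have m0 : 0 < Num.min r (e / (8 * (C + 1))) by rewrite lt_min r0 divr_gt0// mulr_gt0.
have s0 : 0 < s by rewrite divr_gt0.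
have sm : s < Num.min r (e / (8 * (C + 1))) by rewrite ltr_pdivrMr// ltr_pMr// ltr1n.
move: (sm); rewrite lt_min => /andP[sr se].
have ns : `|s| = s by rewrite gtr0_norm.
have Cs : C * `|s| < e / 8.
  rewrite ns; apply: le_lt_trans (_ : (C + 1) * s < _); first by rewrite ler_wpM2r ?(ltW s0)// lerDl.
  by rewrite mulrC -ltr_pdivlMr// -mulrA -invfM.
have Cw : {for x0, continuous (dquot (delta_mx 0 k) s w)}.
  have Ckw : Ck 0 S w by exact: (Ck_partial i (Ck_partial j Hu2)).
  have C00 : Ck 0 (cube x0 r) (fun y => w (y + s *: delta_mx 0 k)).
    apply: (Ck_shift _ Ckw) => y /ltW yr; apply: (nearS (1 + 1)); first by lra.
    by apply: shiftb; rewrite ?mul1r// ns ltW.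
  have C01 : Ck 0 (cube x0 r) w.
    by apply: (Ck_sub _ Ckw) => y /ltW yr; apply: (nearS 1); rewrite ?mul1r// ler1n.
  have C02 := Ck_lin s^-1 (- s^-1) (open_cube (x := x0) (r := r)) C00 C01.
  by rewrite dquotE; apply: (Ck_cont C02); rewrite /cube/= subrr normr0.
have e2 : 0 < e / 2 by rewrite divr_gt0.
have [rho rho0 Hrho] := (continuous_atP _ _).1 Cw _ e2.
exists (Num.min rho r); first by rewrite lt_min rho0.
move=> y; rewrite lt_min => /andP[yrho yr].
have s0' : s != 0 by rewrite gt_eqF.
have sr' : `|s| < r by rewrite ns.
have h1 := HL y (ltW yr) s s0' sr'.
have h2 : `|dquot (delta_mx 0 k) s w x0 - L x0| <= C * `|s|.
  by apply: HL => //; rewrite subrr normr0 ltW.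
have h3 := Hrho y yrho.
exact: limits_close h1 h2 h3 Cs.
Qed.

End Elliptic.

(** * Cauchy estimates for eigenfunctions *)

Lemma is_derive_sum {R : realType} {V : normedModType R} (I : finType) (F : I -> V -> R) (dF : I -> R) (x v : V) :
  (forall i, is_derive x v (F i) (dF i)) ->
  is_derive x v (fun y => \sum_i F i y) (\sum_i dF i).
Proof.
move=> H; elim: (index_enum I) => [|i r IH].
  have -> : (fun y => \sum_(i <- [::]) F i y) = cst 0 by apply/funext => y; rewrite big_nil.
  rewrite big_nil; exact: is_derive_cst.
have -> : (fun y => \sum_(j <- i :: r) F j y) = (fun y => F i y + \sum_(j <- r) F j y).
  by apply/funext => y; rewrite big_cons.
rewrite big_cons; exact: is_deriveD.
Qed.

Section Words.
Context {R : realType} {d : nat}.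
Implicit Types (f g u : 'rV[R]_d -> R) (x y z : 'rV[R]_d) (S : set 'rV[R]_d) (J : seq 'I_d).

(** The letters of J are applied from the right: the last letter of a word is the first
    derivative taken. *)
Definition partials J f : 'rV[R]_d -> R := foldr partial f J.

Lemma partials_cons i J f : partials (i :: J) f = partial i (partials J f).
Proof. by []. Qed.

Definition smooth S f := forall k, Ck k S f.

Lemma smooth_partial S f j : smooth S f -> smooth S (partial j f).
Proof. by move=> H k; exact: Ck_partial (H k.+1). Qed.

Lemma smooth_partials S f J : smooth S f -> smooth S (partials J f).
Proof. by move=> H; elim: J => //= i J; exact: smooth_partial. Qed.

(** By the existence and continuity of third derivatives the equation can be differentiated,
    and the derivatives commute. *)
Lemma sol_partial S (lam : R) u j : open S -> solves_eigen S lam u -> solves_eigen S lam (partial j u).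
Proof.
move=> oS Hu; have Hu2 : Ck 2 S u by case: Hu.
have H3 i j' : Ck 1 S (partial i (partial j' u)).
  split; first by move=> x; exact: Ck_cont (Ck_partial i (Ck_partial j' Hu2)).
  split=> [x Sx k|k].
    have [r [L [r0 rS HL _]]] := third_derivative i j' k oS Hu Sx.
    by have [] := HL x; rewrite ?subrr ?normr0 ?ltW.
  split=> // x Sx.
  have [r [L [r0 rS HL CL]]] := third_derivative i j' k oS Hu Sx.
  have E y : cube x r y -> L y = partial k (partial i (partial j' u)) y.
    by move=> /ltW yr; have [_] := HL y yr.
  have C0L : Ck 0 (cube x r `&` [set x]) L by split => // z [_ ->].
  apply/continuous_atP => e e0.
  have [rho rho0 H] := (continuous_atP _ _).1 CL e e0.
  exists (Num.min rho r); first by rewrite lt_min rho0.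
  move=> y; rewrite lt_min => /andP[y1 y2].
  by rewrite -E// -E; [exact: H|rewrite /cube/= subrr normr0].
have C2 j' : Ck 2 S (partial j' u).
  split; first by move=> x; exact: Ck_cont (Ck_partial j' Hu2).
  split=> [x Sx k|k]; last exact: H3.
  exact: Ck_derivable (Ck_partial j' Hu2) Sx.
split; first exact: C2.
move=> x Sx; rewrite /laplacian.
have D1 : is_derive x (delta_mx 0 j) (fun y => \sum_i partial i (partial i u) y)
    (\sum_i partial j (partial i (partial i u)) x).
  by apply: is_derive_sum => i; exact: Ck_is_derive (H3 i i) Sx.
have D2 : is_derive x (delta_mx 0 j) (fun y => \sum_i partial i (partial i u) y) (- (lam * partial j u x)).
  have Du := Ck_is_derive j (Ck_pred Hu2) Sx.
  have H := is_deriveN (is_deriveZ lam Du).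
  apply: is_derive_eq_open oS _ Sx H => y Sy.
  by rewrite (sol_lap Hu Sy).
have E : \sum_i partial j (partial i (partial i u)) x = - (lam * partial j u x).
  by have [_ <-] := D1; have [_ <-] := D2.
have E2 : \sum_i partial i (partial i (partial j u)) x = \sum_i partial j (partial i (partial i u)) x.
  apply: eq_bigr => i _.
  apply: (etrans _ (schwarz i j oS (C2 i) Sx)).
  apply: (partial_eq_open oS _ Sx); last exact: Ck_derivable (H3 j i) Sx.
  by move=> y Sy; apply: schwarz oS Hu2 Sy.
apply: (etrans (f_equal (@GRing.opp R) (etrans E2 E))); exact: opprK.
Qed.

Lemma sol_partials S (lam : R) u J : open S -> solves_eigen S lam u -> solves_eigen S lam (partials J u).
Proof. by move=> oS Hu; elim: J => //= i J; exact: sol_partial. Qed.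

Lemma sol_smooth S (lam : R) u : open S -> solves_eigen S lam u -> smooth S u.
Proof.
move=> oS Hu k; elim: k u Hu => [|k IH] u Hu.
  by have [H _] := Hu; split => // x; exact: Ck_cont H.
have [H _] := Hu; split; first by move=> x; exact: Ck_cont H.
split; first by move=> x Sx j; exact: Ck_derivable (Ck_pred H) Sx.
by move=> j; apply: IH; exact: sol_partial.
Qed.

(** Each of the m derivatives costs a step h in the radius, as all the intermediate
    derivatives are eigenfunctions. *)
Lemma sol_word_est S (lam : R) u x h M J m : open S -> solves_eigen S lam u ->
  0 < h -> h <= 1 -> 0 < M -> size J = m ->
  (forall y, `|y - x| <= m%:R * h -> S y) -> (forall y, `|y - x| <= m%:R * h -> `|u y| <= M) ->
  `|partials J u x| <= (grad_cst d lam / h) ^+ m * M.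
Proof.
move=> oS Hu h0 h1 M0; have K0 := grad_cst_gt0 d lam.
elim: J m x => [|i J IH] m x <- /= HS HM.
  by rewrite expr0 mul1r; apply: HM; rewrite subrr normr0 mul0r.
have HB : 0 < (grad_cst d lam / h) ^+ size J * M by rewrite mulr_gt0// exprn_gt0// divr_gt0.
have sub y z : `|y - x| <= h -> `|z - y| <= (size J)%:R * h -> `|z - x| <= (size J).+1%:R * h.
  move=> yx zy; have -> : z - x = (z - y) + (y - x) by rewrite addrA subrK.
  by rewrite -natr1 mulrDl mul1r (le_trans (ler_normD _ _))// lerD.
rewrite exprS -mulrA; apply: (grad_est i oS (sol_partials J oS Hu) h0 h1 HB).
  move=> y yx; apply: HS; apply: le_trans yx _.
  by rewrite -natr1 mulrDl mul1r lerDr mulr_ge0// ltW.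
move=> y yx; apply: (IH _ y erefl) => z zy; [exact: HS (sub _ _ yx zy)|exact: HM (sub _ _ yx zy)].
Qed.

(** By induction, since (1 + 1 / k)^k <= e. *)
Lemma expn_le_fact k : k%:R ^+ k <= expR (1 : R) ^+ k * k`!%:R :> R.
Proof.
elim: k => [|k IH]; first by rewrite !expr0 fact0 mulr1.
rewrite factS natrM exprS [leRHS]mulrCA; apply: ler_wpM2l => //.
have [->|k0] := eqVneq k 0%N; first by rewrite expr0 expr1 fact0 mulr1; apply: ltW; rewrite expR_gt1.
have kp : 0 < k%:R :> R by rewrite ltr0n lt0n.
have -> : k.+1%:R = (1 + k%:R^-1) * k%:R :> R by rewrite mulrDl mul1r mulVf ?gt_eqF// -natr1 addrC.
rewrite exprMn exprS -mulrA; apply: ler_pM => //; try by rewrite exprn_ge0// addr_ge0// invr_ge0.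
apply: (@le_trans _ _ (expR (k%:R^-1) ^+ k)).
  by rewrite lerXn2r ?nnegrE ?expR_ge0 ?addr_ge0 ?invr_ge0// expR_ge1Dx.
by rewrite -expRM_natl mulfV ?gt_eqF.
Qed.

(** For k derivatives the step is r / k, and the factor k^k is at most e^k k!. *)
Lemma sol_bound S (lam : R) u x0 : open S -> solves_eigen S lam u -> S x0 ->
  exists r M C : R, [/\ 0 < r, 0 < M, 0 < C, (forall y, `|y - x0| <= r -> S y) &
    forall J y, `|y - x0| <= r -> `|partials J u y| <= M * C ^+ size J * (size J)`!%:R].
Proof.
move=> oS Hu Sx0; have K0 := grad_cst_gt0 d lam.
have [r1 r10 r1H] := (openP S).1 oS x0 Sx0.
set r := Num.min 1 (r1 / 2).
have r0 : 0 < r by rewrite lt_min ltr01 divr_gt0.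
have rS y : `|y - x0| <= 2 * r -> S y.
  move=> yr; apply: r1H; apply: (le_trans yr).
  by rewrite mulrC -ler_pdivlMr// ge_min lexx orbT.
have r20 : 0 < 2 * r by rewrite mulr_gt0.
have Hu2 : Ck 2 S u by case: Hu.
have [M M0 HM] := bounded_on_cube r20 (fun y Sy => Ck_cont Hu2 Sy) rS.
exists r, M, (grad_cst d lam / r * expR 1); split => //.
- by rewrite mulr_gt0// ?expR_gt0// divr_gt0.
- by move=> y yr; apply: rS; rewrite (le_trans yr)// ler_peMl ?ler1n// ltW.
move=> J y yr; have [->|J0] := eqVneq J [::].
  rewrite /= expr0 !mulr1; apply: HM; apply: (le_trans yr); rewrite ler_peMl ?ler1n//; exact: ltW.
set k := size J; have k0 : (0 < k)%N by rewrite lt0n size_eq0.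
have kp : 0 < k%:R :> R by rewrite ltr0n.
have h0 : 0 < r / k%:R by rewrite divr_gt0.
have h1 : r / k%:R <= 1.
  rewrite ler_pdivrMr// mul1r; apply: (@le_trans _ _ 1); last by rewrite ler1n.
  by rewrite ge_min lexx.
have sub z : `|z - y| <= k%:R * (r / k%:R) -> `|z - x0| <= 2 * r.
  rewrite mulrC divfK ?gt_eqF// => zy; have -> : z - x0 = (z - y) + (y - x0) by rewrite addrA subrK.
  by rewrite mulr2n mulrDl mul1r (le_trans (ler_normD _ _))// lerD.
have H := sol_word_est (J := J) (m := k) oS Hu h0 h1 M0 erefl (fun z zy => rS z (sub z zy)) (fun z zy => HM z (sub z zy)).
apply: (le_trans H).
rewrite mulrC -mulrA; apply: ler_wpM2l; first exact: ltW.
have -> : grad_cst d lam / (r / k%:R) = grad_cst d lam / r * k%:R by rewrite invfM invrK mulrA.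
rewrite exprMn [in leRHS]exprMn -[leRHS]mulrA; apply: ler_wpM2l; last exact: expn_le_fact.
by rewrite exprn_ge0// ltW// divr_gt0.
Qed.

End Words.

(** * Cauchy estimates with weights *)

Section Weights.
Context {R : realType}.

(** The factor 1 / (k + 1)^2 makes the sequences M C^k [weight k] stable under Leibniz
    products, with a loss that does not depend on k; since (k + 1)^2 <= 4^k, it changes only the
    constant C. *)
Definition weight (k : nat) : R := k`!%:R / k.+1%:R ^+ 2.

Lemma weight_gt0 k : 0 < weight k.
Proof. by rewrite divr_gt0 ?ltr0n ?fact_gt0// exprn_gt0// ltr0n. Qed.

Lemma weight0 : weight 0 = 1.
Proof. by rewrite /weight fact0 expr1n divr1. Qed.

Lemma weight_le_fact k : weight k <= k`!%:R.
Proof. by rewrite ler_pdivrMr ?exprn_gt0 ?ltr0n// ler_peMr// exprn_ege1// ler1n. Qed.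

Lemma sq_le_exp4 k : k.+1%:R ^+ 2 <= 4 ^+ k :> R.
Proof.
elim: k => [|k IH]; first by rewrite expr1n expr0.
rewrite [leRHS]exprS; apply: le_trans (_ : 4 * k.+1%:R ^+ 2 <= _); last by rewrite ler_wpM2l.
have -> : 4 * k.+1%:R ^+ 2 = (2 * k.+1%:R) ^+ 2 :> R by rewrite exprMn; congr (_ * _); ring.
rewrite lerXn2r ?nnegrE ?mulr_ge0//.
by rewrite -natrM ler_nat; lia.
Qed.

Lemma fact_le_weight k : k`!%:R <= 4 ^+ k * weight k.
Proof.
rewrite /weight mulrA ler_pdivlMr ?exprn_gt0 ?ltr0n// mulrC.
by apply: ler_wpM2r; [exact: ler0n|exact: sq_le_exp4].
Qed.

Lemma weightS k : weight k.+1 <= k.+1%:R * weight k.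
Proof.
rewrite /weight factS natrM -mulrA; apply: ler_wpM2l => //; apply: ler_wpM2l => //.
by rewrite lef_pV2 ?posrE ?exprn_gt0 ?ltr0n// lerXn2r ?nnegrE// ler_nat.
Qed.

Lemma sum_inv_sq n : \sum_(i < n) (i.+1%:R ^+ 2)^-1 <= 2 :> R.
Proof.
(* The stronger bound 2 - 1 / (n + 1) telescopes. *)
suff H : \sum_(i < n.+1) (i.+1%:R ^+ 2)^-1 <= 2 - n.+1%:R^-1 :> R.
  apply: (@le_trans _ _ (\sum_(i < n.+1) (i.+1%:R ^+ 2)^-1 : R)).
    by rewrite big_ord_recr /= lerDl invr_ge0 exprn_ge0.
  by apply: (le_trans H); rewrite gerBl invr_ge0.
elim: n => [|n IH].
  by rewrite big_ord_recr big_ord0 /= expr1n invr1; lra.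
rewrite big_ord_recr /=; apply: (le_trans (lerD IH (lexx _))).
have a0 : 0 < n.+1%:R :> R by rewrite ltr0n.
have -> : n.+2%:R = n.+1%:R + 1 :> R by rewrite -natr1.
move: (n.+1%:R) a0 => a a0.
have a1 : 0 < a + 1 by lra.
rewrite -addrA lerD2l.
have -> : - a^-1 + (a + 1) ^- 2 = - (a + 1)^-1 - (a * (a + 1) ^+ 2)^-1.
  by field; apply/andP; split; apply: lt0r_neq0.
by rewrite gerBl invr_ge0 mulr_ge0 ?exprn_ge0 ?ltW.
Qed.

Lemma inv_conv (a b : R) : 0 < a -> 0 < b ->
  (a ^+ 2)^-1 * (b ^+ 2)^-1 <= 2 / (a + b) ^+ 2 * ((a ^+ 2)^-1 + (b ^+ 2)^-1).
Proof.
move=> a0 b0.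
have E : (a ^+ 2)^-1 * (b ^+ 2)^-1 = (a + b) ^- 2 * (a^-1 + b^-1) ^+ 2.
  by field; rewrite !gt_eqF ?addr_gt0.
rewrite E [2 / _]mulrC -mulrA; apply: ler_wpM2l.
  by rewrite invr_ge0 exprn_ge0// addr_ge0// ltW.
rewrite -!exprVn; move: (a^-1) (b^-1) => x y.
rewrite -subr_ge0; have -> : 2 * (x ^+ 2 + y ^+ 2) - (x + y) ^+ 2 = (x - y) ^+ 2 by ring.
exact: sqr_ge0.
Qed.

(** By [inv_conv] the convolution is at most 2 / (k + 2)^2 times the sum of both series, and
    each of them is at most 2. *)
Lemma conv_inv_sq k : \sum_(i < k.+1) (i.+1%:R ^+ 2)^-1 * ((k - i).+1%:R ^+ 2)^-1
  <= 8 / k.+1%:R ^+ 2 :> R.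
Proof.
apply: (@le_trans _ _ (\sum_(i < k.+1) 2 / k.+2%:R ^+ 2 * ((i.+1%:R ^+ 2)^-1 + ((k - i).+1%:R ^+ 2)^-1) : R)).
  apply: ler_sum => i _.
  have -> : k.+2%:R = i.+1%:R + (k - i).+1%:R :> R.
    by rewrite -natrD; congr (_%:R); have := ltn_ord i; lia.
  by apply: inv_conv; rewrite ltr0n.
rewrite -mulr_sumr big_split /=.
have -> : \sum_(i < k.+1) ((k - i).+1%:R ^+ 2)^-1 = \sum_(i < k.+1) (i.+1%:R ^+ 2)^-1 :> R.
  rewrite [RHS](reindex_inj rev_ord_inj) /=; apply: eq_bigr => i _.
  by rewrite subSS.
apply: (@le_trans _ _ (2 / k.+2%:R ^+ 2 * (2 + 2) : R)).
  by apply: ler_wpM2l; [rewrite divr_ge0// exprn_ge0|apply: lerD; exact: sum_inv_sq].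
have -> : 2 / k.+2%:R ^+ 2 * (2 + 2) = 8 / k.+2%:R ^+ 2 :> R by ring.
apply: ler_wpM2l => //.
by rewrite lef_pV2 ?posrE ?exprn_gt0 ?ltr0n// lerXn2r ?nnegrE// ler_nat.
Qed.

Lemma bin_weight k i : (i <= k)%N -> 'C(k, i)%:R * (weight i * weight (k - i)) =
  k`!%:R * ((i.+1%:R ^+ 2)^-1 * ((k - i).+1%:R ^+ 2)^-1) :> R.
Proof.
move=> ik; rewrite -(bin_fact ik) /weight !natrM; ring.
Qed.

(** The Leibniz sum without the term that has no derivative on the first factor. *)
Definition leibniz_tail (F G : nat -> R) k := \sum_(i < k) 'C(k, i.+1)%:R * (F i.+1 * G (k - i.+1)%N).

Definition leibniz (F G : nat -> R) k := \sum_(i < k.+1) 'C(k, i)%:R * (F i * G (k - i)%N).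

Lemma leibnizE F G k : leibniz F G k = F 0%N * G k + leibniz_tail F G k.
Proof. by rewrite /leibniz big_ord_recl /= bin0 mul1r subn0. Qed.

(** Pascal rule; on derivatives it says that the last one falls on the first or on the
    second factor. *)
Lemma leibniz_tailS F G k : leibniz_tail F G k.+1 = leibniz (fun i => F i.+1) G k + leibniz_tail F (fun i => G i.+1) k.
Proof.
rewrite /leibniz_tail /leibniz.
rewrite (eq_bigr (fun i : 'I_k.+1 => 'C(k, i)%:R * (F i.+1 * G (k - i)%N)
   + 'C(k, i.+1)%:R * (F i.+1 * G (k - i)%N))); last first.
  by move=> i _; rewrite subSS binS natrD addrC mulrDl.
rewrite big_split /=; congr (_ + _).
rewrite big_ord_recr /= bin_small// mul0r addr0; apply: eq_bigr => i _.
by rewrite subnSK.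
Qed.

Definition wgeo (M C : R) k := M * C ^+ k * weight k.

Lemma wgeo_ge0 M C k : 0 <= M -> 0 <= C -> 0 <= wgeo M C k.
Proof. by move=> M0 C0; rewrite /wgeo !mulr_ge0 ?exprn_ge0// ltW ?weight_gt0. Qed.

Lemma leibniz_wgeo M N C k : 0 <= M -> 0 <= N -> 0 <= C ->
  leibniz (wgeo M C) (wgeo N C) k <= wgeo (8 * M * N) C k.
Proof.
move=> M0 N0 C0; rewrite /leibniz.
rewrite (eq_bigr (fun i : 'I_k.+1 => M * N * C ^+ k * k`!%:R * ((i.+1%:R ^+ 2)^-1 * ((k - i).+1%:R ^+ 2)^-1))); last first.
  move=> i _; have ik : (i <= k)%N by rewrite -ltnS.
  have E2 : C ^+ k = C ^+ i * C ^+ (k - i) by rewrite -exprD subnKC.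
  have := bin_weight ik; rewrite /wgeo E2.
  move: (weight i) (weight (k - i)) (C ^+ i) (C ^+ (k - i)) => w1 w2 c1 c2 E.
  rewrite -(mulrA (M * N * (c1 * c2))) -E; ring.
rewrite -mulr_sumr.
apply: (@le_trans _ _ (M * N * C ^+ k * k`!%:R * (8 / k.+1%:R ^+ 2))).
  by apply: ler_wpM2l; [rewrite !mulr_ge0// exprn_ge0|exact: conv_inv_sq].
by rewrite le_eqVlt /wgeo /weight; apply/orP; left; apply/eqP; ring.
Qed.

(** Each term has at least one derivative on the first factor, so replacing C0 by C there
    gains a factor C0 / C. This is what makes the recursion for 1 / f close up. *)
Lemma leibniz_tail_wgeo M N C0 C k : 0 <= M -> 0 <= N -> 0 < C0 -> C0 <= C ->
  leibniz_tail (wgeo M C0) (wgeo N C) k <= wgeo (8 * M * N * (C0 / C)) C k.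
Proof.
move=> M0 N0 C00 C0C; have Cp : 0 < C by exact: lt_le_trans C00 C0C.
have CC : 0 <= C0 / C by rewrite divr_ge0 ?ltW.
apply: (@le_trans _ _ ((C0 / C) * leibniz (wgeo M C) (wgeo N C) k)); last first.
  apply: le_trans (ler_wpM2l CC (leibniz_wgeo k M0 N0 (ltW Cp))) _.
  by rewrite le_eqVlt /wgeo; apply/orP; left; apply/eqP; ring.
rewrite leibnizE mulrDr; apply: ler_wpDl.
  by apply: mulr_ge0 => //; apply: mulr_ge0; apply: wgeo_ge0 => //; exact: ltW.
rewrite /leibniz_tail mulr_sumr; apply: ler_sum => i _.
rewrite [leRHS]mulrCA; apply: ler_wpM2l => //; rewrite [leRHS]mulrA; apply: ler_wpM2r.
  by apply: wgeo_ge0 => //; exact: ltW.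
rewrite /wgeo [leRHS]mulrA; apply: ler_wpM2r; first exact/ltW/weight_gt0.
rewrite [leRHS]mulrCA; apply: ler_wpM2l => //.
rewrite !exprS mulrA divfK ?gt_eqF//; apply: ler_wpM2l; first exact: ltW.
by rewrite lerXn2r// nnegrE ltW.
Qed.

Lemma wgeo_le M C M' C' k : 0 <= M -> 0 <= C -> M <= M' -> C <= C' -> wgeo M C k <= wgeo M' C' k.
Proof.
move=> M0 C0 MM CC; rewrite /wgeo; apply: ler_wpM2r; first exact/ltW/weight_gt0.
by rewrite ler_pM ?exprn_ge0// lerXn2r// nnegrE// (le_trans C0).
Qed.

(** By the inequality of Bernoulli, k + 1 <= n (1 + 1 / n)^(k + 1): one derivative costs a
    factor n if the constant C grows by the factor 1 + 1 / n. *)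
Lemma wgeo_deriv M C k n : 0 <= M -> 0 <= C -> (0 < n)%N ->
  wgeo M C k.+1 <= wgeo (n%:R * (C * (1 + n%:R^-1)) * M) (C * (1 + n%:R^-1)) k.
Proof.
move=> M0 C0 n0; have np : 0 < n%:R :> R by rewrite ltr0n.
set q := 1 + n%:R^-1; have q0 : 0 <= q by rewrite addr_ge0// invr_ge0.
rewrite /wgeo.
apply: (@le_trans _ _ (M * C ^+ k.+1 * (k.+1%:R * weight k))).
  by apply: ler_wpM2l; [rewrite mulr_ge0// exprn_ge0|exact: weightS].
rewrite [leLHS]mulrA; apply: ler_wpM2r; first exact/ltW/weight_gt0.
have -> : n%:R * (C * q) * M * (C * q) ^+ k = M * C ^+ k.+1 * (n%:R * q ^+ k.+1).
  by rewrite exprMn !exprS; ring.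
apply: ler_wpM2l; first by rewrite mulr_ge0// exprn_ge0.
rewrite -ler_pdivrMl// mulrC.
have B (m : nat) : 1 + m%:R / n%:R <= q ^+ m.
  elim: m => [|m IH]; first by rewrite mul0r addr0 expr0.
  rewrite exprS; apply: (@le_trans _ _ (q * (1 + m%:R / n%:R))); last exact: ler_wpM2l.
  rewrite /q -natr1 -subr_ge0.
  have -> : (1 + n%:R^-1) * (1 + m%:R / n%:R) - (1 + (m%:R + 1) / n%:R) = m%:R * (n%:R^-1 * n%:R^-1) :> R by ring.
  by rewrite mulr_ge0// mulr_ge0// invr_ge0.
by apply: le_trans (B k.+1); rewrite lerDr.
Qed.

Lemma pow_compound n : (0 < n)%N -> (1 + n%:R^-1) ^+ n <= expR 1 :> R.
Proof.
move=> n0; apply: (@le_trans _ _ (expR (n%:R^-1) ^+ n)).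
  by rewrite lerXn2r ?nnegrE ?expR_ge0 ?addr_ge0 ?invr_ge0// expR_ge1Dx.
by rewrite -expRM_natl mulfV// pnatr_eq0 -lt0n.
Qed.

End Weights.

(** * Products, inverses and vector fields under Cauchy estimates *)

Section Bounds.
Context {R : realType} {d : nat}.
Implicit Types (f g u v : 'rV[R]_d -> R) (x y z : 'rV[R]_d) (S : set 'rV[R]_d) (J I : seq 'I_d).

Lemma partials_eq_open S f g J x : open S -> smooth S f -> (forall y, S y -> f y = g y) -> S x ->
  partials J g x = partials J f x.
Proof.
move=> oS Hf fg; elim: J x => [|i J IH] x Sx /=; first exact/esym/fg.
apply: (partial_eq_open oS _ Sx); first by move=> y Sy; exact/esym/IH.
exact: Ck_derivable (smooth_partials J Hf 1%N) Sx.
Qed.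

Lemma smooth_eq_open S f g : open S -> (forall y, S y -> f y = g y) -> smooth S f -> smooth S g.
Proof. by move=> oS fg Hf k; exact: Ck_eq oS fg (Hf k). Qed.

Lemma smooth_sub S S' f : S' `<=` S -> smooth S f -> smooth S' f.
Proof. by move=> SS H k; exact: Ck_sub SS (H k). Qed.

Lemma smooth_lin S f g (a b : R) : open S -> smooth S f -> smooth S g ->
  smooth S (fun y => a * f y + b * g y).
Proof. by move=> oS Hf Hg k; exact: Ck_lin. Qed.

Lemma smooth_mul S f g : open S -> smooth S f -> smooth S g -> smooth S (fun y => f y * g y).
Proof. by move=> oS Hf Hg k; exact: Ck_mul. Qed.

Lemma smooth_inv S f : open S -> (forall x, S x -> f x != 0) -> smooth S f -> smooth S (fun y => (f y)^-1).
Proof. by move=> oS f0 Hf k; exact: Ck_inv. Qed.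

Lemma smooth_cst S (c : R) : smooth S (fun=> c).
Proof. by move=> k; exact: Ck_cst. Qed.

Lemma partials_rcons J i f : partials (rcons J i) f = partials J (partial i f).
Proof. by rewrite /partials foldr_rcons. Qed.

Lemma partials_lin S f g (a b : R) J x : open S -> smooth S f -> smooth S g -> S x ->
  partials J (fun y => a * f y + b * g y) x = a * partials J f x + b * partials J g x.
Proof.
move=> oS Hf Hg; elim: J x => [//|i J IH] x Sx /=.
have Df := smooth_partials J Hf; have Dg := smooth_partials J Hg.
rewrite -(partial_lin a b i (Df 1%N) (Dg 1%N) Sx).
apply: (partial_eq_open oS _ Sx); first by move=> y Sy; exact/esym/IH.
exact: Ck_derivable (Ck_lin a b oS (Df 1%N) (Dg 1%N)) Sx.
Qed.

Lemma partial_cst i (c : R) : partial i (fun=> c) = (fun=> 0) :> ('rV[R]_d -> R).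
Proof. by apply/funext => x; exact: derive_cst. Qed.

Lemma partials_cst J (c : R) : J != [::] -> partials J (fun=> c) = (fun=> 0).
Proof.
elim/last_ind: J => [//|J i _] _; rewrite partials_rcons partial_cst.
by elim: J => //= j J ->; rewrite partial_cst.
Qed.

Lemma partials_mul_rcons S f g J i x : open S -> smooth S f -> smooth S g -> S x ->
  partials (rcons J i) (fun y => f y * g y) x =
  partials J (fun y => partial i f y * g y) x + partials J (fun y => f y * partial i g y) x.
Proof.
move=> oS Hf Hg Sx; have H1 := smooth_mul oS (smooth_partial i Hf) Hg.
have H2 := smooth_mul oS Hf (smooth_partial i Hg).
rewrite partials_rcons -[partials J (fun y => partial i f y * g y) x]mul1r -[partials J (fun y => f y * _) x]mul1r.
rewrite -(partials_lin 1 1 J oS H1 H2 Sx).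
apply: (partials_eq_open J oS (smooth_lin 1 1 oS H1 H2) _ Sx) => y Sy.
have D := is_deriveM (Ck_is_derive i (Hf 1%N) Sy) (Ck_is_derive i (Hg 1%N) Sy).
have [_ E] := D; rewrite /partial; apply: esym; apply: etrans E _.
by rewrite !mul1r addrC; congr (_ + _); rewrite [LHS]mulrC.
Qed.

(** Induction on the word through its last letter, that is through the derivative taken
    first. *)
Lemma leibniz_bound S k J f g (F G : nat -> R) : open S -> size J = k -> smooth S f -> smooth S g ->
  (forall I y, S y -> (size I <= k)%N -> `|partials I f y| <= F (size I)) ->
  (forall I y, S y -> (size I < k)%N -> `|partials I g y| <= G (size I)) ->
  forall x, S x -> `|partials J (fun y => f y * g y) x - f x * partials J g x| <= leibniz_tail F G k.
Proof.
move=> oS; elim: k J f g F G => [|k IH] J f g F G.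
  by move=> /size0nil -> _ _ _ _ x _; rewrite /= subrr normr0 /leibniz_tail big_ord0.
elim/last_ind: J => [//|J i _]; rewrite size_rcons => -[sJ] Hf Hg HF HG x Sx.
rewrite (partials_mul_rcons J i oS Hf Hg Sx) partials_rcons leibniz_tailS leibnizE.
have A1 := IH J (partial i f) g (fun i => F i.+1) G sJ (smooth_partial i Hf) Hg _ _ x Sx.
have A2 := IH J f (partial i g) F (fun i => G i.+1) sJ Hf (smooth_partial i Hg) _ _ x Sx.
have B1 : `|partial i f x * partials J g x| <= F 1%N * G k.
  rewrite normrM; apply: ler_pM => //; first exact: (HF [:: i] x Sx).
  by rewrite -sJ; apply: HG => //; rewrite sJ.
set p1 := partials J _ x; set p2 := partials J _ x; set p3 := f x * _.
have -> : p1 + p2 - p3 = partial i f x * partials J g x + (p1 - partial i f x * partials J g x) + (p2 - p3).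
  by move: (partial i f x * _) => q; ring.
apply: (le_trans (ler_normD _ _)); apply: lerD.
  apply: (le_trans (ler_normD _ _)); apply: lerD => //; apply: A1.
    by move=> I y Sy sI; have := HF (rcons I i) y Sy; rewrite size_rcons partials_rcons; exact.
  by move=> I y Sy sI; apply: HG => //; exact: leqW.
apply: A2; first by move=> I y Sy sI; apply: HF => //; exact: leqW.
by move=> I y Sy sI; have := HG (rcons I i) y Sy; rewrite size_rcons partials_rcons; exact.
Qed.

(** Cauchy estimates on S. *)
Definition growth S f (M C : R) := forall J x, S x -> `|partials J f x| <= wgeo M C (size J).

Lemma growth_le S f M C M' C' : 0 <= M -> 0 <= C -> M <= M' -> C <= C' -> growth S f M C -> growth S f M' C'.
Proof. by move=> M0 C0 MM CC H J x Sx; apply: le_trans (H J x Sx) _; exact: wgeo_le. Qed.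

Lemma growth_mul S f g M N C : open S -> smooth S f -> smooth S g -> 0 <= M -> 0 <= N -> 0 <= C ->
  growth S f M C -> growth S g N C -> growth S (fun y => f y * g y) (8 * M * N) C.
Proof.
move=> oS Hf Hg M0 N0 C0 Bf Bg J x Sx.
have H := leibniz_bound (J := J) oS erefl Hf Hg (fun I y Sy _ => Bf I y Sy) (fun I y Sy _ => Bg I y Sy) Sx.
apply: le_trans (leibniz_wgeo (size J) M0 N0 C0); rewrite leibnizE.
rewrite -[partials J _ x](subrK (f x * partials J g x)) addrC.
apply: (le_trans (ler_normD _ _)); apply: lerD => //.
by rewrite normrM; apply: ler_pM => //; [exact: (Bf [::])|exact: Bg].
Qed.

Lemma growth_lin S f g a b M N C : open S -> smooth S f -> smooth S g ->
  growth S f M C -> growth S g N C -> growth S (fun y => a * f y + b * g y) (`|a| * M + `|b| * N) C.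
Proof.
move=> oS Hf Hg Bf Bg J x Sx; rewrite (partials_lin a b J oS Hf Hg Sx).
apply: (le_trans (ler_normD _ _)); rewrite !normrM /wgeo !mulrDl -!mulrA; apply: lerD.
  by apply: ler_wpM2l => //; have := Bf J x Sx; rewrite /wgeo -!mulrA.
by apply: ler_wpM2l => //; have := Bg J x Sx; rewrite /wgeo -!mulrA.
Qed.

Lemma growth_partial S f M C i n : 0 <= M -> 0 <= C -> (0 < n)%N -> growth S f M C ->
  growth S (partial i f) (n%:R * (C * (1 + n%:R^-1)) * M) (C * (1 + n%:R^-1)).
Proof.
move=> M0 C0 n0 H J x Sx; have := H (rcons J i) x Sx; rewrite partials_rcons size_rcons => K.
exact: le_trans K (wgeo_deriv _ M0 C0 n0).
Qed.

(** The product of f and 1 / f has no derivatives, so the derivatives of 1 / f are bounded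
    recursively by the Leibniz sum without its first term; for the larger constant the gain in
    [leibniz_tail_wgeo] compensates 8 M / c. *)
Lemma growth_inv S f M C c : open S -> smooth S f -> 0 < M -> 0 < C -> 0 < c ->
  (forall x, S x -> c <= `|f x|) -> growth S f M C ->
  growth S (fun y => (f y)^-1) c^-1 (C * (1 + 8 * M / c)).
Proof.
move=> oS Hf M0 C0 c0 fc Bf.
have f0 x : S x -> f x != 0 by move=> /fc; rewrite -normr_gt0; exact: lt_le_trans.
have Hi := smooth_inv oS f0 Hf.
set q := 1 + 8 * M / c.
have q1 : 1 <= q by rewrite lerDl divr_ge0 ?ltW// mulr_gt0.
have q0 : 0 < q by exact: lt_le_trans q1.
set C' := C * q; have C'0 : 0 < C' by rewrite mulr_gt0.
have CC' : C <= C' by rewrite ler_peMr// ltW.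
suff H k J : (size J <= k)%N -> forall x, S x -> `|partials J (fun y => (f y)^-1) x| <= wgeo c^-1 C' (size J).
  by move=> J x; exact: H (leqnn _) x.
elim: k J => [|k IH] J.
  rewrite leqn0 => /nilP -> x Sx; rewrite /= /wgeo expr0 weight0 !mulr1 normfV lef_pV2 ?posrE//.
    exact: fc.
  by rewrite normr_gt0; exact: f0.
rewrite leq_eqVlt => /orP[/eqP sJ x Sx|]; last by rewrite ltnS; exact: IH.
have J0 : J != [::] by case: J sJ.
have H := leibniz_bound (J := J) (G := wgeo c^-1 C') oS sJ Hf Hi (fun I y Sy _ => Bf I y Sy)
  (fun I y Sy sI => IH I sI y Sy) Sx.
have E : partials J (fun y => f y * (f y)^-1) x = 0.
  rewrite -[RHS](_ : partials J (fun=> 1) x = 0); last by rewrite partials_cst.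
  apply: (partials_eq_open J oS (@smooth_cst S 1) _ Sx) => y Sy.
  by rewrite mulfV// f0.
rewrite E sub0r normrN normrM in H.
have H2 := le_trans H (leibniz_tail_wgeo (k.+1) (ltW M0) (ltW (_ : 0 < c^-1)) C0 CC').
have ci : 0 < c^-1 by rewrite invr_gt0.
have {H2} H2 := H2 ci.
have H3 : c * `|partials J (fun y => (f y)^-1) x| <= wgeo (8 * M * c^-1 * (C / C')) C' k.+1.
  by apply: le_trans H2; apply: ler_wpM2r => //; exact: fc.
rewrite sJ -(ler_pM2l c0); apply: (le_trans H3).
rewrite /wgeo !mulrA; do 2 (apply: ler_wpM2r; first by rewrite ?exprn_ge0 ?(ltW (weight_gt0 _))// ltW).
rewrite mulfV ?gt_eqF//.
have -> : 8 * M / c * C / C' = (8 * M / c) / q.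
  by rewrite /C' invfM; rewrite !mulrA; congr (_ / _); rewrite mulfK// gt_eqF.
apply: ler_wpM2r; first by rewrite exprn_ge0// ltW.
by rewrite ler_pdivrMr// mul1r lerDr.
Qed.

End Bounds.

Section VectorFields.
Context {R : realType} {d m : nat}.
Variables (S : set 'rV[R]_d) (oS : open S).
Variables (a b : 'I_m -> 'rV[R]_d -> R) (sg : 'I_m -> 'I_d) (j : 'I_d).

(** Vector fields of this shape express the partial derivatives in new coordinates obtained
    by replacing the j-th one. *)
Definition vfield (i : 'I_m) (h : 'rV[R]_d -> R) : 'rV[R]_d -> R :=
  fun x => a i x * partial (sg i) h x + b i x * partial j h x.

Definition vfield_word (J : seq 'I_m) h := foldr vfield h J.

Hypothesis Sa : forall i, smooth S (a i).
Hypothesis Sb : forall i, smooth S (b i).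

Lemma vfieldE i h : vfield i h = (fun x => 1 * (a i x * partial (sg i) h x) + 1 * (b i x * partial j h x)).
Proof. by apply/funext => x; rewrite !mul1r. Qed.

Lemma smooth_vfield i h : smooth S h -> smooth S (vfield i h).
Proof.
by move=> Hh; rewrite vfieldE; apply: smooth_lin => //; apply: smooth_mul => //; exact: smooth_partial.
Qed.

Lemma smooth_vfield_word J h : smooth S h -> smooth S (vfield_word J h).
Proof. by move=> Hh; elim: J => //= i J; exact: smooth_vfield. Qed.

Variables (A C0 : R).
Hypothesis A0 : 0 <= A.
Hypothesis C00 : 0 <= C0.
Hypothesis Ba : forall i, growth S (a i) A C0.
Hypothesis Bb : forall i, growth S (b i) A C0.

Lemma growth_vfield i h M C n : smooth S h -> 0 <= M -> C0 <= C -> (0 < n)%N -> growth S h M C ->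
  growth S (vfield i h) (16 * A * (C * (1 + n%:R^-1)) * n%:R * M) (C * (1 + n%:R^-1)).
Proof.
move=> Hh M0 CC n0 Bh; have Cp : 0 <= C by exact: le_trans CC.
set C' := C * (1 + n%:R^-1).
have C'C : C <= C' by rewrite ler_peMr// lerDl invr_ge0.
have C'0 : 0 <= C' by exact: le_trans C'C.
have C'C0 : C0 <= C' by exact: le_trans C'C.
have M'0 : 0 <= n%:R * C' * M by rewrite !mulr_ge0.
have B k : growth S (partial k h) (n%:R * C' * M) C' by exact: growth_partial.
have B1 := growth_mul oS (Sa i) (smooth_partial (sg i) Hh) A0 M'0 C'0 (growth_le A0 C00 (lexx _) C'C0 (Ba i)) (B (sg i)).
have B2 := growth_mul oS (Sb i) (smooth_partial j Hh) A0 M'0 C'0 (growth_le A0 C00 (lexx _) C'C0 (Bb i)) (B j).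
have := growth_lin 1 1 oS (smooth_mul oS (Sa i) (smooth_partial (sg i) Hh))
   (smooth_mul oS (Sb i) (smooth_partial j Hh)) B1 B2.
rewrite -vfieldE normr1; congr (growth _ _ _ _); ring.
Qed.

(** Losing a factor 1 + 1 / n in the constant at each of the n = size J steps costs only a
    factor e altogether, and the remaining n^n is at most e^n n!. *)
Lemma vfield_word_bound h M : smooth S h -> 0 <= M -> growth S h M C0 -> forall J x, S x ->
  `|vfield_word J h x| <= M * (16 * A * (C0 * expR 1) * expR 1) ^+ size J * (size J)`!%:R.
Proof.
move=> Hh M0 Bh J x Sx.
have [->|J0] := eqVneq J [::].
  by have := Bh [::] x Sx; rewrite /= /wgeo !expr0 weight0.
set n := size J; have n0 : (0 < n)%N by rewrite lt0n size_eq0.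
have np : 0 < n%:R :> R by rewrite ltr0n.
set q := 1 + n%:R^-1 : R; have q1 : 1 <= q by rewrite lerDl invr_ge0.
have q0 : 0 <= q by exact: le_trans q1.
have qe k : (k <= n)%N -> C0 * q ^+ k <= C0 * expR 1.
  move=> kn; apply: ler_wpM2l => //; apply: le_trans (pow_compound n0).
  by rewrite ler_weXn2l.
have e0 : 0 <= expR 1 :> R by exact: expR_ge0.
set K := 16 * A * (C0 * expR 1).
have K0 : 0 <= K by rewrite !mulr_ge0.
(* The constant grows from C0 to at most C0 e, while each letter contributes a factor K n.
   *)
have step I : (size I <= n)%N -> growth S (vfield_word I h) (M * (K * n%:R) ^+ size I) (C0 * q ^+ size I).
  elim: I => [|i I IH] /= sI; first by rewrite !expr0 !mulr1.
  have MI : 0 <= M * (K * n%:R) ^+ size I by rewrite mulr_ge0// exprn_ge0// mulr_ge0.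
  have CI : C0 <= C0 * q ^+ size I by rewrite ler_peMr// exprn_ege1.
  have H := @growth_vfield i _ _ _ n (smooth_vfield_word I Hh) MI CI n0 (IH (ltnW sI)).
  rewrite -/q -[C0 * q ^+ _ * q]mulrA -exprSr in H.
  have G0 : 0 <= 16 * A * (C0 * q ^+ (size I).+1) * n%:R * (M * (K * n%:R) ^+ size I).
    by apply: mulr_ge0 => //; rewrite !mulr_ge0// exprn_ge0.
  apply: (growth_le G0 _ _ (lexx _) H); first by rewrite mulr_ge0// exprn_ge0.
  rewrite [leRHS](_ : _ = K * n%:R * (M * (K * n%:R) ^+ size I)); last by rewrite exprS; ring.
  apply: ler_wpM2r => //; apply: ler_wpM2r => //; rewrite /K; apply: ler_wpM2l; first by rewrite mulr_ge0.
  exact: qe.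
have := step J (leqnn _) [::] x Sx; rewrite /= /wgeo expr0 weight0 !mulr1 => H.
apply: (le_trans H); rewrite -mulrA; apply: ler_wpM2l => //.
rewrite [leLHS]exprMn -/n [in leRHS]exprMn -mulrA; apply: ler_wpM2l; first by rewrite exprn_ge0.
exact: expn_le_fact.
Qed.

End VectorFields.

(** * Taylor series *)

Section Taylor1.
Context {R : realType}.

Lemma ge0_of_deriv (F dF : R -> R) (t : R) : 0 <= t ->
  (forall s : R, 0 <= s <= t -> is_derive s (1:R) F (dF s)) ->
  (forall s : R, 0 <= s <= t -> 0 <= dF s) -> F 0 = 0 -> 0 <= F t.
Proof.
move=> t0 HD Hp F0.
have C : {within `[0, t], continuous F}.
  by apply: derivable_within_continuous => s; rewrite in_itv => /HD[].
have [c cI E] := @MVT_segment R F dF 0 t t0 (fun s sI => HD s (subset_itv_oo_cc sI)) C.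
rewrite F0 !subr0 in E; rewrite E mulr_ge0//; apply: Hp.
by move: cI; rewrite in_itv.
Qed.

Lemma is_derive_pow (k : nat) (s : R) :
  is_derive s (1:R) (fun t : R => t ^+ k.+1 / k.+1`!%:R) (s ^+ k / k`!%:R).
Proof.
have D : is_derive s (1:R) (fun t : R => t ^+ k.+1) (k.+1%:R * s ^+ k).
  by split; [exact: exprn_derivable|rewrite exp_derive [_ *: 1]mulr1].
have -> : (fun t : R => t ^+ k.+1 / k.+1`!%:R) = (fun t => k.+1`!%:R^-1 * t ^+ k.+1).
  by apply/funext => t; rewrite mulrC.
have H := is_deriveZ (k.+1`!%:R^-1 : R) D.
apply: is_derive_eq H _.
rewrite [LHS]mulrA [RHS]mulrC factS natrM invfM.
have k0 : k.+1%:R != 0 :> R by rewrite pnatr_eq0.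
have f0 : k`!%:R != 0 :> R by rewrite pnatr_eq0 -lt0n fact_gt0.
by rewrite [X in X * _]mulrAC mulVf// mul1r.
Qed.

(** Induction on n: both signs of the remainder have a derivative that the induction
    hypothesis bounds. *)
Lemma taylor1 (g : nat -> R -> R) (B : R) n :
  (forall k (s : R), 0 <= s <= 1 -> is_derive s (1:R) (g k) (g k.+1 s)) ->
  (forall s : R, 0 <= s <= 1 -> `|g n s| <= B) ->
  forall t : R, 0 <= t <= 1 ->
    `|g 0%N t - \sum_(k < n) g k 0 * (t ^+ k / k`!%:R)| <= B * (t ^+ n / n`!%:R).
Proof.
elim: n g => [|n IH] g Hg HB t t01.
  by rewrite big_ord0 subr0 expr0 fact0 divr1 mulr1; exact: HB.
have {}IH := IH (fun k => g k.+1) (fun k => Hg k.+1) HB.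
(* The Taylor polynomial and its derivative, the Taylor polynomial of one order less for g
   1. *)
pose P (s : R) := \sum_(k < n.+1) g k 0 * (s ^+ k / k`!%:R).
pose dP (s : R) := \sum_(k < n) g k.+1 0 * (s ^+ k / k`!%:R).
have P_der (s : R) : is_derive s (1:R) P (dP s).
  have -> : P = (fun s => g 0%N 0 + \sum_(k < n) g k.+1 0 * (s ^+ k.+1 / k.+1`!%:R)).
    by apply/funext => u; rewrite /P big_ord_recl /= expr0 fact0 divr1 mulr1.
  have H : is_derive s (1:R) (fun s => \sum_(k < n) g k.+1 0 * (s ^+ k.+1 / k.+1`!%:R)) (dP s).
    by apply: is_derive_sum => k; exact: (is_deriveZ (g k.+1 0) (is_derive_pow k s)).
  have := is_deriveD (is_derive_cst (g 0%N 0) s 1) H; rewrite add0r; exact.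
have P0 : P 0 = g 0%N 0.
  rewrite /P big_ord_recl /= expr0 fact0 divr1 mulr1 big1 ?addr0// => i _.
  by rewrite expr0n /= mul0r mulr0.
have /andP[t0 t1] := t01.
have in01 (s : R) : 0 <= s <= t -> 0 <= s <= 1.
  by move=> /andP[-> st]; exact: le_trans st t1.
have der (e s : R) : 0 <= s <= t -> is_derive s (1:R)
    (fun s => B * (s ^+ n.+1 / n.+1`!%:R) + e * (g 0%N s - P s))
    (B * (s ^+ n / n`!%:R) + e * (g 1%N s - dP s)).
  move=> /in01 s01.
  exact: (is_deriveD (is_deriveZ B (is_derive_pow n s)) (is_deriveZ e (is_deriveB (Hg 0%N s s01) (P_der s)))).
have nonneg (e : R) : `|e| = 1 -> 0 <= B * (t ^+ n.+1 / n.+1`!%:R) + e * (g 0%N t - P t).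
  move=> e1; apply: (ge0_of_deriv t0 (der e)).
    move=> s st; have := IH s (in01 s st); rewrite -/(dP s) => H.
    rewrite -lerBlDl sub0r lerNl; apply: le_trans H.
    by rewrite -[leRHS]mul1r -e1 -normrM -normrN ler_norm.
  by rewrite P0 subrr mulr0 addr0 expr0n /= mul0r mulr0.
rewrite ler_norml; apply/andP; split.
  by have := nonneg 1 (normr1 _); rewrite mul1r -lerBlDl sub0r.
by have := nonneg (-1) (normrN1 _); rewrite mulN1r subr_ge0.
Qed.

End Taylor1.

Section TaylorN.
Context {R : realType} {d : nat}.
Implicit Types (f g u v : 'rV[R]_d -> R) (x y z h : 'rV[R]_d) (S : set 'rV[R]_d) (J I : seq 'I_d).

Definition word_mon h J : R := \prod_(i <- J) h 0 i.

(** The k-th derivative of f at x in the direction h, expanded into words. *)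
Definition taylor_form k h f x : R := \sum_(J : k.-tuple 'I_d) word_mon h J * partials J f x.

Lemma word_mon_bound h J : `|word_mon h J| <= `|h| ^+ size J.
Proof.
elim: J => [|i J IH]; first by rewrite /word_mon big_nil normr1.
rewrite /word_mon big_cons normrM exprS; apply: ler_pM => //; exact: coord_le_norm.
Qed.

Lemma sum_tuple_cons k (F : seq 'I_d -> R) :
  \sum_(J : k.+1.-tuple 'I_d) F J = \sum_(J : k.-tuple 'I_d) \sum_(i < d) F (i :: J).
Proof.
rewrite pair_big /=.
rewrite (reindex (fun p : k.-tuple 'I_d * 'I_d => [tuple of p.2 :: p.1])) //=.
exists (fun t : k.+1.-tuple 'I_d => ([tuple of behead t], thead t)) => [[J i] _|t _] /=.
  by congr (_, _); apply: val_inj.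
by rewrite [RHS]tuple_eta; apply: val_inj.
Qed.

Lemma is_derive_on_line S f x h (t : R) : open S -> Ck 1 S f -> S (x + t *: h) ->
  is_derive t (1:R) (fun s => f (x + s *: h)) (\sum_i h 0 i * partial i f (x + t *: h)).
Proof.
move=> oS Hf Sx.
have H := chain_curve (gam := fun s : R => x + (t + s) *: h) (v := fun i => h 0 i) oS Hf Sx.
have {H} H : is_derive (0:R) (1:R) (fun s : R => f (x + (t + s) *: h)) (\sum_i h 0 i * partial i f (x + t *: h)).
  apply: H; first by rewrite addr0.
  move=> i; have -> : (fun s : R => (x + (t + s) *: h) 0 i) = (fun s => (x + t *: h) 0 i + h 0 i * s).
    by apply/funext => s; rewrite !mxE; ring.
  have := is_deriveD (is_derive_cst ((x + t *: h) 0 i) (0:R) (1:R)) (is_deriveZ (h 0 i) (is_derive_id (0:R) (1:R))).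
  by rewrite add0r [_ *: 1]mulr1; exact.
apply/is_deriveP => e e0; have [r r0 rH] := (is_deriveP _ _ _ _).1 H e e0.
by exists r => // s s0 sr; have := rH s s0 sr; rewrite add0r addr0.
Qed.

Lemma taylor_form_derive S f x h k (t : R) : open S -> smooth S f -> S (x + t *: h) ->
  is_derive t (1:R) (fun s => taylor_form k h f (x + s *: h)) (taylor_form k.+1 h f (x + t *: h)).
Proof.
move=> oS Hf Sx; rewrite /taylor_form (sum_tuple_cons k (fun J => word_mon h J * partials J f (x + t *: h))).
apply: (@is_derive_sum R R _ (fun (J : k.-tuple 'I_d) (s : R) => word_mon h J * partials J f (x + s *: h))
  (fun J : k.-tuple 'I_d => \sum_(i < d) word_mon h (i :: J) * partials (i :: J) f (x + t *: h))) => J.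
have H := is_deriveZ (word_mon h J) (is_derive_on_line oS (smooth_partials J Hf 1%N) Sx).
apply: is_derive_eq H _.
rewrite [LHS]mulr_sumr; apply: eq_bigr => i _.
by rewrite /word_mon big_cons mulrA [_ * h 0 i]mulrC.
Qed.

Lemma taylor_form_bound f x h k (B : R) : (forall J, size J = k -> `|partials J f x| <= B) ->
  `|taylor_form k h f x| <= (d%:R * `|h|) ^+ k * B.
Proof.
move=> HB; rewrite /taylor_form; apply: (le_trans (ler_norm_sum _ _ _)).
apply: (@le_trans _ _ (\sum_(J : k.-tuple 'I_d) `|h| ^+ k * B)).
  apply: ler_sum => J _; rewrite normrM; apply: ler_pM => //.
    by have := word_mon_bound h J; rewrite size_tuple.
  by apply: HB; rewrite size_tuple.
rewrite sumr_const card_tuple card_ord exprMn -[leLHS]mulr_natl natrX.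
by rewrite mulrA.
Qed.

Lemma taylorN S f x h n (M C : R) : open S -> smooth S f ->
  (forall t : R, 0 <= t <= 1 -> S (x + t *: h)) ->
  (forall J y, S y -> `|partials J f y| <= M * C ^+ size J * (size J)`!%:R) ->
  `|f (x + h) - \sum_(k < n) taylor_form k h f x / k`!%:R| <= M * (d%:R * C * `|h|) ^+ n.
Proof.
move=> oS Hf HS HB.
pose g k (s : R) := taylor_form k h f (x + s *: h).
have Hg k (s : R) : 0 <= s <= 1 -> is_derive s (1:R) (g k) (g k.+1 s).
  by move=> /HS Ss; exact: taylor_form_derive oS Hf Ss.
have HgB (s : R) : 0 <= s <= 1 -> `|g n s| <= (d%:R * `|h|) ^+ n * (M * C ^+ n * n`!%:R).
  move=> /HS Ss; apply: taylor_form_bound => J sJ; rewrite -sJ; exact: HB.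
have := taylor1 Hg HgB (t := 1); rewrite ler01 lexx => /(_ isT).
have -> : g 0%N 1 = f (x + h).
  rewrite /g /taylor_form scale1r (eq_bigr (fun=> f (x + h))); last first.
    by move=> J _; rewrite [tval J]size0nil ?size_tuple// /word_mon big_nil mul1r.
  by rewrite sumr_const card_tuple expn0 mulr1n.
under eq_bigr => k _ do rewrite expr1n div1r /g scale0r addr0.
move=> H; apply: (le_trans H); rewrite expr1n div1r le_eqVlt; apply/orP; left; apply/eqP.
have n0 : n`!%:R != 0 :> R by rewrite pnatr_eq0 -lt0n fact_gt0.
rewrite !exprMn; move: (_ ^+ n) (_ ^+ n) (_ ^+ n) => p q s.
by field.
Qed.

(** The Taylor series converges geometrically as soon as d C |h| < 1. *)
Lemma taylor_near f x (r M C : R) : 0 < r -> 0 < C ->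
  smooth (cube x r) f ->
  (forall J y, cube x r y -> `|partials J f y| <= M * C ^+ size J * (size J)`!%:R) ->
  exists2 rho, 0 < rho & forall h, `|h| < rho ->
    [/\ `|h| < r, d%:R * C * `|h| < 1 & forall n,
     `|f (x + h) - \sum_(k < n) taylor_form k h f x / k`!%:R| <= M * (d%:R * C * `|h|) ^+ n].
Proof.
move=> r0 C0 Hf HB.
have D0 : 0 < d%:R * C + 1 by rewrite ltr_wpDl// mulr_ge0// ltW.
exists (Num.min r (d%:R * C + 1)^-1); first by rewrite lt_min r0 invr_gt0.
move=> h; rewrite lt_min => /andP[hr hD]; split=> // [|n].
  apply: (@le_lt_trans _ _ ((d%:R * C + 1) * `|h|)); first by rewrite ler_wpM2r// lerDl.
  by rewrite mulrC -ltr_pdivlMr// div1r.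
apply: (taylorN n (open_cube (x := x) (r := r)) Hf _ HB) => t /andP[t0 t1].
rewrite /cube/= addrAC subrr add0r normrZ ger0_norm//.
by apply: le_lt_trans hr; rewrite ler_piMl.
Qed.

Lemma cvg_of_geometric (v : nat -> R) (l M q : R) : 0 < M -> 0 <= q < 1 ->
  (forall n, `|l - v n| <= M * q ^+ n) -> v @ \oo --> l.
Proof.
move=> M0 /andP[q0 q1] H; apply/cvgrPdist_lt => e e0.
have qc : (fun n => q ^+ n) @ \oo --> (0 : R) by apply: cvg_expr; rewrite ger0_norm.
have eM : 0 < e / M by rewrite divr_gt0.
have /cvgrPdist_lt/(_ _ eM) := qc.
apply: filterS => n; rewrite sub0r normrN ger0_norm ?exprn_ge0// => qn.
by apply: (le_lt_trans (H n)); rewrite mulrC -ltr_pdivlMr.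
Qed.

(** The coefficient of a monomial collects the words whose numbers of letters are its
    exponents. *)
Definition taylor_coef f x k (al : {ffun 'I_d -> nat}) : R :=
  (\sum_(J : k.-tuple 'I_d | [forall i, count_mem i J == al i]) partials J f x) / k`!%:R.

Lemma word_mon_count h J : word_mon h J = \prod_(i < d) h 0 i ^+ count_mem i J.
Proof.
elim: J => [|j J IH].
  by rewrite /word_mon big_nil big1.
rewrite /word_mon big_cons -/(word_mon h J) IH.
rewrite [RHS](eq_bigr (fun i => h 0 i ^+ (j == i) * h 0 i ^+ count_mem i J)); last first.
  by move=> i _; rewrite -exprD.
rewrite big_split /=; congr (_ * _).
rewrite (bigD1 j)//= eqxx expr1 big1 ?mulr1// => i ij.
by rewrite eq_sym (negbTE ij) expr0.
Qed.

Lemma content_le k (J : k.-tuple 'I_d) i : (count_mem i J < k.+1)%N.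
Proof. by rewrite ltnS -{2}(size_tuple J); exact: count_size. Qed.

Lemma sum_count J : (\sum_(i < d) count_mem i J)%N = size J.
Proof.
elim: J => [|j J IH] /=; first by rewrite big1.
rewrite big_split /= IH (bigD1 j)//= eqxx big1 ?addn0 ?add1n// => i ij.
by rewrite eq_sym (negbTE ij).
Qed.

Lemma sum_by_content k (F : k.-tuple 'I_d -> R) :
  \sum_(J : k.-tuple 'I_d) F J =
  \sum_(al : {ffun 'I_d -> 'I_k.+1} | (\sum_i al i)%N == k)
    \sum_(J : k.-tuple 'I_d | [forall i, count_mem i J == [ffun i => al i : nat] i]) F J.
Proof.
pose p (J : k.-tuple 'I_d) : {ffun 'I_d -> 'I_k.+1} := [ffun i => Ordinal (content_le J i)].
rewrite (partition_big p (fun al => (\sum_i al i)%N == k)) /=; last first.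
  move=> J _; under eq_bigr => i _ do rewrite ffunE /=.
  by rewrite sum_count size_tuple.
apply: eq_bigr => al _; apply: eq_bigl => J.
apply/eqP/forallP => [<- i|H]; first by rewrite !ffunE.
by apply/ffunP => i; apply: val_inj; rewrite ffunE /=; have /eqP -> := H i; rewrite ffunE.
Qed.

Lemma monomial_content h k (al : {ffun 'I_d -> nat}) (J : k.-tuple 'I_d) :
  [forall i, count_mem i J == al i] -> monomial h al = word_mon h J.
Proof.
by move=> /forallP H; rewrite word_mon_count; apply: eq_bigr => i _; have /eqP -> := H i.
Qed.

Lemma analytic_at_of_bounds f x (r M C : R) : 0 < r -> 0 < M -> 0 < C ->
  smooth (cube x r) f ->
  (forall J y, cube x r y -> `|partials J f y| <= M * C ^+ size J * (size J)`!%:R) ->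
  analytic_at f x.
Proof.
move=> r0 M0 C0 Hf HB.
have [rho rho0 T] := taylor_near r0 C0 Hf HB.
exists (fun al : {ffun 'I_d -> nat} => taylor_coef f x (\sum_i al i)%N al), rho.
split=> // h hr; have [_ q1 {}T] := T h hr.
set q := d%:R * C * `|h|.
have q0 : 0 <= q by rewrite !mulr_ge0// ltW.
have Sx : cube x r x by rewrite /cube/= subrr normr0.
have fk k : 0 < k`!%:R :> R by rewrite ltr0n fact_gt0.
have E1 k (al : {ffun 'I_d -> 'I_k.+1}) : (\sum_i al i)%N == k ->
   (\sum_i [ffun i => al i : nat] i)%N = k.
  by move=> /eqP H; under eq_bigr => i _ do rewrite ffunE.
split.
  refine (@series_le_cvg _ _ (geometric M q) _ _ _ _).
  - by move=> k; apply: sumr_ge0.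
  - by move=> k; rewrite mulr_ge0 ?exprn_ge0// ltW.
  - move=> k; rewrite /degree_sum /=.
    apply: (@le_trans _ _ ((\sum_(J : k.-tuple 'I_d) `|partials J f x| * `|word_mon h J|) / k`!%:R)).
      rewrite sum_by_content mulr_suml; apply: ler_sum => al Hal.
      rewrite (E1 k al Hal) /taylor_coef normrM normrM normfV (ger0_norm (ltW (fk k))) mulrAC.
      apply: ler_wpM2r; first by rewrite invr_ge0 ltW.
      apply: (le_trans (ler_wpM2r _ (ler_norm_sum _ _ _))) => //.
      rewrite mulr_suml; apply: ler_sum => J HJ.
      by rewrite (monomial_content h HJ).
    rewrite ler_pdivrMr//.
    apply: (@le_trans _ _ (\sum_(J : k.-tuple 'I_d) (M * C ^+ k * k`!%:R) * `|h| ^+ k)).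
      apply: ler_sum => J _; apply: ler_pM => //.
        by have := HB J x Sx; rewrite size_tuple.
      by have := word_mon_bound h J; rewrite size_tuple.
    rewrite sumr_const card_tuple card_ord -[leLHS]mulr_natl natrX /q !exprMn.
    rewrite le_eqVlt; apply/orP; left; apply/eqP; ring.
  - by apply: is_cvg_geometric_series; rewrite ger0_norm.
have E2 n : series (degree_sum (fun al : {ffun 'I_d -> nat} => taylor_coef f x (\sum_i al i)%N al * monomial h al)) n
   = \sum_(k < n) taylor_form k h f x / k`!%:R.
  rewrite /series /= big_mkord; apply: eq_bigr => k _.
  rewrite /degree_sum /taylor_form sum_by_content mulr_suml; apply: eq_bigr => al Hal.
  rewrite (E1 k al Hal) /taylor_coef mulrAC; congr (_ / _).
  rewrite mulr_suml; apply: eq_bigr => J HJ.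
  by rewrite (monomial_content h HJ) mulrC.
apply: (cvg_of_geometric M0 (_ : 0 <= q < 1)) => [|n]; first by rewrite q0.
by rewrite E2; exact: T.
Qed.

(** All Taylor polynomials at x are 0. *)
Lemma flat_vanish f x (r M C : R) : 0 < r -> 0 < M -> 0 < C ->
  smooth (cube x r) f ->
  (forall J y, cube x r y -> `|partials J f y| <= M * C ^+ size J * (size J)`!%:R) ->
  (forall J, partials J f x = 0) -> exists2 rho, 0 < rho & forall y, cube x rho y -> f y = 0.
Proof.
move=> r0 M0 C0 Hf HB H0; have [rho rho0 T] := taylor_near r0 C0 Hf HB.
exists rho => // y; rewrite /cube/= => yr; have [_ q1 {}T] := T _ yr.
have H n : `|f y - (fun=> 0) n| <= M * (d%:R * C * `|y - x|) ^+ n.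
  have := T n; rewrite [x + _]addrC subrK big1// => k _.
  by rewrite /taylor_form big1 ?mul0r// => J _; rewrite H0 mulr0.
have q0 : 0 <= d%:R * C * `|y - x| by rewrite !mulr_ge0// ltW.
have L : (fun=> 0 : R) @ \oo --> f y.
  by apply: (cvg_of_geometric M0 _ H); rewrite q0.
have := @cvg_unique _ (@norm_hausdorff _ R) _ _ _ _ L (cvg_cst (0 : R)); apply.
Qed.

End TaylorN.

(** * Analytic functions of several variables *)

Section Ana.
Context {R : realType} {d : nat}.
Implicit Types (f g u v : 'rV[R]_d -> R) (x y z h : 'rV[R]_d) (S : set 'rV[R]_d) (J I : seq 'I_d).

(** Analyticity expressed by Cauchy estimates near x, with weights. *)
Definition ana_at f x := exists r M C, [/\ 0 < r, 0 < M, 0 < C, smooth (cube x r) f & growth (cube x r) f M C].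

Lemma cube_sub x (r r' : R) : r' <= r -> cube x r' `<=` cube x r.
Proof. by move=> rr y /= yr; exact: lt_le_trans yr rr. Qed.

Lemma cube_center x (r : R) : 0 < r -> cube x r x.
Proof. by move=> r0; rewrite /cube/= subrr normr0. Qed.

Lemma cube_nest x y (r : R) : cube x r y -> exists2 s, 0 < s & cube y s `<=` cube x r.
Proof.
move=> yr; exists (r - `|y - x|); first by rewrite subr_gt0.
move=> z zy; rewrite /cube/=; have -> : z - x = (z - y) + (y - x) by rewrite addrA subrK.
by apply: (le_lt_trans (ler_normD _ _)); rewrite -ltrBrDr.
Qed.

Lemma growth_sub S S' f M C : S' `<=` S -> growth S f M C -> growth S' f M C.
Proof. by move=> SS H J x /SS; exact: H. Qed.

Lemma growth_eq_open S f g M C : open S -> smooth S f -> (forall y, S y -> f y = g y) ->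
  growth S f M C -> growth S g M C.
Proof. by move=> oS Hf fg H J x Sx; rewrite (partials_eq_open J oS Hf fg Sx); exact: H. Qed.

Lemma ana_at_eq f g x (rho : R) : 0 < rho -> (forall y, cube x rho y -> f y = g y) ->
  ana_at f x -> ana_at g x.
Proof.
move=> rho0 fg [r [M [C [r0 M0 C0 Hf Bf]]]].
exists (Num.min r rho), M, C.
have s1 : cube x (Num.min r rho) `<=` cube x r by apply: cube_sub; rewrite ge_min lexx.
have s2 : cube x (Num.min r rho) `<=` cube x rho by apply: cube_sub; rewrite ge_min lexx orbT.
have oC := open_cube (x := x) (r := Num.min r rho).
have fg' y : cube x (Num.min r rho) y -> f y = g y by move=> /s2/fg.
split=> //; first by rewrite lt_min r0.
  exact: smooth_eq_open oC fg' (smooth_sub s1 Hf).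
exact: growth_eq_open oC (smooth_sub s1 Hf) fg' (growth_sub s1 Bf).
Qed.

Lemma ana_fam m (f : 'I_m -> 'rV[R]_d -> R) x : (forall i, ana_at (f i) x) ->
  exists r M C, [/\ 0 < r, 0 < M, 0 < C &
    forall i, smooth (cube x r) (f i) /\ growth (cube x r) (f i) M C].
Proof.
move=> H.
have {}H i : exists p : R * R * R, [/\ 0 < p.1.1, 0 < p.1.2, 0 < p.2,
    smooth (cube x p.1.1) (f i) & growth (cube x p.1.1) (f i) p.1.2 p.2].
  by have [r [M [C K]]] := H i; exists (r, M, C).
have [p Hp] := @choice _ _ (fun i (p : R * R * R) => [/\ 0 < p.1.1, 0 < p.1.2, 0 < p.2,
    smooth (cube x p.1.1) (f i) & growth (cube x p.1.1) (f i) p.1.2 p.2]) H.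
have sumle (F : 'I_m -> R) i : (forall i, 0 < F i) -> F i <= \sum_k F k + 1.
  move=> F0; rewrite (bigD1 i)//= -addrA lerDl addr_ge0// sumr_ge0// => k _; exact: ltW.
(* Sums of the constants bound each of them; adding 1 keeps them positive for an empty
   family. *)
exists (\big[Num.min/1]_i (p i).1.1), (\sum_k (p k).1.2 + 1), (\sum_k (p k).2 + 1); split.
- by apply/bigmin_gtP; split=> [|i _]; [exact: ltr01|case: (Hp i)].
- by rewrite ltr_wpDl// sumr_ge0// => i _; case: (Hp i) => _ /ltW.
- by rewrite ltr_wpDl// sumr_ge0// => i _; case: (Hp i) => _ _ /ltW.
move=> i; have [r0 M0 C0 Hf Bf] := Hp i.
have s : cube x (\big[Num.min/1]_i (p i).1.1) `<=` cube x (p i).1.1.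
  by apply: cube_sub; exact: bigmin_le.
split; first exact: smooth_sub Hf.
apply: (growth_le (ltW M0) (ltW C0) _ _ (growth_sub s Bf)).
  by apply: (sumle (fun i => (p i).1.2)) => k; case: (Hp k).
by apply: (sumle (fun i => (p i).2)) => k; case: (Hp k).
Qed.

Lemma ana_two f g x : ana_at f x -> ana_at g x ->
  exists r M C, [/\ 0 < r, 0 < M, 0 < C, (smooth (cube x r) f /\ growth (cube x r) f M C) &
    (smooth (cube x r) g /\ growth (cube x r) g M C)].
Proof.
move=> Hf Hg.
have [|r [M [C [r0 M0 C0 H]]]] := @ana_fam 2 (fun i => if i == ord0 then f else g) x.
  by move=> i; case: ifP.
by exists r, M, C; split => //; [exact: (H ord0)|exact: (H ord_max)].
Qed.

Lemma ana_lin f g (a b : R) x : ana_at f x -> ana_at g x -> ana_at (fun y => a * f y + b * g y) x.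
Proof.
move=> Hf Hg; have [r [M [C [r0 M0 C0 [Sf Bf] [Sg Bg]]]]] := ana_two Hf Hg.
have oC := open_cube (x := x) (r := r).
exists r, (`|a| * M + `|b| * M + 1), C; split => //.
- by rewrite ltr_wpDl// addr_ge0// mulr_ge0// ltW.
- exact: smooth_lin.
apply: (growth_le _ _ _ (lexx _) (growth_lin a b oC Sf Sg Bf Bg)); last by rewrite lerDl.
  by rewrite addr_ge0// mulr_ge0// ltW.
exact: ltW.
Qed.

Lemma ana_mul f g x : ana_at f x -> ana_at g x -> ana_at (fun y => f y * g y) x.
Proof.
move=> Hf Hg; have [r [M [C [r0 M0 C0 [Sf Bf] [Sg Bg]]]]] := ana_two Hf Hg.
have oC := open_cube (x := x) (r := r).
exists r, (8 * M * M), C; split => //.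
- by rewrite mulr_gt0// mulr_gt0.
- exact: smooth_mul.
exact: growth_mul oC Sf Sg (ltW M0) (ltW M0) (ltW C0) Bf Bg.
Qed.

Lemma ana_cont f x : ana_at f x -> {for x, continuous f}.
Proof.
by move=> [r [M [C [r0 _ _ Hf _]]]]; exact: Ck_cont (Hf 0%N) (cube_center x r0).
Qed.

Lemma ana_inv f x : f x != 0 -> ana_at f x -> ana_at (fun y => (f y)^-1) x.
Proof.
move=> f0 Hf; have c0 : 0 < `|f x| / 2 by rewrite divr_gt0// normr_gt0.
have [rho rho0 Hr] := (continuous_atP _ _).1 (ana_cont Hf) _ c0.
have [r [M [C [r0 M0 C0 Sf Bf]]]] := Hf.
have s1 : cube x (Num.min r rho) `<=` cube x r by apply: cube_sub; rewrite ge_min lexx.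
have s2 : cube x (Num.min r rho) `<=` cube x rho by apply: cube_sub; rewrite ge_min lexx orbT.
have fc y : cube x (Num.min r rho) y -> `|f x| / 2 <= `|f y|.
  move=> /s2/Hr H; have : `|f x| <= `|f y| + `|f y - f x|.
    by rewrite -{1}[f x](subKr (f y)) (le_trans (ler_normB _ _)).
  by move: H; move: (`|f x|) (`|f y|) (`|f y - f x|) => p q s; lra.
have oC := open_cube (x := x) (r := Num.min r rho).
have Sf' := smooth_sub s1 Sf.
exists (Num.min r rho), (`|f x| / 2)^-1, (C * (1 + 8 * M / (`|f x| / 2))); split.
- by rewrite lt_min r0.
- by rewrite invr_gt0.
- by rewrite mulr_gt0// ltr_pwDl// divr_ge0 ?ltW// mulr_gt0.
- apply: smooth_inv => // y /fc H; rewrite -normr_gt0; exact: lt_le_trans c0 H.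
exact: growth_inv oC Sf' M0 C0 c0 fc (growth_sub s1 Bf).
Qed.

Lemma ana_partial f x i : ana_at f x -> ana_at (partial i f) x.
Proof.
move=> [r [M [C [r0 M0 C0 Sf Bf]]]].
have H := growth_partial i (ltW M0) (ltW C0) (isT : (0 < 1)%N) Bf.
exists r, (1%:R * (C * (1 + 1%:R^-1)) * M), (C * (1 + 1%:R^-1)); split => //.
- by rewrite mul1r mulr_gt0// mulr_gt0// addr_gt0// invr_gt0.
- by rewrite mulr_gt0// addr_gt0// invr_gt0.
exact: smooth_partial.
Qed.

Lemma ana_partials f x J : ana_at f x -> ana_at (partials J f) x.
Proof. by move=> H; elim: J => //= i J; exact: ana_partial. Qed.

Lemma ana_cst (c : R) x : ana_at (fun=> c) x.
Proof.
exists 1, (`|c| + 1), 1; split => //; try by rewrite ltr_wpDl.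
  exact: smooth_cst.
move=> J y _; have [->|J0] := eqVneq J [::].
  by rewrite /= /wgeo expr0 weight0 !mulr1 lerDl.
by rewrite partials_cst// normr0 wgeo_ge0// addr_ge0.
Qed.

Lemma partial_coord i j : partial j (fun y => y 0 i) = (fun=> (i == j)%:R) :> ('rV[R]_d -> R).
Proof.
apply/funext => x.
have H : is_derive x (delta_mx 0 j) (fun y : 'rV[R]_d => y 0 i) ((i == j)%:R : R).
  apply/is_deriveP => e e0; exists 1 => // s s0 _.
  by rewrite !mxE eqxx /= addrAC subrr add0r mulrAC divff// mul1r subrr normr0.
by have [_] := H.
Qed.

Lemma ana_coord i x : ana_at (fun y => y 0 i) x.
Proof.
have Sm : smooth (cube x 1) (fun y : 'rV[R]_d => y 0 i).
  move=> k; elim: k => [|k IH]; first by split => // y _; exact: cont_coord.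
  split; first by move=> y _; exact: cont_coord.
  split=> [y _ j|j]; last by rewrite partial_coord; exact: Ck_cst.
  have H : is_derive y (delta_mx 0 j) (fun y : 'rV[R]_d => y 0 i) ((i == j)%:R : R).
    apply/is_deriveP => e e0; exists 1 => // s s0 _.
    by rewrite !mxE eqxx /= addrAC subrr add0r mulrAC divff// mul1r subrr normr0.
  by case: H.
exists 1, (`|x| + 4), 1; split => //; try by rewrite ltr_wpDl.
move=> J y yx; elim/last_ind: J => [|J j _].
  rewrite /= /wgeo expr0 weight0 !mulr1; apply: le_trans (coord_le_norm y i) _.
  rewrite -[y](subrK x) (le_trans (ler_normD _ _))// addrC lerD2l.
  by rewrite (le_trans (ltW yx))// ler1n.
rewrite partials_rcons partial_coord size_rcons.
have [->|J0] := eqVneq J [::].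
  rewrite /= /wgeo expr1n mulr1 /weight.
  apply: (@le_trans _ _ 1); first by case: (_ == _); rewrite ?normr1 ?normr0.
  have -> : 1`!%:R / 2 ^+ 2 = 4^-1 :> R by rewrite factS fact0 mul1n -natrX mul1r.
  by rewrite ler_pdivlMr// mul1r lerDr.
by rewrite partials_cst// normr0 wgeo_ge0// addr_ge0.
Qed.

Lemma ana_nbhs f x : ana_at f x -> exists2 rho, 0 < rho & forall y, cube x rho y -> ana_at f y.
Proof.
move=> [r [M [C [r0 M0 C0 Sf Bf]]]]; exists r => // y yr.
have [s s0 sub] := cube_nest yr.
by exists s, M, C; split => //; [exact: smooth_sub Sf|exact: growth_sub Bf].
Qed.

Lemma fact_of_growth S f M C J y : 0 <= M -> 0 <= C -> growth S f M C -> S y ->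
  `|partials J f y| <= M * C ^+ size J * (size J)`!%:R.
Proof.
move=> M0 C0 B Sy; apply: (le_trans (B J y Sy)); rewrite /wgeo; apply: ler_wpM2l.
  by rewrite mulr_ge0// exprn_ge0.
exact: weight_le_fact.
Qed.

Lemma growth_of_fact S f M C : 0 <= M -> 0 <= C ->
  (forall J y, S y -> `|partials J f y| <= M * C ^+ size J * (size J)`!%:R) -> growth S f M (C * 4).
Proof.
move=> M0 C0 H J y Sy; apply: (le_trans (H J y Sy)); rewrite /wgeo exprMn.
rewrite [leRHS](_ : _ = M * C ^+ size J * (4 ^+ size J * weight (size J))); last by ring.
apply: ler_wpM2l; first by rewrite mulr_ge0// exprn_ge0.
exact: fact_le_weight.
Qed.

Lemma ana_sol S (lam : R) u x : open S -> solves_eigen S lam u -> S x -> ana_at u x.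
Proof.
move=> oS Hu Sx; have [r [M [C [r0 M0 C0 rS HB]]]] := sol_bound oS Hu Sx.
exists r, M, (C * 4); split => //; first by rewrite mulr_gt0.
  by apply: smooth_sub (sol_smooth oS Hu) => y /ltW; exact: rS.
by apply: growth_of_fact; rewrite ?ltW// => J y /ltW; exact: HB.
Qed.

Lemma ana_analytic_at f x : ana_at f x -> analytic_at f x.
Proof.
move=> [r [M [C [r0 M0 C0 Sf Bf]]]].
by apply: (analytic_at_of_bounds r0 M0 C0 Sf) => J y; exact: fact_of_growth (ltW M0) (ltW C0) Bf.
Qed.

Lemma ana_flat f x : ana_at f x -> (forall J, partials J f x = 0) ->
  exists2 rho, 0 < rho & forall y, cube x rho y -> f y = 0.
Proof.
move=> [r [M [C [r0 M0 C0 Sf Bf]]]].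
by apply: (flat_vanish r0 M0 C0 Sf) => J y; exact: fact_of_growth (ltW M0) (ltW C0) Bf.
Qed.

Lemma partials_zero S f J y : open S -> (forall y, S y -> f y = 0) -> S y -> partials J f y = 0.
Proof.
move=> oS f0 Sy.
rewrite (partials_eq_open (f := fun=> 0) J oS (@smooth_cst _ _ S 0) _ Sy); last by move=> z /f0.
by have [->//|J0] := eqVneq J [::]; rewrite partials_cst.
Qed.

(** Differentiability of every order is a local property. *)
Lemma smooth_local S f : (forall y, S y -> ana_at f y) -> smooth S f.
Proof.
suff H k g : (forall y, S y -> exists2 r, 0 < r & smooth (cube y r) g) -> Ck k S g.
  move=> HS k; apply: H => y /HS[r [M [C [r0 _ _ Sf _]]]]; by exists r.
elim: k g => [|k IH] g Hg.
  by split=> // y /Hg[r r0 Sg]; exact: Ck_cont (Sg 0%N) (cube_center y r0).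
split; first by move=> y /Hg[r r0 Sg]; exact: Ck_cont (Sg 0%N) (cube_center y r0).
split=> [y /Hg[r r0 Sg] j|j]; first exact: Ck_derivable (Sg 1%N) (cube_center y r0).
by apply: IH => y /Hg[r r0 Sg]; exists r => //; exact: smooth_partial.
Qed.

Lemma segment_cont x y (t : R) : {for t, continuous (fun t : R => x + t *: (y - x))}.
Proof.
apply/continuous_atP => e e0; exists (e / (`|y - x| + 1)); first by rewrite divr_gt0// ltr_wpDl.
move=> s st; rewrite opprD addrACA subrr add0r -scalerBl normrZ.
apply: (@le_lt_trans _ _ (`|s - t| * (`|y - x| + 1))); first by rewrite ler_wpM2l// lerDl.
by rewrite -ltr_pdivlMr// ltr_wpDl.
Qed.

Lemma cube_convex x r y z (t : R) : cube x r y -> cube x r z -> 0 <= t <= 1 ->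
  cube x r (y + t *: (z - y)).
Proof.
move=> yr zr /andP[t0 t1]; rewrite /cube/=.
have -> : y + t *: (z - y) - x = (1 - t) *: (y - x) + t *: (z - x).
  by apply/rowP => i; rewrite !mxE; ring.
apply: (le_lt_trans (ler_normD _ _)); rewrite !normrZ !ger0_norm ?subr_ge0//.
move: yr zr; rewrite /cube/=; move: (`|y - x|) (`|z - x|) => a b ar br.
have [->|tn0] := eqVneq t 0; first by rewrite subr0 mul1r mul0r addr0.
have tp : 0 < t by rewrite lt_neqAle eq_sym tn0.
have : (1 - t) * a <= (1 - t) * r by rewrite ler_wpM2l ?subr_ge0// ltW.
have : t * b < t * r by rewrite ltr_pM2l.
lra.
Qed.

(** On the segment from q to y, the points where all derivatives of f vanish form a nonempty
    open and closed set. *)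
Lemma ana_identity f p r q : (forall y, cube p r y -> ana_at f y) -> cube p r q ->
  (forall J, partials J f q = 0) -> forall y, cube p r y -> f y = 0.
Proof.
move=> Hf pq q0 z pz.
pose T := (fun t : R => q + t *: (z - q)) @` `[0, 1]%classic.
have cT : connected T.
  apply: connected_continuous_connected; first exact: segment_connected.
  by apply: continuous_in_subspaceT => t _; exact: segment_cont.
have Tp y : T y -> cube p r y.
  by move=> [t + <-]; rewrite /= in_itv /= => t01; exact: cube_convex.
have Tend t : 0 <= t <= 1 -> T (q + t *: (z - q)) by move=> t01; exists t => //; rewrite /= in_itv.
suff E : [set y | T y /\ forall J, partials J f y = 0] = T.
  have : T z by have := Tend 1; rewrite ler01 lexx scale1r addrC subrK; exact.
  by rewrite -E => -[_ /(_ [::])].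
apply: cT.
- exists q; split=> //; have := Tend 0; rewrite ler01 lexx scale0r addr0; exact.
- exists (\bigcup_(c in [set c : 'rV[R]_d * R | forall y, cube c.1 c.2 y -> f y = 0]) cube c.1 c.2).
    by apply: bigcup_open => c _; exact: open_cube.
  apply/seteqP; split=> y [Ty Py]; split=> //.
    have [rho rho0 H] := ana_flat (Hf _ (Tp y Ty)) Py.
    by exists (y, rho) => //; exact: cube_center.
  by move: Py => [[c s] /= cs0 cy] J; exact: partials_zero (open_cube (x := c) (r := s)) cs0 cy.
- exists (closure [set y | T y /\ forall J, partials J f y = 0]); first exact: closed_closure.
  apply/seteqP; split=> y [Ty Py]; split=> //; first by apply: subset_closure; split.
  move=> J; apply/eqP; rewrite -normr_le0; apply/ler_addgt0Pr => e e0; rewrite add0r.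
  have [rho rho0 H] := (continuous_atP _ _).1 (ana_cont (ana_partials J (Hf _ (Tp y Ty)))) e e0.
  have [y' [[_ P'] /= y'y]] := Py _ (nbhs_cube y rho0).
  by have := H _ y'y; rewrite P' sub0r normrN => /ltW.
Qed.

End Ana.

(** * Straightening an analytic hypersurface *)

Section Flatten.
Context {R : realType} {n : nat}.
Implicit Types (f g h : 'rV[R]_n.+1 -> R) (x y z : 'rV[R]_n.+1).

(** The change of coordinates that forgets the j-th coordinate and appends w as the last
    one. *)
Definition to_chart (j : 'I_n.+1) (w : 'rV[R]_n.+1 -> R) x : 'rV[R]_n.+1 :=
  \row_i (if unlift ord_max i is Some k then x 0 (lift j k) else w x).

(** The point whose coordinates other than the j-th are the first n entries of y, and whose
    j-th coordinate is t: the inverse of the chart up to the choice of t. *)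
Definition of_chart (j : 'I_n.+1) y (t : R) : 'rV[R]_n.+1 :=
  \row_i (if unlift j i is Some k then y 0 (lift ord_max k) else t).

Lemma to_chart_lift j w x k : to_chart j w x 0 (lift ord_max k) = x 0 (lift j k).
Proof. by rewrite mxE liftK. Qed.
Lemma to_chart_max j w x : to_chart j w x 0 ord_max = w x.
Proof. by rewrite mxE unlift_none. Qed.
Lemma of_chart_lift j y t k : of_chart j y t 0 (lift j k) = y 0 (lift ord_max k).
Proof. by rewrite mxE liftK. Qed.
Lemma of_chart_at j y t : of_chart j y t 0 j = t.
Proof. by rewrite mxE unlift_none. Qed.

Lemma row_ext_lift j x y : x 0 j = y 0 j -> (forall k, x 0 (lift j k) = y 0 (lift j k)) -> x = y.
Proof. by move=> H1 H2; apply/rowP => i; case: (unliftP j i) => [k ->|->]. Qed.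

Lemma of_to_chart j w x : of_chart j (to_chart j w x) (x 0 j) = x.
Proof.
by apply: (row_ext_lift (j := j)) => [|k]; rewrite ?of_chart_at ?of_chart_lift ?to_chart_lift.
Qed.

Lemma to_of_chart j w y t : w (of_chart j y t) = y 0 ord_max -> to_chart j w (of_chart j y t) = y.
Proof.
by move=> E; apply: (row_ext_lift (j := ord_max)) => [|k]; rewrite ?to_chart_max ?to_chart_lift ?of_chart_lift.
Qed.

Lemma of_chart_dist j y z t s e : 0 <= e -> `|y - z| <= e -> `|t - s| <= e ->
  `|of_chart j y t - of_chart j z s| <= e.
Proof.
move=> e0 yz ts; apply: norm_le_coord => // i; rewrite sub_entry.
case: (unliftP j i) => [k ->|->]; last by rewrite !of_chart_at.
rewrite !of_chart_lift; apply: le_trans yz.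
by rewrite -sub_entry; exact: coord_le_norm.
Qed.

Lemma lipschitz_cube (w : 'rV[R]_n.+1 -> R) p (rho B : R) : 0 <= B ->
  Ck 1 (cube p rho) w ->
  (forall i x, cube p rho x -> `|partial i w x| <= B) ->
  forall x y, `|x - p| < rho / 3 -> `|y - p| < rho / 3 -> `|w x - w y| <= n.+1%:R * B * `|x - y|.
Proof.
move=> B0 Hw HB x y xp yp; set h := x - y.
have inC t : `|t| <= `|1 : R| -> cube p rho (y + t *: h).
  rewrite normr1 => t1; rewrite /cube/= addrAC (le_lt_trans (ler_normD _ _))// normrZ.
  have h2 : `|h| < rho / 3 + rho / 3.
    have -> : h = (x - p) - (y - p) by rewrite /h opprB addrA subrK.
    by rewrite (le_lt_trans (ler_normB _ _))// ltrD.
  apply: (@le_lt_trans _ _ (`|y - p| + `|h|)); first by rewrite lerD2l ler_piMl.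
  by apply: (lt_le_trans (ltrD yp h2)); lra.
have D t : `|t| <= `|1 : R| -> is_derive (y + t *: h) h w (\sum_i h 0 i * partial i w (y + t *: h)).
  move=> t1; apply: is_derive_of_line.
  have := @is_derive_on_line _ _ (cube p rho) w (y + t *: h) h 0 (open_cube (x := p) (r := rho)) Hw.
  by rewrite scale0r addr0; apply; exact: inC.
have [t t1] := mvt_line (s := 1) (fun t t1 => @ex_derive _ _ _ _ _ _ _ (D t t1)).
have -> : y + 1 *: h = x by rewrite scale1r /h addrC subrK.
rewrite mul1r => ->.
have [_ ->] := D t t1.
apply: (le_trans (ler_norm_sum _ _ _)).
apply: (@le_trans _ _ (\sum_(i < n.+1) `|h| * B)).
  by apply: ler_sum => i _; rewrite normrM ler_pM// ?coord_le_norm// HB//; exact: inC.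
by rewrite sumr_const card_ord -[leLHS]mulr_natl [`|h| * B]mulrC mulrA.
Qed.

(** The change of coordinates maps W onto a cube with inverse psi, and composition with psi
    preserves analyticity. The last clause is the chain rule along the hypersurfaces on which w
    is constant. *)
Definition chart (j : 'I_n.+1) (w : 'rV[R]_n.+1 -> R) p (W : set 'rV[R]_n.+1) (s : R)
    (psi : 'rV[R]_n.+1 -> 'rV[R]_n.+1) : Prop :=
  let V := cube (to_chart j w p) s in
  [/\ open W, W p, 0 < s, (forall x, W x -> V (to_chart j w x) /\ psi (to_chart j w x) = x) &
      (forall y, V y -> W (psi y) /\ to_chart j w (psi y) = y)] /\
  [/\ (forall y, V y -> {for y, continuous psi}),
      (forall h, (forall x, W x -> ana_at h x) -> forall y, V y -> ana_at (fun z => h (psi z)) y) &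
      (forall h k y, (forall x, W x -> ana_at h x) -> V y ->
         partial (lift ord_max k) (fun z => h (psi z)) y =
         partial (lift j k) h (psi y) - partial (lift j k) w (psi y) / partial j w (psi y) * partial j h (psi y))].

End Flatten.

Section Straighten.
Context {R : realType} {n : nat}.
Implicit Types (f g h : 'rV[R]_n.+1 -> R) (x y z : 'rV[R]_n.+1).
Variables (j : 'I_n.+1) (w : 'rV[R]_n.+1 -> R) (p : 'rV[R]_n.+1) (rho c B sg : R).
Hypothesis rho0 : 0 < rho.
Hypothesis c0 : 0 < c.
Hypothesis B0 : 0 <= B.
Hypothesis sg1 : sg = 1 \/ sg = -1.
Hypothesis wp : w p = 0.
Hypothesis Aw : forall x, cube p rho x -> ana_at w x.
Hypothesis wc : forall x, cube p rho x -> c <= sg * partial j w x.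
Hypothesis wB : forall i x, cube p rho x -> `|partial i w x| <= B.

Let Sw : smooth (cube p rho) w. Proof. exact: smooth_local. Qed.
Let oC : open (cube p rho). Proof. exact: open_cube. Qed.
Let phi := to_chart j w.
Let L := n.+1%:R * B.
Let L0 : 0 <= L. Proof. by rewrite mulr_ge0. Qed.
Let lipw x y : `|x - p| < rho / 3 -> `|y - p| < rho / 3 -> `|w x - w y| <= L * `|x - y|.
Proof. exact: lipschitz_cube B0 (Sw 1%N) wB x y. Qed.

Let nsg : `|sg| = 1. Proof. by case: sg1 => ->; rewrite ?normrN1 ?normr1. Qed.

(** The sign sg is that of the j-th derivative of w, so sg * w increases along the j-th
    direction with slope at least c. *)
Let mono x (t : R) : `|x - p| <= rho / 4 -> `|t| <= rho / 2 -> 0 <= t ->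
  c * t <= sg * (w (x + t *: delta_mx 0 j) - w x).
Proof.
move=> xp tr t0.
have inC s : `|s| <= `|t| -> cube p rho (x + s *: delta_mx 0 j).
  move=> st; rewrite /cube/= addrAC (le_lt_trans (ler_normD _ _))// normrZ norm_delta mulr1.
  apply: (le_lt_trans (lerD xp (le_trans st tr))); move: rho0; move: (rho) => q q0; lra.
have [s st ->] := mvt_line (fun s st => Ck_derivable (j := j) (Sw 1%N) (inC s st)).
rewrite mulrCA mulrC; apply: ler_wpM2l => //; exact: wc (inC s st).
Qed.

Let mono_abs x (t : R) : `|x - p| <= rho / 4 -> `|t| <= rho / 2 ->
  `|x + t *: delta_mx 0 j - p| <= rho / 4 ->
  c * `|t| <= `|w (x + t *: delta_mx 0 j) - w x|.
Proof.
move=> xp tr xtp; rewrite -[leRHS]mul1r -nsg -normrM.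
have [t0|t0] := leP 0 t.
  by apply: le_trans (ler_norm _); rewrite ger0_norm//; exact: mono.
have := @mono (x + t *: delta_mx 0 j) (- t) xtp; rewrite normrN => /(_ tr).
rewrite oppr_ge0 => /(_ (ltW t0)).
rewrite scaleNr addrK (ltr0_norm t0) => H; apply: le_trans H _.
by rewrite -normrN -mulrN opprB ler_norm.
Qed.

Let s : R := Num.min (rho / 8) (c * rho / (16 * (L + 1))).
Let V : set 'rV[R]_n.+1 := cube (phi p) s.
Let W : set 'rV[R]_n.+1 := [set x | cube p (rho / 4) x /\ V (phi x)].

Let s0 : 0 < s.
Proof. by rewrite lt_min !divr_gt0//= ?mulr_gt0// ltr_wpDl. Qed.
Let s8 : s <= rho / 8. Proof. by rewrite ge_min lexx. Qed.
Let sL : (L + 1) * s <= c * rho / 16.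
Proof.
have L1 : 0 < L + 1 by rewrite ltr_wpDl.
rewrite mulrC -ler_pdivlMr//.
have -> : c * rho / 16 / (L + 1) = c * rho / (16 * (L + 1)) by rewrite -mulrA -invfM.
by rewrite ge_min lexx orbT.
Qed.

Let of_chart_near y t : V y -> `|t - p 0 j| <= rho / 4 -> `|of_chart j y t - p| <= rho / 4.
Proof.
move=> Vy tp; rewrite -[X in _ - X](of_to_chart j w p); apply: of_chart_dist => //.
  by rewrite divr_ge0 ?ltW.
by apply: (le_trans (ltW Vy)); apply: (le_trans s8); move: rho0; move: (rho) => q q0; lra.
Qed.

Let of_chart_shift y t t' : of_chart j y t' = of_chart j y t + (t' - t) *: delta_mx 0 j.
Proof.
apply: (row_ext_lift (j := j)) => [|k]; rewrite !mxE ?unlift_none ?liftK !eqxx /=.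
  by rewrite mulr1 addrC subrK.
by rewrite eq_sym (negbTE (neq_lift j k)) mulr0 addr0.
Qed.

(** On the line through p the slope c moves sg * w by c rho / 4 in both directions, and the
    choice of s keeps the lines over V so close that this still exceeds |y_max| < s. *)
Let ends y : V y ->
  sg * w (of_chart j y (p 0 j - rho / 4)) < sg * y 0 ord_max < sg * w (of_chart j y (p 0 j + rho / 4)).
Proof.
move=> Vy; set a := p 0 j - rho / 4; set b := p 0 j + rho / 4.
have pe : of_chart j (phi p) (p 0 j) = p by exact: of_to_chart.
have q4 : 0 <= rho / 4 by rewrite divr_ge0 ?ltW.
have q2 : `|rho / 4| <= rho / 2 by rewrite ger0_norm//; move: rho0; move: (rho) => q q0; lra.
have near3 y' t : V y' -> `|t - p 0 j| <= rho / 4 -> `|of_chart j y' t - p| < rho / 3.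
  move=> Vy' tp; apply: (le_lt_trans (of_chart_near Vy' tp)); move: rho0; move: (rho) => q q0; lra.
have Vp : V (phi p) by rewrite /V; exact: cube_center.
have ta : `|a - p 0 j| <= rho / 4 by rewrite /a addrAC subrr add0r normrN ger0_norm.
have tb : `|b - p 0 j| <= rho / 4 by rewrite /b addrAC subrr add0r ger0_norm.
have pp : `|p - p| <= rho / 4 by rewrite subrr normr0.
have Eb : c * (rho / 4) <= sg * w (of_chart j (phi p) b).
  have := mono pp q2 q4; rewrite wp subr0.
  have -> // : of_chart j (phi p) b = p + (rho / 4) *: delta_mx 0 j.
  by rewrite (of_chart_shift _ (p 0 j)) pe /b addrAC subrr add0r.
have Ea : sg * w (of_chart j (phi p) a) <= - (c * (rho / 4)).
  have pa : `|of_chart j (phi p) a - p| <= rho / 4 by exact: of_chart_near.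
  have := mono pa q2 q4.
  have -> : of_chart j (phi p) a + (rho / 4) *: delta_mx 0 j = p.
    have Ea0 : a - p 0 j = - (rho / 4) by rewrite /a addrAC subrr add0r.
    by rewrite (of_chart_shift _ (p 0 j)) pe Ea0 scaleNr subrK.
  by rewrite wp sub0r mulrN lerNr.
have lip t : `|t - p 0 j| <= rho / 4 -> `|sg * w (of_chart j y t) - sg * w (of_chart j (phi p) t)| <= L * s.
  move=> tp; rewrite -mulrBr normrM nsg mul1r.
  apply: (le_trans (lipw (near3 _ _ Vy tp) (near3 _ _ Vp tp))).
  apply: ler_wpM2l => //; apply: of_chart_dist; rewrite ?subrr ?normr0 ?ltW//.
have yl : `|sg * y 0 ord_max| < s.
  rewrite normrM nsg mul1r; apply: le_lt_trans Vy.
  have := coord_le_norm (y - phi p) ord_max; rewrite sub_entry to_chart_max wp subr0; exact.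
have := lip _ ta; have := lip _ tb; move: sL c0 rho0 Ea Eb yl.
have cr : 0 < c * rho by rewrite mulr_gt0.
rewrite mulrDl mul1r.
move: (L * s) (sg * w (of_chart j y a)) (sg * w (of_chart j y b)) (sg * w (of_chart j (phi p) a)) (sg * w (of_chart j (phi p) b)) (sg * y 0 ord_max).
move: (s) cr; rewrite [c * (rho / 4)]mulrA; move: (c * rho) => K s' K0 Ls ya yb pa pb yy.
move=> h1 _ _ h2 h3; rewrite ltr_norml => /andP[h4 h5].
rewrite !ler_norml => /andP[h6 h7] /andP[h8 h9].
by apply/andP; split; lra.
Qed.

Let exist_root y : V y -> exists2 t, p 0 j - rho / 4 < t < p 0 j + rho / 4 & w (of_chart j y t) = y 0 ord_max.
Proof.
move=> Vy; have /andP[Ha Hb] := ends Vy.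
set a := p 0 j - rho / 4 in Ha *; set b := p 0 j + rho / 4 in Hb *.
have ab : a <= b by rewrite /a /b; move: rho0; move: (rho) (p 0 j) => q pj q0; lra.
have C : {within `[a, b], continuous (fun t : R => sg * w (of_chart j y t))}.
  apply: continuous_in_subspaceT => t /[1!inE]; rewrite /= in_itv /= => /andP[t1 t2].
  have tp : `|t - p 0 j| <= rho / 4.
    by rewrite ler_norml; move: t1 t2; rewrite /a /b; move: (rho) (p 0 j) => q pj h1 h2; apply/andP; split; lra.
  apply: cont_mul; first exact: cst_continuous.
  have inC : cube p rho (of_chart j y t).
    rewrite /cube/=; apply: (le_lt_trans (of_chart_near Vy tp)); move: rho0; move: (rho) => q q0; lra.
  apply/continuous_atP => e e0.
  have [r r0 H] := (continuous_atP _ _).1 (ana_cont (Aw inC)) e e0.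
  exists r => // t' tt; apply: H; apply: le_lt_trans tt; apply: of_chart_dist => //.
  by rewrite subrr normr0.
have [|t tI E] := IVT (v := sg * y 0 ord_max) ab C.
  by rewrite ge_min le_max (ltW Ha) (ltW Hb) orbT.
have E' : w (of_chart j y t) = y 0 ord_max.
  have sg0 : sg != 0 by rewrite -normr_eq0 nsg oner_eq0.
  exact: (mulfI sg0).
exists t => //; move: tI; rewrite in_itv /= => /andP[]; rewrite !le_eqVlt.
move=> /orP[/eqP ta|->]; first by move: Ha; rewrite ta E ltxx.
by move=> /orP[/eqP tb|->//]; move: Hb; rewrite -tb E ltxx.
Qed.

Let WV x : W x -> `|x - p| < rho / 4. Proof. by case. Qed.

Let psi_exists y : exists x, V y -> W x /\ phi x = y.
Proof.
have [Vy|nV] := pselect (V y); last by exists 0.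
have [t /andP[t1 t2] E] := exist_root Vy.
have Ephi : phi (of_chart j y t) = y by exact: to_of_chart.
exists (of_chart j y t) => _; split => //; split; last by rewrite Ephi.
have tp : `|t - p 0 j| < rho / 4.
  by rewrite ltr_norml; apply/andP; split; lra.
rewrite /cube/=; apply: (@le_lt_trans _ _ (Num.max `|t - p 0 j| (rho / 8))).
  rewrite -[X in _ - X](of_to_chart j w p); apply: of_chart_dist.
  - by rewrite le_max normr_ge0.
  - by rewrite le_max (le_trans (ltW Vy) s8) orbT.
  - by rewrite le_max lexx.
by rewrite gt_max tp /=; lra.
Qed.

(** Points with the same image lie on a line in direction j, on which w is strictly
    monotone. *)
Let W_inj x x' : W x -> W x' -> phi x = phi x' -> x = x'.
Proof.
move=> Wx Wx' E.
have wE : w x = w x'.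
  by have := congr1 (fun z : 'rV[R]_n.+1 => z 0 ord_max) E; rewrite /phi !to_chart_max.
have xE : x + (x' 0 j - x 0 j) *: delta_mx 0 j = x'.
  rewrite -[RHS](of_to_chart j w x') -(of_to_chart j w x) -/phi -E.
  by rewrite !of_chart_at -of_chart_shift.
have d2 : `|x' 0 j - x 0 j| <= rho / 2.
  have h1 := coord_le_norm (x' - p) j; have h2 := coord_le_norm (x - p) j.
  have {h1} h1 := le_lt_trans h1 (WV Wx'); have {h2} h2 := le_lt_trans h2 (WV Wx).
  move: h1 h2; rewrite !sub_entry !ltr_norml ler_norml => /andP[h1 h2] /andP[h3 h4].
  by apply/andP; split; lra.
have := mono_abs (ltW (WV Wx)) d2; rewrite xE => /(_ (ltW (WV Wx'))).
rewrite wE subrr normr0 pmulr_rle0// normr_le0 subr_eq0 => /eqP jE.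
by rewrite -xE jE subrr scale0r addr0.
Qed.

Let K : R := 1 + (1 + L) / c.
Let K0 : 0 < K. Proof. by rewrite ltr_pwDl// divr_ge0 ?addr_ge0// ltW. Qed.

Let lip_phi x x' : `|x - p| < rho / 3 -> `|x' - p| < rho / 3 -> `|phi x - phi x'| <= (1 + L) * `|x - x'|.
Proof.
move=> h1 h2; apply: norm_le_coord; first by rewrite mulr_ge0// addr_ge0.
move=> i; rewrite sub_entry; case: (unliftP ord_max i) => [k ->|->].
  rewrite !to_chart_lift -sub_entry; apply: le_trans (coord_le_norm _ _) _.
  by rewrite ler_peMl// lerDl.
rewrite !to_chart_max; apply: (le_trans (lipw h1 h2)).
by apply: ler_wpM2r => //; rewrite lerDr.
Qed.

Let openW : open W.
Proof.
apply/openP => x [xp Vx].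
have [e1 e10 H1] := cube_nest xp.
have [e2 e20 H2] := cube_nest Vx.
have L1 : 0 < 1 + L by rewrite ltr_pwDl.
exists (Num.min (e1 / 2) (e2 / (2 * (1 + L)))).
  by rewrite lt_min !divr_gt0// mulr_gt0.
move=> y; rewrite le_min => /andP[y1 y2].
have y1' : cube x e1 y by rewrite /cube/=; apply: (le_lt_trans y1); rewrite ltr_pdivrMr// ltr_pMr// ltr1n.
have q43 : rho / 4 < rho / 3 by rewrite ltr_pM2l// ltf_pV2 ?posrE// ltr_nat.
split; first exact: H1.
apply: H2; rewrite /cube/=.
apply: (le_lt_trans (lip_phi (lt_trans (H1 _ y1') q43) (lt_trans xp q43))).
apply: (le_lt_trans (ler_wpM2l (ltW L1) y2)).
have -> : (1 + L) * (e2 / (2 * (1 + L))) = e2 / 2 by field; rewrite gt_eqF.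
by rewrite ltr_pdivrMr// ltr_pMr// ltr1n.
Qed.

Let W_sub : W `<=` cube p rho.
Proof. by move=> x [xp _]; apply: lt_trans xp _; rewrite ltr_pdivrMr// ltr_pMr// ltr1n. Qed.

Section Psi.
Variable psi : 'rV[R]_n.+1 -> 'rV[R]_n.+1.
Hypothesis psiP : forall y, V y -> W (psi y) /\ phi (psi y) = y.

Let psi_lift y k : V y -> psi y 0 (lift j k) = y 0 (lift ord_max k).
Proof. by move=> /psiP[_ E]; rewrite -[in RHS]E to_chart_lift. Qed.

Let psi_w y : V y -> w (psi y) = y 0 ord_max.
Proof. by move=> /psiP[_ E]; rewrite -[in RHS]E to_chart_max. Qed.

Let psi_of_chart y : V y -> psi y = of_chart j y (psi y 0 j).
Proof. by move=> /psiP[_ E]; have := of_to_chart j w (psi y); rewrite -[to_chart j w _]/(phi _) E => ->. Qed.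

(** The first n coordinates of psi y are those of y; the j-th is controlled by the slope of
    w. *)
Let lip_psi y z : V y -> V z -> `|psi y - psi z| <= K * `|y - z|.
Proof.
move=> Vy Vz; have [Wy _] := psiP Vy; have [Wz _] := psiP Vz.
set t := psi y 0 j - psi z 0 j.
have jz : `|psi z 0 j - p 0 j| <= rho / 4.
  by rewrite -sub_entry; apply: le_trans (coord_le_norm _ _) _; exact/ltW/WV.
have mp := of_chart_near Vy jz; set m := of_chart j y (psi z 0 j) in mp.
have ym : psi y = m + t *: delta_mx 0 j by rewrite /m -of_chart_shift -psi_of_chart.
have d2 : `|t| <= rho / 2.
  have h1 := coord_le_norm (psi y - p) j; have h2 := coord_le_norm (psi z - p) j.
  have {h1} h1 := le_lt_trans h1 (WV Wy); have {h2} h2 := le_lt_trans h2 (WV Wz).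
  move: h1 h2; rewrite /t !sub_entry !ltr_norml ler_norml => /andP[h1 h2] /andP[h3 h4].
  by apply/andP; split; lra.
have H := mono_abs mp d2; rewrite -ym in H.
have {}H := H (ltW (WV Wy)).
have q43 : rho / 4 < rho / 3 by rewrite ltr_pM2l// ltf_pV2 ?posrE// ltr_nat.
have H2 : `|w (psi y) - w m| <= (1 + L) * `|y - z|.
  have -> : w (psi y) - w m = (w (psi y) - w (psi z)) + (w (psi z) - w m) by rewrite addrA subrK.
  apply: (le_trans (ler_normD _ _)); rewrite mulrDl mul1r; apply: lerD.
    by rewrite !psi_w// -sub_entry; exact: coord_le_norm.
  apply: (le_trans (lipw (lt_trans (WV Wz) q43) (le_lt_trans mp q43))).
  apply: ler_wpM2l => //; rewrite distrC {1}(psi_of_chart Vz) /m; apply: of_chart_dist => //.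
  by rewrite subrr normr0.
rewrite (psi_of_chart Vy) (psi_of_chart Vz); apply: of_chart_dist; first by rewrite mulr_ge0// ltW.
  by rewrite ler_peMl// lerDl divr_ge0 ?addr_ge0// ltW.
rewrite -/t; apply: (@le_trans _ _ ((1 + L) / c * `|y - z|)).
  rewrite mulrAC ler_pdivlMr// mulrC; exact: le_trans H H2.
by apply: ler_wpM2r => //; rewrite lerDr.
Qed.

Let sgm (i : 'I_n.+1) : 'I_n.+1 := if unlift ord_max i is Some k then lift j k else j.
Let av (i : 'I_n.+1) : 'rV[R]_n.+1 -> R := fun=> (if unlift ord_max i is Some _ then 1 else 0).
(** The j-th component of the vector fields: by implicit differentiation the j-th coordinate
    of psi moves with velocity - d_k w / d_j w along the coordinate of y that stands for x_k,
    and with velocity 1 / d_j w along the last coordinate. *)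
Let bv (i : 'I_n.+1) : 'rV[R]_n.+1 -> R := fun x =>
  (if unlift ord_max i is Some k then - partial (lift j k) w x else 1) * (partial j w x)^-1.

Let dj0 x : cube p rho x -> partial j w x != 0.
Proof.
move=> /wc H; apply/eqP => E; move: H; rewrite E mulr0; apply/negP; rewrite -ltNge//.
Qed.

Let ana_av i x : ana_at (av i) x. Proof. exact: ana_cst. Qed.

Let ana_bv i x : cube p rho x -> ana_at (bv i) x.
Proof.
move=> xC; rewrite /bv; apply: ana_mul; last first.
  by apply: ana_inv; [exact: dj0|apply: ana_partial; exact: Aw].
case: (unlift _ _) => [k|]; last exact: ana_cst.
have H := ana_lin (-1) 0 (ana_partial (lift j k) (Aw xC)) (ana_cst 0 x).
by apply: ana_at_eq ltr01 _ H => y _; rewrite mulr0 addr0 mulN1r.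
Qed.

(** The map psi is Lipschitz, so the first order expansion of w at psi y has an error of
    smaller order than t. Along y + t e_i the increments of w and of all coordinates but the
    j-th are known exactly, and the expansion gives the increment of the j-th one. *)
Let root_derive y i : V y ->
  is_derive (0:R) (1:R) (fun s => psi (y + s *: delta_mx 0 i) 0 j) (bv i (psi y)).
Proof.
move=> Vy; have [Wy _] := psiP Vy; set x := psi y in Wy *.
have xC := W_sub Wy; set D := partial j w x.
have D0 : D != 0 by exact: dj0.
have Dc : c <= `|D|.
  by apply: le_trans (wc xC) _; rewrite -/D -[`|D|]mul1r -nsg -normrM ler_norm.
set T : R := if unlift ord_max i is Some _ then 0 else 1.
set q : R := if unlift ord_max i is Some k then partial (lift j k) w x else 0.
have -> : bv i x = (T - q) / D.
  by rewrite /bv /T /q; case: (unlift _ _) => [k|]; rewrite ?sub0r ?subr0.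
apply/is_deriveP => e e0.
set e1 := e * c / (2 * K).
have e10 : 0 < e1 by rewrite divr_gt0 ?mulr_gt0.
have [r r0 Hr] := C1_diff oC (Sw 1%N) xC e10.
have [v v0 Hv] := cube_nest Vy.
exists (Num.min v (r / K)); first by rewrite lt_min v0 divr_gt0.
move=> t t0; rewrite lt_min => /andP[tv tr].
rewrite add0r [t *: 1]mulr1 scale0r addr0 -/x.
set y' := y + t *: delta_mx 0 i.
have yy' : `|y' - y| = `|t| by rewrite /y' addrAC subrr add0r normrZ norm_delta mulr1.
have Vy' : V y' by apply: Hv; rewrite /cube/= yy'.
set Dl := psi y' - x.
have DlK : `|Dl| <= K * `|t| by rewrite -yy'; exact: lip_psi.
have Dlr : `|Dl| < r by apply: (le_lt_trans DlK); rewrite mulrC -ltr_pdivlMr.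
have := Hr Dl Dlr.
have -> : x + Dl = psi y' by rewrite /Dl addrC subrK.
have -> : w (psi y') - w x = t * T.
  rewrite !psi_w// /y' mxE mxE addrAC subrr add0r mxE eqxx /= /T.
  case: (unliftP ord_max i) => [k ->|->]; last by rewrite eqxx.
  by rewrite (negbTE (neq_lift _ _)).
have -> : \sum_l Dl 0 l * partial l w x = (psi y' 0 j - x 0 j) * D + t * q.
  rewrite (bigD1_ord j)//=; congr (_ + _); first by rewrite /Dl sub_entry.
  rewrite (eq_bigr (fun k : 'I_n => t * ((lift ord_max k == i)%:R * partial (lift j k) w x))); last first.
    move=> k _; rewrite /Dl sub_entry !psi_lift// /y' mxE mxE addrAC subrr add0r mxE eqxx /=.
    by rewrite mulrA.
  rewrite -mulr_sumr /q; congr (_ * _); case: (unliftP ord_max i) => [k ->|->].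
    rewrite (bigD1 k)//= eqxx mul1r big1 ?addr0// => l lk.
    by rewrite (inj_eq lift_inj) (negbTE lk) mul0r.
  by rewrite big1// => l _; rewrite eq_sym (negbTE (neq_lift _ _)) mul0r.
move=> H; set eta := psi y' 0 j - x 0 j in H *.
have E : eta / t - (T - q) / D = - ((t * T - (eta * D + t * q)) / (t * D)).
  by field; rewrite D0.
rewrite E normrN normrM normfV normrM ltr_pdivrMr; last by rewrite mulr_gt0 ?normr_gt0.
apply: (le_lt_trans H); apply: (le_lt_trans (ler_wpM2l (ltW e10) DlK)).
have tp : 0 < `|t| by rewrite normr_gt0.
have -> : e1 * (K * `|t|) = e / 2 * (`|t| * c).
  by rewrite /e1; field; rewrite gt_eqF.
apply: (@lt_le_trans _ _ (e * (`|t| * c))).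
  by rewrite ltr_pM2r ?mulr_gt0// ltr_pdivrMr// ltr_pMr// ltr1n.
by rewrite ler_pM2l// ler_pM2l.
Qed.

Let comp_derive h y i : Ck 1 W h -> V y ->
  is_derive y (delta_mx 0 i) (fun z => h (psi z)) (vfield av bv sgm j i h (psi y)).
Proof.
move=> Hh Vy; have [Wy _] := psiP Vy; apply: is_derive_of_line.
pose v l := av i (psi y) * (l == sgm i)%:R + bv i (psi y) * (l == j)%:R.
have -> : vfield av bv sgm j i h (psi y) = \sum_l v l * partial l h (psi y).
  rewrite /v; under eq_bigr => l _ do rewrite mulrDl.
  rewrite big_split /= /vfield; congr (_ + _).
    rewrite (bigD1 (sgm i))//= eqxx mulr1 big1 ?addr0// => l li.
    by rewrite (negbTE li) mulr0 mul0r.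
  rewrite (bigD1 j)//= eqxx mulr1 big1 ?addr0// => l li.
  by rewrite (negbTE li) mulr0 mul0r.
apply: (chain_curve (gam := fun s : R => psi (y + s *: delta_mx 0 i)) openW Hh Wy).
  by rewrite scale0r addr0.
move=> l; case: (unliftP j l) => [k ->|->].
  have -> : v (lift j k) = (lift ord_max k == i)%:R.
    rewrite /v [_ == j]eq_sym (negbTE (neq_lift j k)) mulr0 addr0 /av /sgm.
    case: (unliftP ord_max i) => [k' ->|->].
      by rewrite mul1r !(inj_eq lift_inj).
    by rewrite mul0r eq_sym (negbTE (neq_lift _ _)).
  have [e e0 He] := cube_nest Vy.
  apply/is_deriveP => d d0; exists e => // t t0 te.
  rewrite add0r [t *: 1]mulr1 scale0r addr0 !psi_lift//; last first.
    by apply: He; rewrite /cube/= addrAC subrr add0r normrZ norm_delta mulr1.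
  by rewrite !mxE eqxx /= addrAC subrr add0r mulrAC divff// mul1r subrr normr0.
have -> : v j = bv i (psi y).
  rewrite /v eqxx mulr1 /av /sgm; case: (unlift _ _) => [k|]; last by rewrite mul0r add0r.
  by rewrite (negbTE (neq_lift j k)) mulr0 add0r.
exact: root_derive.
Qed.

Let Sav i : smooth W (av i). Proof. by apply: smooth_local => x _; exact: ana_av. Qed.
Let Sbv i : smooth W (bv i). Proof. by apply: smooth_local => x /W_sub; exact: ana_bv. Qed.
Let openV : open V. Proof. exact: open_cube. Qed.

Let psi_close y e : V y -> 0 < e -> exists2 r, 0 < r & forall z, `|z - y| < r -> V z /\ `|psi z - psi y| < e.
Proof.
move=> Vy e0; have [v v0 Hv] := cube_nest Vy.
exists (Num.min v (e / K)); first by rewrite lt_min v0 divr_gt0.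
move=> z; rewrite lt_min => /andP[zv ze]; have Vz := Hv _ zv.
by split=> //; apply: (le_lt_trans (lip_psi Vz Vy)); rewrite mulrC -ltr_pdivlMr.
Qed.

Let comp_cont h y : {for psi y, continuous h} -> V y -> {for y, continuous (fun z => h (psi z))}.
Proof.
move=> Ch Vy; apply/continuous_atP => e e0.
have [r r0 Hr] := (continuous_atP _ _).1 Ch e e0.
have [r' r'0 H'] := psi_close Vy r0.
by exists r' => // z /H'[_]; exact: Hr.
Qed.

Let comp_smooth h : smooth W h -> smooth V (fun z => h (psi z)).
Proof.
move=> Hh k; elim: k h Hh => [|k IH] h Hh.
  by split=> // y Vy; apply: comp_cont => //; apply: Ck_cont (Hh 0%N) _; case: (psiP Vy).
apply: (@CkSP _ _ _ _ _ (fun i y => vfield av bv sgm j i h (psi y))) => //.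
- by move=> y Vy; apply: comp_cont => //; apply: Ck_cont (Hh 0%N) _; case: (psiP Vy).
- by move=> i y Vy; apply: comp_derive => //; exact: Hh.
- by move=> i; apply: IH; exact: smooth_vfield.
Qed.

Let partials_comp h J y : smooth W h -> V y ->
  partials J (fun z => h (psi z)) y = vfield_word av bv sgm j J h (psi y).
Proof.
move=> Hh; elim: J y => [//|i J IH] y Vy.
have HJ := @smooth_vfield_word _ _ _ W openW av bv sgm j Sav Sbv J h Hh.
have [D E] := comp_derive i (HJ 1%N) Vy.
rewrite partials_cons; apply: (etrans _ E).
apply: (partial_eq_open openV _ Vy D) => z Vz; exact/esym/IH.
Qed.

(** The derivatives of h \o psi are words in the vector fields applied to h and composed
    with psi, so they inherit the Cauchy estimates of these words. *)
Let ana_comp h : (forall x, W x -> ana_at h x) -> forall y, V y -> ana_at (fun z => h (psi z)) y.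
Proof.
move=> Ah y Vy; have [Wy _] := psiP Vy; have Sh := smooth_local Ah.
have [r1 [A1 [C1 [r10 A10 C10 H1]]]] := ana_fam (fun i => ana_av i (psi y)).
have [r2 [A2 [C2 [r20 A20 C20 H2]]]] := ana_fam (fun i => ana_bv i (W_sub Wy)).
have [r3 [M [C3 [r30 M0 C30 S3 B3]]]] := Ah _ Wy.
set r := Num.min r1 (Num.min r2 r3).
have r0 : 0 < r by rewrite !lt_min r10 r20.
have s1 : cube (psi y) r `<=` cube (psi y) r1 by apply: cube_sub; rewrite ge_min lexx.
have s2 : cube (psi y) r `<=` cube (psi y) r2 by apply: cube_sub; rewrite !ge_min lexx orbT.
have s3 : cube (psi y) r `<=` cube (psi y) r3 by apply: cube_sub; rewrite !ge_min lexx !orbT.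
set A := A1 + A2; set C := C1 + C2 + C3.
have A0 : 0 < A by rewrite addr_gt0.
have C0 : 0 < C by rewrite !addr_gt0.
have Ba i : growth (cube (psi y) r) (av i) A C.
  apply: (growth_le (ltW A10) (ltW C10) _ _ (growth_sub s1 (H1 i).2)).
    by rewrite lerDl ltW.
  by rewrite /C -addrA lerDl addr_ge0// ltW.
have Bb i : growth (cube (psi y) r) (bv i) A C.
  apply: (growth_le (ltW A20) (ltW C20) _ _ (growth_sub s2 (H2 i).2)).
    by rewrite lerDr ltW.
  by rewrite /C addrAC lerDr addr_ge0// ltW.
have Bh : growth (cube (psi y) r) h M C.
  apply: (growth_le (ltW M0) (ltW C30) (lexx _) _ (growth_sub s3 B3)).
  by rewrite /C lerDr addr_ge0// ltW.
have oCr := open_cube (x := psi y) (r := r).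
have WB := @vfield_word_bound _ _ _ (cube (psi y) r) oCr av bv sgm j (fun i => smooth_sub s1 (H1 i).1) (fun i => smooth_sub s2 (H2 i).1)
  A C (ltW A0) (ltW C0) Ba Bb h M (smooth_sub s3 S3) (ltW M0) Bh.
have [e e0 He] := psi_close Vy r0.
set G := 16 * A * (C * expR 1) * expR 1 in WB.
have G0 : 0 < G by rewrite !mulr_gt0// expR_gt0.
have eV : cube y e `<=` V by move=> z /He[].
exists e, M, (G * 4); split => //; first by rewrite mulr_gt0.
  exact: smooth_sub eV (comp_smooth Sh).
apply: growth_of_fact; rewrite ?ltW// => J z ze.
by rewrite (partials_comp J Sh (eV _ ze)); apply: WB; have [] := He _ ze.
Qed.

Lemma straighten_psi : chart j w p W s psi.
Proof.
split; split => //.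
- by split; apply: cube_center => //; rewrite divr_gt0.
- move=> x Wx; have [_ Vx] := Wx; split => //.
  by have [W1 E1] := psiP Vx; exact: W_inj.
- move=> y Vy; apply/continuous_atP => e e0.
  by have [r r0 H] := psi_close Vy e0; exists r => // z /H[].
- move=> h k y Ah Vy.
  have [_ E] := comp_derive (lift ord_max k) (smooth_local Ah 1%N) Vy.
  rewrite /partial E /vfield /av /bv /sgm liftK mul1r; congr (_ + _).
  by rewrite !mulNr.
Qed.

End Psi.

Lemma straighten_aux : exists W0 s1 psi, chart j w p W0 s1 psi /\ W0 `<=` cube p rho.
Proof.
have [psi psiP] := @choice _ _ (fun y x => V y -> W x /\ phi x = y) psi_exists.
by exists W, s, psi; split => //; exact: straighten_psi.
Qed.

End Straighten.

Section StraightenMain.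
Context {R : realType} {n : nat}.

(** On a small cube w is analytic, its j-th derivative is at least half its value at p in
    absolute value, and all first derivatives are bounded. *)
Lemma straighten (j : 'I_n.+1) (w : 'rV[R]_n.+1 -> R) p (rho : R) :
  ana_at w p -> w p = 0 -> partial j w p != 0 -> 0 < rho ->
  exists W s psi, [/\ chart j w p W s psi, W `<=` cube p rho & (forall x, W x -> ana_at w x)].
Proof.
move=> Aw wp D0 rho0; set D := partial j w p in D0.
have [r1 r10 H1] := ana_nbhs Aw.
have c0 : 0 < `|D| / 2 by rewrite divr_gt0// normr_gt0.
have [r2 r20 H2] := (continuous_atP _ _).1 (ana_cont (ana_partial j Aw)) _ c0.
have [r3 r30 H3] : exists2 r : R, 0 < r & forall i : 'I_n.+1, forall y, `|y - p| < r ->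
    `|partial i w y - partial i w p| < 1.
  apply: (@finite_radius R n.+1 (fun i r => forall y, `|y - p| < r -> `|partial i w y - partial i w p| < 1)).
    by move=> i r r' rr H y yr; apply: H; exact: lt_le_trans yr rr.
  move=> i; apply: (continuous_atP _ _).1 => //; exact: ana_cont (ana_partial i Aw).
set r := Num.min rho (Num.min r1 (Num.min r2 r3)).
have r0 : 0 < r by rewrite !lt_min rho0 r10 r20.
have s1 : cube p r `<=` cube p r1 by apply: cube_sub; rewrite !ge_min lexx orbT.
have s2 : cube p r `<=` cube p r2 by apply: cube_sub; rewrite !ge_min lexx !orbT.
have s3 : cube p r `<=` cube p r3 by apply: cube_sub; rewrite !ge_min lexx !orbT.
have sr : cube p r `<=` cube p rho by apply: cube_sub; rewrite !ge_min lexx.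
pose B := \sum_i `|partial i w p| + 1.
have B0 : 0 <= B by rewrite addr_ge0// sumr_ge0.
have wB i x : cube p r x -> `|partial i w x| <= B.
  move=> /s3 xr; have := H3 i x xr => /ltW h.
  rewrite -[partial i w x](subrK (partial i w p)) addrC /B (le_trans (ler_normD _ _))// lerD//.
  by rewrite (bigD1 i)//= lerDl sumr_ge0.
have sgD : Num.sg D = 1 \/ Num.sg D = -1.
  by case: (sgrP D) => [E|_|_]; [move: D0; rewrite E eqxx|left|right].
have sgn : `|Num.sg D| = 1 by case: sgD => ->; rewrite ?normrN1 ?normr1.
have wc x : cube p r x -> `|D| / 2 <= Num.sg D * partial j w x.
  move=> /s2 xr; have := H2 x xr; rewrite -/D => h.
  have -> : Num.sg D * partial j w x = `|D| + Num.sg D * (partial j w x - D).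
    by rewrite mulrBr [in RHS](normrEsg D) addrC subrK.
  have : `|Num.sg D * (partial j w x - D)| < `|D| / 2 by rewrite normrM sgn mul1r.
  have aux (a q : R) : - (a / 2) < q -> a / 2 <= a + q by move=> aq; lra.
  by rewrite ltr_norml => /andP[h1 _]; exact: aux.
have [W [s [psi [H A3]]]] :=
  straighten_aux r0 c0 B0 sgD wp (fun x xr => H1 x (s1 x xr)) wc wB.
by exists W, s, psi; split => // x /A3; [move/sr|move/s1/H1].
Qed.

End StraightenMain.

(** * Invariance of dimension *)

Section Dimension.
Context {R : realType}.

Definition pos_part (t : R) : R := (t + `|t|) / 2.

Lemma pos_part_ge0 t : 0 <= pos_part t.
Proof.
rewrite /pos_part divr_ge0// -lerBlDl sub0r; apply: le_trans (ler_norm _) _; by rewrite normrN.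
Qed.

Lemma pos_part_gt0 t : 0 < t -> 0 < pos_part t.
Proof. by move=> t0; rewrite /pos_part gtr0_norm// divr_gt0// addr_gt0. Qed.

Lemma pos_part_pos t : 0 < pos_part t -> 0 < t.
Proof.
move=> H; rewrite ltNge; apply/negP => t0; move: H; rewrite /pos_part ler0_norm// subrr mul0r ltxx//.
Qed.

Lemma pos_part_lip s t : `|pos_part s - pos_part t| <= `|s - t|.
Proof.
rewrite /pos_part -mulrBl opprD addrACA normrM normfV (ger0_norm (ler0n _ 2)) ler_pdivrMr//.
apply: (le_trans (ler_normD _ _)); rewrite mulr2n mulrDr mulr1 lerD2l.
exact: ler_dist_dist.
Qed.

Lemma four_quarters (a b c d e : R) : a < e / 4 -> b < e / 4 -> c < e / 4 -> d < e / 4 ->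
  a + b + (c + d) < e.
Proof. by move=> *; lra. Qed.

(** The function |A x - A y| + max(0, e - |B x - B y|) is continuous on a compact set and
    nowhere 0, so it has a positive minimum eta; for |A x - A y| < eta its second term is
    positive. *)
Lemma uniform_separation n (p q : nat) (x0 : 'rV[R]_n) (r : R) (A : 'rV[R]_n -> 'rV[R]_p) (B : 'rV[R]_n -> 'rV[R]_q) (e : R) :
  0 < r -> 0 < e ->
  (forall x, `|x - x0| <= r -> {for x, continuous A}) ->
  (forall x, `|x - x0| <= r -> {for x, continuous B}) ->
  (forall x y, `|x - x0| <= r -> `|y - x0| <= r -> A x = A y -> B x = B y) ->
  exists2 eta, 0 < eta & forall x y, `|x - x0| <= r -> `|y - x0| <= r ->
    `|A x - A y| < eta -> `|B x - B y| < e.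
Proof.
move=> r0 e0 CA CB AB.
pose l (z : 'rV[R]_(n + n)) := lsubmx z; pose rr (z : 'rV[R]_(n + n)) := rsubmx z.
(* Pairs of points of R^n are points of R^(n + n). *)
pose F (z : 'rV[R]_(n + n)) := `|A (l z) - A (rr z)| + pos_part (e - `|B (l z) - B (rr z)|).
pose c0 : 'rV[R]_(n + n) := row_mx x0 x0.
have boxP (z : 'rV[R]_(n + n)) : (forall i, c0 0 i - r <= z 0 i <= c0 0 i + r) <->
    `|l z - x0| <= r /\ `|rr z - x0| <= r.
  have D (a b : R) : (b - r <= a <= b + r) = (`|a - b| <= r).
    by rewrite ler_norml; apply/andP/andP => -[h1 h2]; split; lra.
  split=> [H|[H1 H2] i].
    split; apply: norm_le_coord; try exact: ltW; move=> i; rewrite sub_entry -D.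
      by have := H (lshift n i); rewrite /c0 row_mxEl /l mxE.
    by have := H (rshift n i); rewrite /c0 row_mxEr /rr mxE.
  rewrite D; case: (split_ordP i) => k ->.
    have := le_trans (coord_le_norm (l z - x0) k) H1.
    by rewrite sub_entry /c0 row_mxEl /l mxE.
  have := le_trans (coord_le_norm (rr z - x0) k) H2.
  by rewrite sub_entry /c0 row_mxEr /rr mxE.
have ln (z z' : 'rV[R]_(n + n)) : `|l z - l z'| <= `|z - z'|.
  apply: norm_le_coord => // i; have := coord_le_norm (z - z') (lshift n i).
  by rewrite !mxE.
have rn (z z' : 'rV[R]_(n + n)) : `|rr z - rr z'| <= `|z - z'|.
  apply: norm_le_coord => // i; have := coord_le_norm (z - z') (rshift n i).
  by rewrite !mxE.
have diff (V : normedModType R) (a b a' b' : V) : `| `|a - b| - `|a' - b'| | <= `|a - a'| + `|b - b'|.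
  apply: le_trans (ler_dist_dist _ _) _.
  by rewrite opprD addrACA -opprD (le_trans (ler_normB _ _)).
have [||z /boxP[z1 z2] zmin] := @box_argmin R (n + n) (fun i => c0 0 i - r) (fun i => c0 0 i + r) F.
- by move=> i; rewrite lerBlDr -addrA lerDl addr_ge0// ltW.
- move=> z /boxP[z1 z2]; apply/continuous_atP => d d0.
  have d4 : 0 < d / 4 by rewrite divr_gt0.
  have [r1 r10 H1] := (continuous_atP _ _).1 (CA _ z1) _ d4.
  have [r2 r20 H2] := (continuous_atP _ _).1 (CA _ z2) _ d4.
  have [r3 r30 H3] := (continuous_atP _ _).1 (CB _ z1) _ d4.
  have [r4 r40 H4] := (continuous_atP _ _).1 (CB _ z2) _ d4.
  exists (Num.min (Num.min r1 r2) (Num.min r3 r4)); first by rewrite !lt_min r10 r20 r30.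
  move=> y; rewrite !lt_min => /andP[/andP[y1 y2] /andP[y3 y4]].
  have h1 := H1 _ (le_lt_trans (ln y z) y1); have h2 := H2 _ (le_lt_trans (rn y z) y2).
  have h3 := H3 _ (le_lt_trans (ln y z) y3); have h4 := H4 _ (le_lt_trans (rn y z) y4).
  rewrite /F opprD addrACA; apply: (le_lt_trans (ler_normD _ _)).
  have k1 := diff _ (A (l y)) (A (rr y)) (A (l z)) (A (rr z)).
  have k2 := le_trans (pos_part_lip _ _) (_ : `|e - `|B (l y) - B (rr y)| - (e - `|B (l z) - B (rr z)|)| <= `|B (l y) - B (l z)| + `|B (rr y) - B (rr z)|).
  apply: (le_lt_trans (lerD k1 (k2 _))).
    by rewrite opprB addrC subrKA distrC; exact: diff.
  exact: four_quarters h1 h2 h3 h4.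
have m0 : 0 < F z.
  rewrite /F; have [E|E] := eqVneq (A (l z)) (A (rr z)).
    rewrite E subrr normr0 add0r (AB _ _ z1 z2 E) subrr normr0 subr0.
    exact: pos_part_gt0.
  by rewrite ltr_pwDl ?pos_part_ge0// normr_gt0 subr_eq0.
exists (F z) => // x y xr yr xy.
have := zmin (row_mx x y); rewrite /F /l /rr row_mxKl row_mxKr => H.
have {}H := H ((boxP (row_mx x y)).2 _); rewrite /l /rr row_mxKl row_mxKr in H.
have {}H := H (conj xr yr).
have : 0 < pos_part (e - `|B x - B y|).
  rewrite -(ltrD2l `|A x - A y|) addr0; apply: lt_le_trans H; exact: xy.
by move/pos_part_pos; rewrite subr_gt0.
Qed.

Lemma int_lt1 (z : int) : `|z%:~R : R| < 1 -> z = 0.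
Proof.
rewrite -intr_norm -[1]/(1%:~R) ltr_int => H; apply/eqP; rewrite -normr_eq0; lia.
Qed.

Lemma floor_stable (t t' e : R) : (Num.floor t)%:~R + e <= t -> t + e <= (Num.floor t)%:~R + 1 ->
  `|t' - t| < e -> Num.floor t' = Num.floor t.
Proof.
move=> h1 h2; rewrite ltr_norml => /andP[h3 h4].
by apply: floor_def; rewrite intrD; apply/andP; split; lra.
Qed.

Lemma floor_same (t t' : R) : Num.floor t = Num.floor t' -> `|t - t'| < 1.
Proof.
move=> E; have := floor_itv t; have := floor_itv t'; rewrite E intrD.
by move=> /andP[h1 h2] /andP[h3 h4]; rewrite ltr_norml; apply/andP; split; lra.
Qed.

(** With n + 1 shifts, if each had a coordinate of t close to a wall, then two shifts would
    share this coordinate. But the walls of the two shifted grids are at least 1 / (n + 1) = 2 e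
    apart. *)
Lemma good_colour n (t : 'I_n -> R) : let e := (2 * n.+1%:R)^-1 in
  exists c : 'I_n.+1, forall i, let s := t i - c%:R / n.+1%:R in
    (Num.floor s)%:~R + e <= s /\ s + e <= (Num.floor s)%:~R + 1.
Proof.
move=> e; apply: contrapT => H.
have np : 0 < n.+1%:R :> R by rewrite ltr0n.
have bad (c : 'I_n.+1) : exists i : 'I_n, exists k : int, `|t i - c%:R / n.+1%:R - k%:~R| < e.
  apply: contrapT => nb; apply: H; exists c => i s; apply: contrapT => K; apply: nb; exists i.
  have /andP[f1 f2] := floor_itv s; rewrite intrD in f2.
  have [h1|h1] := leP ((Num.floor s)%:~R + e) s.
    have [h2|h2] := leP (s + e) ((Num.floor s)%:~R + 1); first by exfalso; apply: K.
    exists (Num.floor s + 1); rewrite -/s intrD ltr_norml; apply/andP; split; lra.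
  have e0 : 0 < e by rewrite invr_gt0 mulr_gt0.
  by exists (Num.floor s); rewrite -/s ltr_norml; apply/andP; split; lra.
have [i Hi] := @choice _ _ (fun (c : 'I_n.+1) (i : 'I_n) => exists k : int, `|t i - c%:R / n.+1%:R - k%:~R| < e) bad.
have ninj : ~ injective i.
  by move=> /leq_card; rewrite !card_ord ltnn.
apply: ninj => c c' E.
have [k Hk] := Hi c; have [k' Hk'] := Hi c'; rewrite -E in Hk'.
have e2 : n.+1%:R * (e + e) = 1.
  by rewrite /e; field; rewrite gt_eqF.
have : `|(Posz c' - Posz c - Posz n.+1 * (k - k'))%:~R : R| < 1.
  have -> : (Posz c' - Posz c - Posz n.+1 * (k - k'))%:~R =
      n.+1%:R * ((t (i c) - c%:R / n.+1%:R - k%:~R) - (t (i c) - c'%:R / n.+1%:R - k'%:~R)) :> R.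
    have Ei (j : nat) : (Posz j)%:~R = j%:R :> R by [].
    rewrite !rmorphB rmorphM rmorphB /= !Ei; move: (n.+1%:R) np => q q0.
    move: (t (i c)) (c%:R) (c'%:R) (k%:~R) (k'%:~R) => a1 a2 a3 a4 a5.
    by field; rewrite gt_eqF.
  rewrite normrM ger0_norm// -[X in _ < X]e2 ltr_pM2l//.
  by apply: (le_lt_trans (ler_normB _ _)); exact: ltrD.
move=> /int_lt1 Z.
apply: val_inj => /=; have c1 := ltn_ord c; have c2 := ltn_ord c'.
have [kk|kk] := eqVneq k k'; first by move: Z; rewrite kk subrr mulr0 subr0; lia.
exfalso; have : (k - k' <= -1) || (1 <= k - k') by lia.
by move=> /orP[K|K]; nia.
Qed.

Definition cell n m (V : set 'rV[R]_n) (g : 'rV[R]_n -> 'rV[R]_m) : Prop :=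
  [/\ open V, (forall v, V v -> {for v, continuous g}) &
      (forall a b, V a -> V b -> g a = g b -> a = b)].

(** The inverse of an injective g is uniformly continuous on compact sets. So in R^n a mesh
    m can be chosen such that two points with images in the same cell of size m have distance
    less than r. For each of the n + 1 colours c, label a point x of a fine grid by 0 if g x
    lies in the same cell of the c-th shifted grid as the image of some point of the lower face
    in direction c, and by 1 otherwise; on the opposite face the label is 1, since the faces
    have distance 2 r. In some cell of the fine grid every colour takes both labels. But for one
    colour the images are so deep inside a cell of its grid that the label is constant. *)
Lemma no_drop_of_dimension n (V : set 'rV[R]_n.+1) (g : 'rV[R]_n.+1 -> 'rV[R]_n) v0 :
  cell V g -> V v0 -> False.
Proof.
move=> [oV Cg inj] Vv0.
have [r r0 rV] := (openP V).1 oV v0 Vv0.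
have Cid (x : 'rV[R]_n.+1) : {for x, continuous (@id 'rV[R]_n.+1)}.
  by apply/continuous_atP => e e0; exists e.
(* Points of the cube whose images are closer than m are closer than r. *)
have [m m0 Hm] := @uniform_separation n.+1 n n.+1 v0 r g id r r0 r0
  (fun x xr => Cg x (rV x xr)) (fun x _ => Cid x) (fun x y xr yr => inj x y (rV x xr) (rV y yr)).
pose e : R := (2 * n.+1%:R)^-1.
have np : 0 < n.+1%:R :> R by rewrite ltr0n.
have e0 : 0 < e by rewrite invr_gt0 mulr_gt0.
have em : 0 < m * e by rewrite mulr_gt0.
(* Points closer than eta have images closer than m e, the depth guaranteed by the
   colouring. *)
have [eta eta0 He] := @uniform_separation n.+1 n.+1 n v0 r id g (m * e) r0 em
  (fun x _ => Cid x) (fun x xr => Cg x (rV x xr)) (fun x y _ _ xy => congr1 g xy).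
have [N0 HN0] : exists N : nat, 2 * r / eta < N%:R.
  by exists (Num.bound (2 * r / eta)); apply: archi_boundP; rewrite divr_ge0 ?mulr_ge0 ?ltW.
set N := N0.+1.
have Np : 0 < N%:R :> R by rewrite ltr0n.
have mesh : 2 * r / N%:R < eta.
  rewrite ltr_pdivrMr// [X in _ < X]mulrC -ltr_pdivrMr//; apply: (lt_trans HN0).
  by rewrite ltr_nat.
(* The fine grid with N steps, from the lower corner of the cube; larger indices are cut off
   at N. *)
pose X (v : 'I_n.+1 -> nat) : 'rV[R]_n.+1 := \row_i (v0 0 i - r + 2 * r / N%:R * (minn (v i) N)%:R).
have XQ v : `|X v - v0| <= r.
  apply: norm_le_coord; first exact: ltW.
  move=> i; rewrite !mxE.
  have h1 : 0 <= 2 * r / N%:R * (minn (v i) N)%:R by rewrite mulr_ge0// divr_ge0 ?mulr_ge0 ?ltW.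
  have h2 : 2 * r / N%:R * (minn (v i) N)%:R <= 2 * r.
    rewrite mulrAC ler_pdivrMr//; apply: ler_wpM2l; first by rewrite mulr_ge0// ltW.
    by rewrite ler_nat geq_minr.
  rewrite ler_norml; move: (2 * r / N%:R * (minn (v i) N)%:R) h1 h2 => q h1 h2.
  by apply/andP; split; lra.
have Xadj v a : (forall k, (v k <= a k <= (v k).+1)%N) -> `|X a - X v| < eta.
  move=> Ha; apply: le_lt_trans mesh; apply: norm_le_coord.
    by rewrite divr_ge0 ?mulr_ge0 ?ltW.
  move=> i; rewrite !mxE opprD addrACA subrr add0r -mulrBr normrM ger0_norm; last first.
    by rewrite divr_ge0 ?mulr_ge0 ?ltW.
  rewrite -[leRHS]mulr1; apply: ler_wpM2l; first by rewrite divr_ge0 ?mulr_ge0 ?ltW.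
  have /andP[a1 a2] := Ha i.
  have l1 : (minn (v i) N <= minn (a i) N)%N by lia.
  rewrite ger0_norm ?subr_ge0 ?ler_nat// -natrB// -[leRHS]/(1%:R) ler_nat; lia.
pose cell (c : 'I_n.+1) (z : 'rV[R]_n) (i : 'I_n) := Num.floor (z 0 i / m - c%:R / n.+1%:R).
pose P (c : 'I_n.+1) z := exists2 y, `|y - v0| <= r & y 0 c = v0 0 c - r /\ forall i, cell c (g y) i = cell c z i.
pose f (c : 'I_n.+1) (v : 'I_n.+1 -> nat) : 'F_2 := if `[< P c (g (X v)) >] then 0 else 1.
have f0 c v : v c = 0%N -> f c v = 0.
  move=> vc; rewrite /f; case: asboolP => // nP; exfalso; apply: nP; exists (X v) => //; split => //.
  by rewrite mxE vc min0n mulr0 addr0.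
have f1 c v : v c = N -> f c v = 1.
  move=> vc; rewrite /f; case: asboolP => // -[y yr [yc yi]]; exfalso.
  have gl : `|g y - g (X v)| < m.
    apply: norm_lt_coord => // i; rewrite sub_entry.
    have := floor_same (yi i); rewrite opprB addrA subrK -mulrBl normrM normfV (gtr0_norm m0).
    by rewrite ltr_pdivrMr// mul1r.
  have := Hm y (X v) yr (XQ v) gl; have := coord_le_norm (y - X v) c.
  rewrite sub_entry yc mxE vc minnn divfK ?gt_eqF// opprD addrA subrr add0r.
  rewrite normrN (ger0_norm (mulr_ge0 (ler0n _ 2) (ltW r0))) => h1 h2; have := le_lt_trans h1 h2.
  by apply/negP; rewrite -leNgt ler_peMl ?ler1n// ltW.
have [v Hv] := grid_poincare_miranda f0 f1.
have [c Hc] := good_colour (fun i => g (X v) 0 i / m).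
have [a [b [Ha Hb]]] := Hv c.
have same (a' : 'I_n.+1 -> nat) : (forall k, (v k <= a' k <= (v k).+1)%N) -> f c a' = f c v.
  move=> Ha'; have h := He _ _ (XQ a') (XQ v) (Xadj v a' Ha').
  have E i : cell c (g (X a')) i = cell c (g (X v)) i.
    have [c1 c2] := Hc i; apply: (floor_stable c1 c2).
    rewrite opprB addrA subrK -mulrBl normrM normfV (gtr0_norm m0) ltr_pdivrMr// mulrC.
    by rewrite -sub_entry; apply: le_lt_trans h; exact: coord_le_norm.
  rewrite /f; congr (if _ then _ else _); apply: asbool_equiv_eq.
  by split=> -[y yr [yc yi]]; exists y => //; split => // i; rewrite yi E.
by rewrite (same a Ha) (same b Hb) eqxx.
Qed.

End Dimension.

(** * Analytic parametrization of a hypersurface *)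

Section Slice.
Context {R : realType} {n : nat}.
Implicit Types (f g h w : 'rV[R]_n.+1 -> R) (x y : 'rV[R]_n.+1) (z : 'rV[R]_n).

(** The points with last coordinate 0: these are the points of the hypersurface w = 0 in the
    chart. *)
Definition insert0 z : 'rV[R]_n.+1 := \row_i (if unlift ord_max i is Some k then z 0 k else 0).
Definition omit (j : 'I_n.+1) x : 'rV[R]_n := \row_k x 0 (lift j k).

Lemma insert0_lift z k : insert0 z 0 (lift ord_max k) = z 0 k. Proof. by rewrite mxE liftK. Qed.
Lemma insert0_max z : insert0 z 0 ord_max = 0. Proof. by rewrite mxE unlift_none. Qed.

Lemma insert0_line z (t : R) k : insert0 (z + t *: delta_mx 0 k) = insert0 z + t *: delta_mx 0 (lift ord_max k).
Proof.
apply: (row_ext_lift (j := ord_max)) => [|l].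
  by rewrite insert0_max mxE insert0_max !mxE eqxx /= (negbTE (neq_lift _ _)) mulr0 addr0.
by rewrite insert0_lift !mxE liftK !eqxx /= (inj_eq lift_inj).
Qed.

Lemma insert0_dist z z' : `|insert0 z - insert0 z'| <= `|z - z'|.
Proof.
apply: norm_le_coord => // i; rewrite sub_entry; case: (unliftP ord_max i) => [k ->|->].
  by rewrite !insert0_lift -sub_entry coord_le_norm.
by rewrite !insert0_max subrr normr0.
Qed.

Lemma partial_insert0 f k : partial k (fun z => f (insert0 z)) = (fun z => partial (lift ord_max k) f (insert0 z)).
Proof.
apply/funext => z; rewrite /partial /derive.
suff -> : (fun h : R => h^-1 *: (((fun z => f (insert0 z)) \o shift z) (h *: delta_mx 0 k) - f (insert0 z)))
  = (fun h : R => h^-1 *: ((f \o shift (insert0 z)) (h *: delta_mx 0 (lift ord_max k)) - f (insert0 z))) by [].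
by apply/funext => h /=; rewrite (addrC _ z) insert0_line (addrC (insert0 z)).
Qed.

Lemma is_derive_insert0 f k z df : is_derive (insert0 z) (delta_mx 0 (lift ord_max k)) f df ->
  is_derive z (delta_mx 0 k) (fun z => f (insert0 z)) df.
Proof.
move/is_deriveP => H; apply/is_deriveP => e /H[r r0 rH]; exists r => // s s0 sr.
by rewrite insert0_line; exact: rH.
Qed.

Lemma partials_insert0 f J : partials J (fun z => f (insert0 z)) = (fun z => partials [seq lift ord_max k | k <- J] f (insert0 z)).
Proof. by elim: J => //= k J ->; rewrite partial_insert0. Qed.

Lemma Ck_insert0 k f (S : set 'rV[R]_n) (S' : set 'rV[R]_n.+1) : (forall z, S z -> S' (insert0 z)) ->
  Ck k S' f -> Ck k S (fun z => f (insert0 z)).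
Proof.
move=> SS; have C0 g : (forall x, S' x -> {for x, continuous g}) ->
  forall z, S z -> {for z, continuous (fun z => g (insert0 z))}.
  move=> Hg z /SS Sz; apply/continuous_atP => e e0.
  have [r r0 rH] := (continuous_atP _ _).1 (Hg _ Sz) e e0.
  by exists r => // y yz; apply: rH; apply: le_lt_trans yz; exact: insert0_dist.
elim: k f => [|k IH] f Hf; first by split=> //; apply: C0 => x; exact: Ck_cont Hf.
split; first by apply: C0 => x; exact: Ck_cont Hf.
split=> [z /SS Sz j|j].
  by have [] := is_derive_insert0 (Ck_is_derive (lift ord_max j) Hf Sz).
rewrite partial_insert0; apply: IH; exact: Ck_partial.
Qed.

Lemma ana_insert0 f z : ana_at f (insert0 z) -> ana_at (fun z => f (insert0 z)) z.
Proof.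
move=> [r [M [C [r0 M0 C0 Sf Bf]]]].
have sub z' : cube z r z' -> cube (insert0 z) r (insert0 z').
  by rewrite /cube/=; apply: le_lt_trans; exact: insert0_dist.
exists r, M, C; split=> //; first by move=> k; exact: Ck_insert0 sub (Sf k).
move=> J z' /sub z'r; rewrite partials_insert0; have := Bf [seq lift ord_max k | k <- J] _ z'r.
by rewrite size_map.
Qed.

(** The map th parametrizes the zero set of w in W by the coordinates other than the j-th.
    *)
Definition sliced (j : 'I_n.+1) w p (W : set 'rV[R]_n.+1) (s : R) (th : 'rV[R]_n -> 'rV[R]_n.+1) : Prop :=
  let Q := cube (omit j p) s in
  [/\ (forall x, W x -> w x = 0 -> Q (omit j x) /\ th (omit j x) = x) &
      (forall z, Q z -> [/\ W (th z), w (th z) = 0 & omit j (th z) = z])] /\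
  [/\ (forall z, Q z -> {for z, continuous th}),
      (forall h, (forall x, W x -> ana_at h x) -> forall z, Q z -> ana_at (fun z => h (th z)) z) &
      (forall h k z, (forall x, W x -> ana_at h x) -> Q z ->
         partial k (fun z => h (th z)) z = partial (lift j k) h (th z)
           - partial (lift j k) w (th z) / partial j w (th z) * partial j h (th z))].

Lemma slice (j : 'I_n.+1) w p (rho : R) : ana_at w p -> w p = 0 -> partial j w p != 0 -> 0 < rho ->
  exists W s psi th, [/\ chart j w p W s psi, W `<=` cube p rho, (forall x, W x -> ana_at w x) &
    sliced j w p W s th].
Proof.
move=> Aw wp D0 rho0.
have [W [s [psi [H Wsub AW]]]] := straighten Aw wp D0 rho0.
exists W, s, psi, (fun z => psi (insert0 z)); split=> //.
have [[_ _ s0 A5 B1] [B3 B4 B5]] := H.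
have dropE x : w x = 0 -> insert0 (omit j x) = to_chart j w x.
  move=> wx; apply: (row_ext_lift (j := ord_max)) => [|k].
    by rewrite insert0_max to_chart_max.
  by rewrite insert0_lift to_chart_lift mxE.
have dropd x y : `|omit j x - omit j y| <= `|to_chart j w x - to_chart j w y|.
  apply: norm_le_coord => // k; have := coord_le_norm (to_chart j w x - to_chart j w y) (lift ord_max k).
  by rewrite !sub_entry !to_chart_lift !mxE.
have inC z : cube (omit j p) s z -> cube (to_chart j w p) s (insert0 z).
  by rewrite /cube/= -(dropE p wp); apply: le_lt_trans; exact: insert0_dist.
split; split=> //.
- move=> x Wx wx; have [C1 C2] := A5 x Wx; rewrite dropE//; split=> //.
  by rewrite /cube/=; apply: le_lt_trans C1; exact: dropd.
- move=> z /inC Cz; have [Wz Ez] := B1 _ Cz; split=> //.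
    by rewrite -(to_chart_max j w) Ez insert0_max.
  by apply/rowP => k; rewrite mxE -(to_chart_lift j w) Ez insert0_lift.
- move=> z /inC Cz; apply/continuous_atP => e e0.
  have [r r0 rH] := (continuous_atP _ _).1 (B3 _ Cz) e e0.
  by exists r => // z' zz; apply: rH; apply: le_lt_trans zz; exact: insert0_dist.
- by move=> h Ah z /inC Cz; apply: (@ana_insert0 (fun y => h (psi y))); exact: B4.
- move=> h k z Ah /inC Cz; have := partial_insert0 (fun y => h (psi y)) k.
  by move=> /(congr1 (fun F => F z)) -> ; exact: B5.
Qed.

End Slice.

(** * Analytic functions vanishing on a cell *)

Section Vanish.
Context {R : realType}.

Lemma rV0_eq (x y : 'rV[R]_0) : x = y.
Proof. by apply/rowP => -[]. Qed.

(** Words have lengths in nat, so there is a point of the family with the shortest word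
    satisfying P. *)
Lemma min_order (T : Type) d (V : set T) (P : seq 'I_d -> T -> Prop) v J :
  V v -> P J v -> exists J0 v0, [/\ V v0, P J0 v0 &
    forall J' v', V v' -> (size J' < size J0)%N -> ~ P J' v'].
Proof.
move=> Vv Pv.
have ex : exists k, `[< exists J v, [/\ V v, P J v & size J = k] >].
  by exists (size J); apply/asboolP; exists J, v.
case: (ex_minnP ex) => k /asboolP[J0 [v0 [V0 P0 sk]]] kmin.
exists J0, v0; split=> // J' v' V' s' P'.
have ex' : exists J v, [/\ V v, P J v & size J = size J'] by exists J', v'.
by have := kmin (size J') (asboolT ex'); rewrite -sk leqNgt s'.
Qed.

Lemma cell_shrink n m (V : set 'rV[R]_n) (W : set 'rV[R]_m) (g : 'rV[R]_n -> 'rV[R]_m) v :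
  cell V g -> V v -> open W -> W (g v) ->
  exists e, [/\ 0 < e, cell (cube v e) g & forall v', cube v e v' -> V v' /\ W (g v')].
Proof.
move=> [oV Cg inj] Vv oW Wg.
have [r1 r10 H1] := (openP V).1 oV v Vv.
have [r2 r20 H2] := (openP W).1 oW _ Wg.
have [r3 r30 H3] := (continuous_atP _ _).1 (Cg _ Vv) _ r20.
have sub v' : cube v (Num.min r1 r3) v' -> V v' /\ W (g v').
  rewrite /cube/= lt_min => /andP[v1 v3]; split; first exact/H1/ltW.
  exact/H2/ltW/H3.
exists (Num.min r1 r3); split=> //; first by rewrite lt_min r10.
split; first exact: open_cube.
  by move=> v' /sub[/Cg].
by move=> a b /sub[Va _] /sub[Vb _]; exact: inj.
Qed.

Lemma omit_cont n m (j : 'I_m.+1) (g : 'rV[R]_n -> 'rV[R]_m.+1) v :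
  {for v, continuous g} -> {for v, continuous (fun v => omit j (g v))}.
Proof.
move=> Cg; apply/continuous_atP => e e0.
have [r r0 H] := (continuous_atP _ _).1 Cg _ e0; exists r => // y /H.
apply: le_lt_trans; apply: norm_le_coord => // k.
by rewrite sub_entry !mxE -sub_entry; exact: coord_le_norm.
Qed.

(** On a hypersurface the projection along the j-th axis is injective. *)
Lemma cell_omit n m (j : 'I_m.+1) w p W s th (V : set 'rV[R]_n) (g : 'rV[R]_n -> 'rV[R]_m.+1) :
  sliced j w p W s th -> cell V g -> (forall v, V v -> W (g v) /\ w (g v) = 0) ->
  cell V (fun v => omit j (g v)).
Proof.
move=> [[T1 _] _] [oV Cg inj] H; split=> // [v Vv|x y Vx Vy E]; first exact/omit_cont/Cg.
have [Wx wx] := H x Vx; have [Wy wy] := H y Vy; apply: inj => //.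
by have [_ <-] := T1 _ Wx wx; have [_ <-] := T1 _ Wy wy; rewrite E.
Qed.

(** At a point of the cell where f has the lowest order of vanishing, write the word of a
    nonzero derivative as i :: I. The derivative along I vanishes on the whole cell, so near
    this point the cell lies in a hypersurface of dimension n - 1, which invariance of dimension
    forbids. *)
Lemma vanish_on_cell n (V : set 'rV[R]_n) (g : 'rV[R]_n -> 'rV[R]_n) (f : 'rV[R]_n -> R) :
  cell V g -> (forall v, V v -> ana_at f (g v)) -> (forall v, V v -> f (g v) = 0) ->
  forall v, V v -> forall J, partials J f (g v) = 0.
Proof.
case: n V g f => [|n] V g f Vg Af f0 v Vv J.
  by case: J => [|[]//]; exact: f0.
apply/eqP; apply: contrapT => /negP nz.
have [J0 [v0 [Vv0 nz0 Jmin]]] := @min_order _ _ V (fun J v => partials J f (g v) != 0) v J Vv nz.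
case: J0 nz0 Jmin => [|i I] nz0 Jmin; first by move: nz0; rewrite /= f0// eqxx.
have wz v' : V v' -> partials I f (g v') = 0.
  by move=> V'; apply/eqP; apply: contrapT => /negP; exact: Jmin.
have [W [s [psi [th [[[oW Wp _ _ _] _] _ _ Hs]]]]] :=
  slice (ana_partials I (Af _ Vv0)) (wz _ Vv0) nz0 ltr01.
have [e [e0 Ce He]] := cell_shrink Vg Vv0 oW Wp.
apply: (no_drop_of_dimension (cell_omit Hs Ce _)) (cube_center v0 e0) => y /He[Vy Wy].
by split=> //; exact: wz.
Qed.

(** In the coordinates of the hypersurface the cell has full dimension. *)
Lemma vanish_on_slice n (j : 'I_n.+1) w p W s th (V : set 'rV[R]_n) (g : 'rV[R]_n -> 'rV[R]_n.+1) h :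
  sliced j w p W s th -> cell V g -> (forall v, V v -> W (g v) /\ w (g v) = 0) ->
  (forall x, W x -> ana_at h x) -> (forall v, V v -> h (g v) = 0) ->
  forall v, V v -> forall J, partials J (fun z => h (th z)) (omit j (g v)) = 0.
Proof.
move=> Hs Vg H Ah h0; have [[T1 _] [_ T4 _]] := Hs.
have T v : V v -> cube (omit j p) s (omit j (g v)) /\ th (omit j (g v)) = g v.
  by move=> /H[Wv wv]; exact: T1.
apply: (vanish_on_cell (cell_omit Hs Vg H)) => v Vv; have [Cv Ev] := T v Vv.
  exact: T4.
by rewrite Ev h0.
Qed.

End Vanish.

(** * Countability of the critical values *)

Section CriticalValues.
Context {R : realType}.

(** Countably many cubes, with rational centres and radii 1 / (k + 1), suffice. *)
Lemma countable_of_local n (D : set 'rV[R]_n) (f : 'rV[R]_n -> R) :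
  (forall x, D x -> exists2 e, 0 < e & countable (f @` (D `&` cube x e))) -> countable (f @` D).
Proof.
move=> H.
pose B (a : 'rV[rat]_n * nat) : set 'rV[R]_n := cube (map_mx ratr a.1) (a.2.+1%:R^-1).
pose G : set ('rV[rat]_n * nat) := [set a | countable (f @` (D `&` B a))].
apply: (@sub_countable _ _ _ (\bigcup_(a in G) (f @` (D `&` B a)))); last first.
  by apply: bigcup_countable => //; exact: countableP.
apply: subset_card_le => _ [x Dx <-].
have [e e0 He] := H x Dx.
have [k Hk] : exists k : nat, (k.+1%:R)^-1 < e / 2 :> R.
  exists (Num.bound (2 / e)).
  have b0 : 2 / e < (Num.bound (2 / e))%:R by apply: archi_boundP; rewrite divr_ge0// ltW.
  rewrite -[e / 2]invrK ltf_pV2 ?posrE ?ltr0n//; last by rewrite invr_gt0 divr_gt0.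
  by rewrite invf_div; apply: lt_trans b0 _; rewrite ltr_nat.
have k0 : 0 < k.+1%:R^-1 :> R by rewrite invr_gt0 ltr0n.
have rat_near (t d : R) : 0 < d -> exists q : rat, `|t - ratr q| < d.
  move=> d0; have := @rat_in_itvoo R (t - d) (t + d).
  have -> : t - d < t + d by lra.
  move=> /(_ isT)[q]; rewrite in_itv/= => /andP[q1 q2]; exists q.
  by rewrite ltr_norml; apply/andP; split; lra.
have [q Hq] := @choice _ _ (fun i q => `|x 0 i - ratr q| < k.+1%:R^-1) (fun i => rat_near (x 0 i) _ k0).
pose a : 'rV[rat]_n * nat := (\row_i q i, k).
have xB : B a x.
  rewrite /B /cube/=; apply: norm_lt_coord => // i.
  by rewrite sub_entry !mxE; exact: Hq.
exists a; last by exists x.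
apply: sub_countable He; apply: subset_card_le => _ [y [Dy By] <-]; exists y => //; split=> //.
move: xB By; rewrite /B /cube/=; set c := map_mx _ _ => xB By.
have -> : y - x = (y - c) - (x - c) by rewrite opprB addrA subrK.
apply: (le_lt_trans (ler_normB _ _)); rewrite (splitr e); apply: ltrD.
  exact: lt_trans By Hk.
exact: lt_trans xB Hk.
Qed.

(** Induction on n. Near a point where all derivatives of positive order vanish the function
    is constant. At any other critical point the shortest nonempty word with a nonzero
    derivative is i :: K with K nonempty, so that the derivative along K is 0 and the one along
    i :: K is not. The critical points with the same (K, i) lie locally on a slice, on which f
    is an analytic function of fewer variables and they are critical points of it. There are
    countably many pairs (K, i). *)
Lemma countable_critical_values n (S : set 'rV[R]_n) (f : 'rV[R]_n -> R) :
  open S -> (forall x, S x -> ana_at f x) ->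
  countable (f @` [set x | S x /\ forall i, partial i f x = 0]).
Proof.
elim: n S f => [|n IH] S f oS Af.
  apply: (@sub_countable _ _ _ [set f 0]); last exact: finite_set_countable.
  by apply: subset_card_le => _ [x _ <-]; rewrite (rV0_eq x 0).
set C := [set x | _].
pose D (a : seq 'I_n.+1 * 'I_n.+1) : set 'rV[R]_n.+1 :=
  [set x | C x /\ partials a.1 f x = 0 /\ partial a.2 (partials a.1 f) x != 0].
pose D0 : set 'rV[R]_n.+1 := [set x | C x /\ forall J, J != [::] -> partials J f x = 0].
(* The index None stands for the points where all derivatives of positive order vanish. *)
pose E o := if o is Some a then D a else D0.
apply: (@sub_countable _ _ _ (\bigcup_(o in setT) (f @` E o))).
  apply: subset_card_le => _ [x Cx <-].
  have [x0|nx0] := pselect (D0 x); first by exists None => //; exists x.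
  have [J [J0 Jx]] : exists J, J != [::] /\ partials J f x != 0.
    apply: contrapT => H; apply: nx0; split=> // J J0; apply/eqP; apply: contrapT => /negP Jx.
    by apply: H; exists J.
  have [J1 [[] [_ [J10 J1x] Jmin]]] :=
    @min_order unit _ setT (fun J _ => J != [::] /\ partials J f x != 0) tt J I (conj J0 Jx).
  case: J1 J10 J1x Jmin => [//|i K] _ J1x Jmin.
  exists (Some (K, i)) => //; exists x => //; split=> //; split=> //=.
  have [K0|K0] := eqVneq K [::]; first by move: J1x; rewrite K0 /= Cx.2 eqxx.
  by apply/eqP; apply: contrapT => /negP Kx; apply: (Jmin K tt).
apply: bigcup_countable => [|[[K i]|] _]; first exact: countableP; last first.
  apply: countable_of_local => x [[Sx _] x0].
  have Ag := ana_lin 1 (-1) (Af x Sx) (ana_cst (f x) x).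
  have [|e e0 He] := ana_flat Ag.
    move=> J; have [->|J0] := eqVneq J [::]; first by rewrite /= mul1r mulN1r subrr.
    have [r [M [C1 [r0 _ _ Sf _]]]] := Af x Sx.
    rewrite (partials_lin 1 (-1) J (open_cube (x := x) (r := r)) Sf (@smooth_cst _ _ _ (f x)) (cube_center x r0)).
    by rewrite partials_cst// x0// !mulr0 addr0.
  exists e => //; apply: (@sub_countable _ _ _ [set f x]); last exact: finite_set_countable.
  apply: subset_card_le => _ [y [_ /He] + <-].
  by rewrite mul1r mulN1r => /subr0_eq.
apply: countable_of_local => x [[Sx xc] [/= wx Dx]].
have [rho rho0 Hrho] := (openP S).1 oS x Sx.
have [W [s [psi [th [[[oW Wp _ _ _] _] Wsub _ [[T1 _] [_ T4 T5]]]]]]] := slice (ana_partials K (Af _ Sx)) wx Dx rho0.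
have [e e0 He] := (openP W).1 oW x Wp.
exists e => //.
have WS y : W y -> S y by move=> /Wsub/ltW/Hrho.
have AfW y : W y -> ana_at f y by move=> /WS/Af.
apply: sub_countable (IH (cube (omit i x) s) (fun z => f (th z)) (open_cube (x := omit i x) (r := s)) (T4 f AfW)).
apply: subset_card_le => _ [y [[[Sy yc] [/= wy _]] ye] <-].
have Wy : W y by apply: He; exact: ltW.
have [Cz Ez] := T1 y Wy wy.
exists (omit i y); last by rewrite Ez.
split=> // k; rewrite (T5 f k _ AfW Cz) Ez !yc mulr0 subrr//.
Qed.

End CriticalValues.

(** * Connected components *)

Section Components.
Context {R : realType}.

(** A nontrivial interval has positive Lebesgue measure. *)
Lemma countable_interval_trivial (E : set R) : is_interval E -> countable E ->
  forall a b, E a -> E b -> a = b.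
Proof.
move=> iE cE.
suff H a b : E a -> E b -> a < b -> False.
  by move=> a b Ea Eb; case: (ltgtP a b) => // ab; exfalso; [exact: H ab|exact: H ab].
move=> Ea Eb ab.
have sub : `[a, b]%classic `<=` E by move=> t; rewrite /= in_itv /= => tab; exact: iE Ea Eb _ tab.
have := countable_lebesgue_measure0 (sub_countable (subset_card_le sub) cE).
rewrite lebesgue_measure_itv /= lte_fin ab => /eqP.
by rewrite -EFinB eqe subr_eq0 gt_eqF.
Qed.

(** The image of the path is connected. *)
Lemma component_path (T : topologicalType) (X A : set T) (q : T) (gam : R -> T) :
  is_component X A -> A q -> gam 0 = q ->
  (forall t, 0 <= t <= 1 -> X (gam t)) -> (forall t, 0 <= t <= 1 -> {for t, continuous gam}) ->
  A (gam 1).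
Proof.
move=> [x Xx ->] Aq g0 gX gC.
rewrite (same_connected_component Aq).
have C : connected (gam @` `[0, 1]%classic).
  apply: connected_continuous_connected; first exact: segment_connected.
  by apply: continuous_in_subspaceT => t /[1!inE]; rewrite /= in_itv /=; exact: gC.
refine (connected_component_max _ _ C _).
- by exists 0 => //; rewrite /= in_itv /= lexx ler01.
- by move=> _ [t + <-]; rewrite /= in_itv /=; exact: gX.
- by exists 1 => //; rewrite /= in_itv /= lexx ler01.
Qed.

Lemma component_sub (T : topologicalType) (X A : set T) : is_component X A -> A `<=` X.
Proof. by move=> [x Xx ->]; exact: connected_component_sub. Qed.

Lemma component_conn (T : topologicalType) (X A : set T) : is_component X A -> connected A.
Proof. by move=> [x Xx ->]; exact: component_connected. Qed.

(** A nonempty clopen part of the set A with x adjoined cannot be reduced to x, which is a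
    limit of A. So it meets A, hence contains A, and being closed it contains x. *)
Lemma connected_adjoin (T : topologicalType) (A : set T) (x : T) :
  connected A -> closure A x -> connected (A `|` [set x]).
Proof.
move=> cA clx B B0 [C oC BC] [D cD BD].
have [[y [Ay Cy]]|H] := pselect (A `&` C !=set0).
  have E : A `&` C = A.
    apply: cA; [by exists y|by exists C|exists D => //].
    apply/seteqP; split=> z [Az Cz]; split=> //.
      by have : B z by [rewrite BC; split => //; left|]; rewrite BD => -[].
    by have : B z by [rewrite BD; split => //; left|]; rewrite BC => -[].
  have AD : A `<=` D.
    by move=> z; rewrite -E => -[Az Cz]; have : B z by [rewrite BC; split => //; left|]; rewrite BD => -[].
  have Dx : D x by rewrite (closure_id D).1//; exact: closure_subset AD _ clx.
  by rewrite BD; apply/seteqP; split=> [z []//|z [Az|->]]; split=> //; [left|exact: AD|right].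
exfalso; have [y By] := B0; have : (A `|` [set x]) y /\ C y by rewrite BC in By.
move=> [[Ay|->] Cy]; first by apply: H; exists y.
by apply: H; apply: clx; exact: open_nbhs_nbhs.
Qed.

Lemma component_closed_in (T : topologicalType) (X A : set T) :
  is_component X A -> closure A `&` X `<=` A.
Proof.
move=> [x0 Xx0 ->] x [clA Xx].
have C := connected_adjoin (component_connected (A := X) (x := x0)) clA.
refine (connected_component_max _ _ C _).
- by left; exact: connected_component_refl.
- by move=> y [/connected_component_sub//|->].
- by right.
Qed.

Lemma continuous_at_open d m (V : set 'rV[R]_d) (g : 'rV[R]_d -> 'rV[R]_m) v :
  open V -> {within V, continuous g} -> V v -> {for v, continuous g}.
Proof.
move=> oV; rewrite (continuous_open_subspace g oV) => H Vv; apply: H; by rewrite inE.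
Qed.

Lemma cont_comp_path d m (th : 'rV[R]_d -> 'rV[R]_m) (gam : R -> 'rV[R]_d) (t : R) :
  {for t, continuous gam} -> {for gam t, continuous th} -> {for t, continuous (fun t => th (gam t))}.
Proof.
move=> Cg Ct; apply/continuous_atP => e e0.
have [r r0 H] := (continuous_atP _ _).1 Ct e e0.
have [r' r'0 H'] := (continuous_atP _ _).1 Cg r r0.
by exists r' => // s /H'; exact: H.
Qed.

End Components.

(** * Components of the critical set of an eigenfunction *)

Section Main.
Context {R : realType} {n : nat}.
Variables (Omega : set 'rV[R]_n.+1) (oO : open Omega) (u : 'rV[R]_n.+1 -> R) (lam : R).
Hypothesis lam0 : lam != 0.
Hypothesis Hu : solves_eigen Omega lam u.
Variable A : set 'rV[R]_n.+1.
Hypothesis cA : is_component (crit Omega u) A.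
Implicit Types (x y p q : 'rV[R]_n.+1).

Lemma ana_u x : Omega x -> ana_at u x. Proof. exact: ana_sol oO Hu. Qed.

Lemma critP x : crit Omega u x <-> Omega x /\ forall i, partial i u x = 0.
Proof.
split=> [[Ox /rowP g0]|[Ox H]]; split=> //; first by move=> i; have := g0 i; rewrite !mxE.
by apply/rowP => i; rewrite !mxE.
Qed.

Lemma component_Omega x : A x -> Omega x. Proof. by move/(component_sub cA)/critP => []. Qed.
Lemma component_crit x i : A x -> partial i u x = 0. Proof. by move/(component_sub cA)/critP => []. Qed.

(** Components are closed in the critical set, and the critical set is closed in Omega. *)
Lemma component_closed_Omega : closed_in Omega A.
Proof.
exists (closure A); first exact: closed_closure.
apply/seteqP; split=> x.
  by move=> Ax; split; [exact: subset_closure|exact: component_Omega].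
move=> [clx Ox]; apply: (component_closed_in cA); split=> //; apply/critP; split=> // i.
apply/eqP; rewrite -normr_le0; apply/ler_addgt0Pr => e e0; rewrite add0r.
have [r r0 H] := (continuous_atP _ _).1 (ana_cont (ana_partial i (ana_u Ox))) e e0.
have [y [Ay /H]] := clx _ (@nbhs_cube R n.+1 x r r0).
by rewrite component_crit// sub0r normrN => /ltW.
Qed.

(** The image of the component is an interval of critical values, and these are countable.
    *)
Lemma constant_on_component x y : A x -> A y -> u x = u y.
Proof.
move=> Ax Ay.
have C : connected (u @` A).
  apply: connected_continuous_connected (component_conn cA) _.
  by apply: continuous_in_subspaceT => z /[1!inE] Az; exact: ana_cont (ana_u (component_Omega Az)).
have I := (connected_intervalP _).1 C.
have K : countable (u @` A).
  apply: sub_countable (countable_critical_values oO ana_u).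
  by apply: subset_card_le => _ [z Az <-]; exists z => //; apply/critP; exact: component_sub cA _ Az.
by apply: (countable_interval_trivial I K); [exists x|exists y].
Qed.

Lemma partials_commute i I J x : Omega x -> partials (i :: I ++ J) u x = partials (I ++ i :: J) u x.
Proof.
elim: I x => [//|l I IH] x Ox.
have S : Ck 2 Omega (partials (I ++ J) u) by exact: (smooth_partials _ (sol_smooth oO Hu)).
apply: (etrans (schwarz i l oO S Ox)).
apply: esym; apply: (partial_eq_open oO _ Ox); first exact: IH.
by apply: Ck_derivable Ox; exact: (smooth_partials (i :: I ++ J) (sol_smooth oO Hu) 1%N).
Qed.

(** Otherwise take a point p of the cell with the lowest order m + 1 of vanishing, which is
    at least 2 since the cell consists of critical points. All derivatives of order m vanish on
    the cell, which near p lies in the hypersurface where one of them, w, is 0; so they vanish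
    on this hypersurface to infinite order at p, and their gradients are multiples of a conormal
    vector nu. By commutation the derivative of order m + 1 of u at p along a word is a constant
    T times the product of the entries of nu named by its letters. Since u is an eigenfunction,
    the sum of the derivatives of order m + 1 along the words l :: l :: i ... i is a multiple of
    a derivative of order m - 1, hence 0, whereas it is T times the squared length of nu. *)
Lemma flat_of_zero_cell (V : set 'rV[R]_n) (g : 'rV[R]_n -> 'rV[R]_n.+1) :
  cell V g -> (forall v, V v -> A (g v)) -> (forall v, V v -> u (g v) = 0) ->
  forall v, V v -> forall J, partials J u (g v) = 0.
Proof.
move=> Vg gA u0 v Vv J; apply/eqP; apply: contrapT => /negP nz.
have [J0 [v0 [Vv0 nz0 Jmin]]] := @min_order _ _ V (fun J v => partials J u (g v) != 0) v J Vv nz.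
have {}Jmin I v' : V v' -> (size I < size J0)%N -> partials I u (g v') = 0.
  by move=> Vv' sI; apply/eqP; apply: contrapT => /negP; exact: Jmin.
case: J0 nz0 Jmin => [|i I] nz0 Jmin; first by move: nz0; rewrite /= u0// eqxx.
case: I nz0 Jmin => [|i' I'] nz0 Jmin; first by move: nz0; rewrite /= component_crit ?eqxx//; exact: gA.
set I := i' :: I' in nz0 Jmin; set p := g v0 in nz0.
have Op : Omega p by apply: component_Omega; exact: gA.
have [rho rho0 Hrho] := (openP Omega).1 oO p Op.
have wp : partials I u p = 0 by exact: Jmin.
have [W [s [psi [th [[[oW Wp _ _ _] _] Wsub _ Hs]]]]] :=
  slice (ana_partials I (ana_u Op)) wp nz0 rho0.
have WO y : W y -> Omega y by move=> /Wsub/ltW/Hrho.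
have [e [e0 Ce He]] := cell_shrink Vg Vv0 oW Wp.
set w := partials I u in Hs.
have wcell v' : cube v0 e v' -> W (g v') /\ w (g v') = 0.
  by move=> /He[Vv' Wv']; split=> //; exact: Jmin.
(* The conormal of the hypersurface w = 0 at p, normalized so that its i-th entry is 1. *)
pose nu l := if unlift i l is Some k then partial (lift i k) w p / partial i w p else 1.
have tang K l : size K = size I -> partial l (partials K u) p = nu l * partial i (partials K u) p.
  move=> sK; rewrite /nu; case: unliftP => [k ->|->]; last by rewrite mul1r.
  have AK y : W y -> ana_at (partials K u) y by move=> /WO/ana_u; exact: ana_partials.
  have K0 v' : cube v0 e v' -> partials K u (g v') = 0.
    by move=> /He[Vv' _]; apply: Jmin => //; rewrite sK.
  have [[T1 _] [_ _ T5]] := Hs; have [cp Ep] := T1 p Wp wp.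
  have := vanish_on_slice Hs Ce wcell AK K0 (cube_center v0 e0) [:: k].
  by rewrite /= (T5 (partials K u) k _ AK cp) Ep => /subr0_eq.
set m := size I; set T := partials (nseq m.+1 i) u p.
(* The letters of K are replaced by i one at a time, each at the cost of its entry of nu. *)
have powers K r : (size K + r = m.+1)%N -> partials (K ++ nseq r i) u p = (\prod_(l <- K) nu l) * T.
  elim: K r => [|l K IH] r /=; first by rewrite add0n => ->; rewrite big_nil mul1r.
  move=> sK; rewrite big_cons -mulrA -(IH r.+1); last by rewrite addnS -addSn.
  rewrite -(partials_commute i K (nseq r i) Op).
  by apply: tang; rewrite size_cat size_nseq; move: sK; rewrite addSn => -[].
have T0 : T != 0.
  apply: contraNneq nz0 => T0; have := powers (i :: I) 0%N; rewrite addn0 => /(_ erefl).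
  by rewrite cats0 T0 mulr0 => ->.
(* The trace of the derivative of order m + 1, with the other m - 1 letters equal to i. *)
set U := partials (nseq m.-1 i) u.
have HU : solves_eigen Omega lam U by exact: sol_partials.
have lapU := sol_lap HU Op.
have U0 : U p = 0 by apply: Jmin => //; rewrite size_nseq.
have E : \sum_l partial l (partial l U) p = (\sum_l nu l ^+ 2) * T.
  rewrite mulr_suml; apply: eq_bigr => l _.
  have := powers [:: l; l] m.-1; rewrite /= => -> //.
  by rewrite !big_cons big_nil mulr1 expr2.
move: lapU; rewrite E U0 mulr0 oppr0 => /eqP; rewrite mulf_eq0 (negbTE T0) orbF => /eqP S0.
have : 1 <= \sum_l nu l ^+ 2.
  by rewrite (bigD1 i)//= /nu unlift_none expr1n lerDl sumr_ge0// => l _; exact: sqr_ge0.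
by rewrite S0; apply/negP; rewrite -ltNge ltr01.
Qed.

Definition cell_point x := exists (V : set 'rV[R]_n) (g : 'rV[R]_n -> 'rV[R]_n.+1) v,
  [/\ cell V g, V v, g v = x & forall v, V v -> A (g v)].

Definition flattened q := exists (W V : set 'rV[R]_n.+1) (phi psi : 'rV[R]_n.+1 -> 'rV[R]_n.+1),
      [/\ open W, W q & open V] /\
      [/\ inverse_on W V phi psi, analytic_on W phi, analytic_on V psi &
          A `&` W =
            [set x | W x /\ forall j : 'I_n.+1, (n <= j)%N -> phi x 0 j = 0]].

(** Since lam * u q is not 0, some j-th pure second derivative of u does not vanish at q,
    and the component lies near q in the hypersurface where the j-th derivative w of u is 0. All
    first derivatives of u vanish on a cell of critical points in it, so on the whole slice, by
    the identity theorem. As the slice is path connected, it then belongs to the component. *)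
Lemma local_alternative q : A q -> u q != 0 -> exists2 W, open W /\ W q &
  (exists2 x, W x & cell_point x) -> flattened q /\ forall x, A x -> W x -> cell_point x.
Proof.
move=> Aq uq; have Oq := component_Omega Aq.
have [j Dj] : exists j, partial j (partial j u) q != 0.
  apply: contrapT => H; have := sol_lap Hu Oq; rewrite big1.
    by move=> /esym/eqP; rewrite oppr_eq0 mulf_eq0 (negbTE lam0) (negbTE uq).
  by move=> j _; apply/eqP; apply: contrapT => /negP Hj; apply: H; exists j.
have [rho rho0 Hrho] := (openP Omega).1 oO q Oq.
have [W [s [psi [th [[[oW Wq s0 B1 B2] [_ B4 _]] Wsub B3 Hs]]]]] :=
  slice (ana_partial j (ana_u Oq)) (component_crit j Aq) Dj rho0.
have [[T1 T2] [T3 T4 T5]] := Hs.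
set w := partial j u in Hs B1 B2 B3 B4 T1 T2 T5.
have WO y : W y -> Omega y by move=> /Wsub/ltW/Hrho.
have T1A x : A x -> W x -> cube (omit j q) s (omit j x) /\ th (omit j x) = x.
  by move=> Ax Wx; apply: T1 => //; exact: component_crit.
exists W => // -[x Wx [V [g [v [Vg Vv gv gA]]]]]; subst x.
have [e [e0 Ce He]] := cell_shrink Vg Vv oW Wx.
have [cv _] := T1A _ (gA v Vv) Wx.
have Ai i y : W y -> ana_at (partial i u) y by move=> /WO/ana_u; exact: ana_partial.
have flat_i i : forall J, partials J (fun z => partial i u (th z)) (omit j (g v)) = 0.
  apply: (vanish_on_slice Hs Ce _ (Ai i) _ (cube_center v e0)) => v' /He[Vv' Wv'].
    by split=> //; apply: component_crit; exact: gA.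
  by apply: component_crit; exact: gA.
have zero_i i z : cube (omit j q) s z -> partial i u (th z) = 0.
  move=> zs; have Ath z' : cube (omit j q) s z' -> ana_at (fun z => partial i u (th z)) z'.
    exact: (T4 (partial i u) (Ai i)).
  exact: (ana_identity Ath cv (flat_i i) zs).
have [cq Eq] := T1A q Aq Wq.
have thA z : cube (omit j q) s z -> A (th z).
  move=> zs.
  have := @component_path R _ (crit Omega u) A q (fun t : R => th (omit j q + t *: (z - omit j q))) cA Aq.
  rewrite scale0r addr0 scale1r [omit j q + _]addrC subrK; apply=> // t t01.
    have ts := cube_convex cq zs t01; apply/critP; split; last by move=> i; exact: zero_i.
    by apply: WO; have [] := T2 _ ts.
  apply: cont_comp_path; first exact: segment_cont.
  by apply: T3; exact: cube_convex.
split; last first.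
  move=> x Ax Wx'; have [cx Ex] := T1A x Ax Wx'.
  exists (cube (omit j q) s), th, (omit j x); split=> //; split=> //; first exact: open_cube.
  move=> y z ys zs E; by have [_ _ <-] := T2 y ys; have [_ _ <-] := T2 z zs; rewrite E.
exists W, (cube (to_chart j w q) s), (to_chart j w), psi; split; first by split=> //; exact: open_cube.
split.
- split; last by move=> x Wx'; have [] := B1 x Wx'.
  apply/seteqP; split=> [_ [x Wx' <-]|y yV]; first by have [] := B1 x Wx'.
  by have [Wy Ey] := B2 y yV; exists (psi y).
- move=> x Wx' l; apply: ana_analytic_at; case: (unliftP ord_max l) => [k ->|->].
    apply: (@ana_at_eq _ _ (fun y => y 0 (lift j k)) _ _ 1) => //; last exact: ana_coord.
    by move=> y _; rewrite to_chart_lift.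
  apply: (@ana_at_eq _ _ w _ _ 1) => //; last exact: B3.
  by move=> y _; rewrite to_chart_max.
- move=> y yV l; apply: ana_analytic_at; apply: (B4 (fun y => y 0 l)) => //.
  by move=> x _; exact: ana_coord.
apply/seteqP; split=> x [] => [Ax Wx'|Wx' H]; split=> //.
  move=> l nl; have -> : l = ord_max by apply: val_inj; apply/eqP; rewrite eqn_leq nl -ltnS ltn_ord.
  by rewrite to_chart_max; exact: component_crit.
have wx : w x = 0 by have := H ord_max (leqnn _); rewrite to_chart_max.
by have [cx <-] := T1 x Wx' wx; exact: thA.
Qed.

(** The points of A that lie on a cell form an open and closed subset of A. *)
Lemma all_flattened x0 : A x0 -> u x0 != 0 -> cell_point x0 -> forall q, A q -> flattened q.
Proof.
move=> Ax0 ux0 Gx0.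
have uq q : A q -> u q != 0 by move=> Aq; rewrite (constant_on_component Aq Ax0).
pose G : set 'rV[R]_n.+1 := [set x | A x /\ cell_point x].
have GA : G = A.
  apply: (component_conn cA).
  - by exists x0.
  - exists (\bigcup_(W in [set W | open W /\ forall x, A x -> W x -> cell_point x]) W).
      by apply: bigcup_open => W [].
    apply/seteqP; split=> x [Ax Gx]; split=> //.
      have [W [oW Wx] H] := local_alternative Ax (uq x Ax).
      have [_ H2] := H (ex_intro2 _ _ x Wx Gx).
      by exists W.
    by have [W [_ H] Wx] := Gx; exact: H.
  - exists (closure G); first exact: closed_closure.
    apply/seteqP; split=> x [Ax Gx]; split=> //; first by apply: subset_closure; split.
    have [W [oW Wx] H] := local_alternative Ax (uq x Ax).
    have [y [[Ay Gy] Wy]] := Gx _ (open_nbhs_nbhs (conj oW Wx)).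
    by have [_ H2] := H (ex_intro2 _ _ y Wy Gy); exact: H2.
move=> q Aq; have [W [oW Wq] H] := local_alternative Aq (uq q Aq).
have Gq : cell_point q by move: Aq; rewrite -GA => -[].
by have [] := H (ex_intro2 _ _ q Wq Gq).
Qed.

(** If u vanished on the given cell, it would vanish to infinite order there, hence near p.
    Then A would contain a cube around p, and the chart of the manifold would embed it into a
    space of lower dimension. *)
Lemma exists_nonzero_cell (U : set 'rV[R]_n.+1) : open U -> U `&` A !=set0 ->
  topological_manifold n (U `&` A) -> exists x, [/\ A x, u x != 0 & cell_point x].
Proof.
move=> oU [p [Up Ap]] /(_ p (conj Up Ap)) [W [V [f [g [[oW Wp oV] [[fV fg] Cf Cg]]]]]].
have gfx x : (U `&` A `&` W) x -> V (f x) /\ g (f x) = x.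
  by move=> Mx; split; [rewrite -fV; exists x|exact: fg].
have gV v : V v -> (U `&` A `&` W) (g v) /\ f (g v) = v.
  by rewrite -fV => -[x Mx <-]; rewrite (fg x Mx).
have Cg' v : V v -> {for v, continuous g}.
  by move=> Vv; exact: continuous_at_open oV Cg Vv.
have inj a b : V a -> V b -> g a = g b -> a = b.
  by move=> /gV[_ {2}<-] /gV[_ {2}<-] ->.
have gA v : V v -> A (g v) by move=> /gV[[[]]].
have [Vp gp] := gfx p (conj (conj Up Ap) Wp).
have Vg : cell V g by split.
apply: contrapT => H.
have u0 v : V v -> u (g v) = 0.
  move=> Vv; apply/eqP; apply: contrapT => /negP nz; apply: H.
  by exists (g v); split; [exact: gA|done|exists V, g, v].
have fl := flat_of_zero_cell Vg gA u0 Vp; rewrite gp in fl.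
have Op := component_Omega Ap.
have [rho rho0 Hrho] := ana_flat (ana_u Op) fl.
have [r1 r10 H1] := (openP Omega).1 oO p Op.
have [r2 r20 H2] := (openP (U `&` W)).1 (openI oU oW) p (conj Up Wp).
set r := Num.min rho (Num.min r1 r2).
have r0 : 0 < r by rewrite !lt_min rho0 r10.
have s1 : cube p r `<=` cube p rho by apply: cube_sub; rewrite ge_min lexx.
have s2 : cube p r `<=` cube p r1 by apply: cube_sub; rewrite !ge_min lexx orbT.
have s3 : cube p r `<=` cube p r2 by apply: cube_sub; rewrite !ge_min lexx !orbT.
have cr x : cube p r x -> crit Omega u x.
  move=> xr; apply/critP; split; first by apply: H1; apply: ltW; exact: s2.
  by move=> i; exact: (partials_zero [:: i] (open_cube (x := p) (r := rho)) Hrho (s1 _ xr)).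
have cubeA x : cube p r x -> A x.
  move=> xr.
  have := @component_path R _ (crit Omega u) A p (fun t : R => p + t *: (x - p)) cA Ap.
  have E0 : p + 0 *: (x - p) = p by rewrite scale0r addr0.
  have E1 : p + 1 *: (x - p) = x by rewrite scale1r addrC subrK.
  rewrite E1 => K; apply: (K E0) => t t01.
    by apply: cr; apply: (cube_convex (cube_center p r0) xr).
  exact: segment_cont.
have cubeM x : cube p r x -> (U `&` A `&` W) x.
  move=> xr; have [Ux Wx] : (U `&` W) x by apply: H2; apply: ltW; exact: s3.
  by split=> //; split=> //; exact: cubeA.
apply: (@no_drop_of_dimension R n (cube p r) f p); last exact: cube_center.
split; first exact: open_cube.
  move=> y yr; apply: (continuous_at_open (open_cube (x := p) (r := r)) _ yr).
  exact: continuous_subspaceW cubeM Cf.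
by move=> x y /cubeM/gfx[_ {2}<-] /cubeM/gfx[_ {2}<-] ->.
Qed.

End Main.

Theorem theorem4 (R : realType) (d : nat) (hd : (0 < d)%N)
    (Omega : set 'rV[R]_d) (hOmega : open Omega)
    (u : 'rV[R]_d -> R) (lambda : R) (hlambda : lambda != 0)
    (hu : solves_eigen Omega lambda u)
    (A : set 'rV[R]_d) (hA : is_component (crit Omega u) A)
    (hU : exists U : set 'rV[R]_d,
        [/\ open U, U `<=` Omega, U `&` A !=set0 &
            topological_manifold d.-1 (U `&` A)]) :
  proper_analytic_submanifold d.-1 Omega A.
Proof.
case: d hd Omega hOmega u hu A hA hU => [//|n] _ Omega oO u Hu A cA [U [oU _ U0 UM]].
have [x [Ax ux Gx]] := exists_nonzero_cell oO Hu cA oU U0 UM.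
split; last first.
  have H := component_closed_Omega oO Hu cA.
  exact H.
move=> q Aq; exact (all_flattened oO hlambda Hu cA Ax ux Gx Aq).
Qed.
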